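(* Let $S$ be a separable operator system generating a $C^*$-algebra $A$. If $S$ is hyperrigid, then every irreducible representation of $A$ is a boundary representation for $S$. In particular, the boundary ideal of a hyperrigid (separable) operator system must be $\{0\}$.
   Context: An operator system is a self-adjoint linear subspace $S$ of a unital $C^*$-algebra that contains the unit; $C^*(S)$ is the $C^*$-algebra it generates (here $A=C^*(S)$). UCP means unital completely positive. All representations are nondegenerate. A UCP map $\phi:S\to B$ into a unital $C^*$-algebra $B$ has the unique extension property if it has a unique UCP extension $\tilde\phi:C^*(S)\to B$ and moreover this extension is multiplicative. A boundary representation for $S$ is an irreducible representation $\pi:C^*(S)\to\mathcal B(H)$ such that $\pi\restriction_S$ has the unique extension property. The boundary ideal for $S$ is the largest closed two-sided ideal $K\subseteq A=C^*(S)$ such that the quotient map $a\in A\mapsto\dot a\in A/K$ is completely isometric on $S$ (such a largest ideal always exists). A separable operator system $S$ generating $A$ is hyperrigid if for every faithful (nondegenerate) representation of $A$ on a Hilbert space, written as an inclusion $A\subseteq\mathcal B(H)$, and every sequence of UCP maps $\phi_n:\mathcal B(H)\to\mathcal B(H)$, one has: $\lim_n\|\phi_n(s)-s\|=0$ for all $s\in S$ implies $\lim_n\|\phi_n(a)-a\|=0$ for all $a\in A$. *)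

(* Defs.v *)
From HB Require Import structures.
From mathcomp Require Import all_boot all_order all_algebra.
From mathcomp Require Import complex.
From mathcomp Require Import all_classical all_reals all_analysis.
From mathcomp Require Import ring lra.

Set Implicit Arguments.
Unset Strict Implicit.
Unset Printing Implicit Defensive.

Import Order.TTheory GRing.Theory Num.Theory.
Import numFieldNormedType.Exports.

Local Open Scope classical_set_scope.
Local Open Scope ring_scope.

(* Norms in MathComp-Analysis take their values in the scalars, here R[i];
   [hdot] is linear in its first argument and antilinear in its second. *)
HB.mixin Record CompleteNormedModule_isHilbert (R : realType) H
    of CompleteNormedModule R[i] H := {
  hdot : {dot H for (@Num.conj R[i])};
  hdotE : forall x : H, hdot x x = `|x| ^+ 2
}.

#[short(type="hilbertType")]
HB.structure Definition Hilbert (R : realType) :=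
  {H of CompleteNormedModule R[i] H & CompleteNormedModule_isHilbert R H}.

(* Unital complex C*-algebras. The ring operations are fields of the mixin
   because HB does not allow the join of GRing.PzRing and NormedModule; the
   ring structure is recovered by the instance below. *)
HB.mixin Record CompleteNormedModule_isCstar (R : realType) A
    of CompleteNormedModule R[i] A := {
  cstar_one : A;
  cstar_mul : A -> A -> A;
  cstar : A -> A;
  cstar_mulA : associative cstar_mul;
  cstar_mul1x : left_id cstar_one cstar_mul;
  cstar_mulx1 : right_id cstar_one cstar_mul;
  cstar_mulDl : left_distributive cstar_mul +%R;
  cstar_mulDr : right_distributive cstar_mul +%R;
  cstar_scaleAl : forall (a : R[i]) (x y : A), a *: cstar_mul x y = cstar_mul (a *: x) y;
  cstar_scaleAr : forall (a : R[i]) (x y : A), a *: cstar_mul x y = cstar_mul x (a *: y);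
  cstarD : forall x y : A, cstar (x + y) = cstar x + cstar y;
  cstarZ : forall (a : R[i]) (x : A), cstar (a *: x) = Num.conj a *: cstar x;
  cstarM : forall x y : A, cstar (cstar_mul x y) = cstar_mul (cstar y) (cstar x);
  cstarK : involutive cstar;
  cstar_normM : forall x y : A, `|cstar_mul x y| <= `|x| * `|y|;
  cstar_norm : forall x : A, `|cstar_mul (cstar x) x| = `|x| ^+ 2
}.

#[short(type="cstarType")]
HB.structure Definition Cstar (R : realType) :=
  {A of CompleteNormedModule R[i] A & CompleteNormedModule_isCstar R A}.

#[non_forgetful_inheritance]
HB.instance Definition _ (R : realType) (A : cstarType R) :=
  GRing.Zmodule_isPzRing.Build A cstar_mulA cstar_mul1x cstar_mulx1 cstar_mulDl cstar_mulDr.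

Section NormTheory.
Context {R : realType}.
Implicit Types V : normedModType R[i].

Lemma normC_re (a : R[i]) : `|a| = (complex.Re `|a|)%:C%C.
Proof. by rewrite RRe_real// ger0_real. Qed.

(* The norm of a complex normed module, as a real number. *)
Definition rnorm V (x : V) : R := complex.Re `|x|.

Lemma rnormE V (x : V) : `|x| = (rnorm x)%:C%C.
Proof. by rewrite /rnorm RRe_real// ger0_real. Qed.

Lemma rnorm_ge0 V (x : V) : 0 <= rnorm x.
Proof. by rewrite -ler0c -rnormE. Qed.

Lemma rnormD V (x y : V) : rnorm (x + y) <= rnorm x + rnorm y.
Proof. by rewrite -lecR rmorphD /= -!rnormE ler_normD. Qed.

Lemma rnormN V (x : V) : rnorm (- x) = rnorm x.
Proof. by rewrite /rnorm normrN. Qed.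

Lemma rnorm0 V : rnorm (0 : V) = 0.
Proof. by rewrite /rnorm normr0. Qed.

Lemma rnorm_eq0 V (x : V) : rnorm x = 0 -> x = 0.
Proof. by move=> x0; apply/normr0_eq0; rewrite rnormE x0. Qed.

Lemma rnormZ V (a : R[i]) (x : V) :
  rnorm (a *: x) = complex.Re `|a| * rnorm x.
Proof.
by apply: complexI; rewrite -rnormE normrZ rmorphM /= -rnormE -normC_re.
Qed.
End NormTheory.

Section HilbertTheory.
Context {R : realType} {H : hilbertType R}.
Implicit Types x y z : H.

Lemma hdotC x y : hdot y x = Num.conj (hdot x y).
Proof. by rewrite hermC /= expr0 mul1r. Qed.

Lemma hdotDl x y z : hdot (x + y) z = hdot x z + hdot y z.
Proof. exact: linearDl. Qed.

Lemma hdotZl a x z : hdot (a *: x) z = a * hdot x z.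
Proof. exact: linearZl_LR. Qed.

Lemma hdotNl x z : hdot (- x) z = - hdot x z.
Proof. exact: linearNl. Qed.

Lemma hdot_rnorm x : hdot x x = (rnorm x ^+ 2)%:C%C.
Proof. by rewrite hdotE rnormE rmorphXn. Qed.

Lemma rnormD2 x y :
  rnorm (x + y) ^+ 2 = rnorm x ^+ 2 + rnorm y ^+ 2 + complex.Re (hdot x y) *+ 2.
Proof.
have := dnormD hdot x y; rewrite /= !hdot_rnorm => /(congr1 (@complex.Re R)) /=.
by case: (hdot x y) => a b /= ->; rewrite mulr2n.
Qed.

Lemma normc_real (r : R) : 0 <= r -> complex.Re `|r%:C%C : R[i]| = r.
Proof. by move=> r0; rewrite ger0_norm ?ler0c. Qed.

Lemma hdot_CS x y : complex.Re (hdot x y) <= rnorm x * rnorm y.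
Proof.
set a := rnorm x; set b := rnorm y.
have a0 : 0 <= a by exact: rnorm_ge0.
have b0 : 0 <= b by exact: rnorm_ge0.
have [/rnorm_eq0 x0|xn0] := eqVneq a 0.
  by rewrite x0 linear0l /= mulr_ge0.
have [/rnorm_eq0 y0|yn0] := eqVneq b 0.
  by rewrite y0 linear0r /= mulr_ge0.
have ap : 0 < a by rewrite lt_def xn0.
have bp : 0 < b by rewrite lt_def yn0.
have := rnormD2 (b%:C%C *: x) (- (a%:C%C *: y)).
rewrite rnormN !rnormZ !normc_real// -/a -/b linearNr linearZl_LR linearZr_LR /=.
have -> : Num.conj (a%:C%C : R[i]) = a%:C%C by rewrite conj_Creal// ger0_real// ler0c.
have -> : complex.Re (- (b%:C%C * (a%:C%C * hdot x y))) =
          - (b * a * complex.Re (hdot x y)).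
  by case: (hdot x y) => u v /=; ring.
move=> E.
have := sqr_ge0 (rnorm (b%:C%C *: x - a%:C%C *: y)).
rewrite {}E; move: (complex.Re _) => c h.
rewrite -(ler_pM2l (mulr_gt0 bp ap)); rewrite mulr2n in h; nra.
Qed.

End HilbertTheory.

Lemma posC (R : realType) (eps : {posnum R[i]}) :
  exists2 e : R, 0 < e & eps%:num = e%:C%C.
Proof.
have e0 : 0 < eps%:num by [].
have er : (complex.Re eps%:num)%:C%C = eps%:num by apply: RRe_real; exact: gtr0_real.
by exists (complex.Re eps%:num) => //; rewrite -ltcR er.
Qed.

Section Riesz.
Context {R : realType} {H : hilbertType R}.
Variables (phi : H -> R[i]) (M : R).
Hypothesis phi_lin : forall a x y, phi (a *: x + y) = a * phi x + phi y.
Hypothesis phi_bnd : forall x, complex.Re (phi x) <= M * rnorm x.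
Hypothesis M_ge0 : 0 <= M.

Let J x := rnorm x ^+ 2 - complex.Re (phi x) *+ 2.
Let m := inf (range J).

Let J_ge x : - M ^+ 2 <= J x.
Proof.
rewrite /J mulr2n; have := phi_bnd x; have := sqr_ge0 (rnorm x - M).
by rewrite sqrrB mulr2n; nra.
Qed.

Let m_le x : m <= J x.
Proof.
apply: ge_inf; last by exists x.
by exists (- M ^+ 2) => _ [y _ <-]; exact: J_ge.
Qed.

Let J_near d : 0 < d -> exists x, J x < m + d.
Proof.
move=> d0; have hi : has_inf (range J).
  by split; [exists (J 0), 0 | exists (- M ^+ 2) => _ [y _ <-]; exact: J_ge].
by have [_ [x _ <-] xd] := inf_adherent d0 hi; exists x.
Qed.

Let phi0 : phi 0 = 0.
Proof.
have := phi_lin 1 0 0; rewrite scaler0 add0r mul1r => /eqP.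
by rewrite -[X in X == _]addr0 (inj_eq (addrI _)) eq_sym => /eqP.
Qed.

Let phiD x y : phi (x + y) = phi x + phi y.
Proof. by rewrite -[x]scale1r phi_lin scale1r mul1r. Qed.

Let phiZ a x : phi (a *: x) = a * phi x.
Proof. by rewrite -[a *: x]addr0 phi_lin phi0 addr0. Qed.

Let phiN x : phi (- x) = - phi x.
Proof. by rewrite -scaleN1r phiZ mulN1r. Qed.

Let JD x w : J (x + w) = J x + rnorm w ^+ 2
  + complex.Re (hdot w x) *+ 2 - complex.Re (phi w) *+ 2.
Proof.
rewrite /J rnormD2 phiD hdotC.
case: (phi x) (phi w) (hdot w x) => a b [c d] [e f] /=; rewrite !mulr2n; ring.
Qed.

Let parallelogram x y : J x < m + y -> forall z, J z < m + y ->
  rnorm (x - z) ^+ 2 < 4 * y.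
Proof.
move=> xy z zy; set h := (2^-1 : R)%:C%C.
have hh (u : H) : h *: u + h *: u = u.
  rewrite -scalerDl -[RHS]scale1r; congr (_ *: _).
  by rewrite -rmorphD /=; congr (_%:C)%C; field.
set w := h *: (x - z).
have Ew : rnorm (x - z) = 2 * rnorm w.
  by rewrite rnormZ normc_real//; field.
have Ex : J x = J (h *: (x + z) + w).
  by rewrite /w scalerBr scalerDr addrACA subrr addr0 hh.
have Ez : J z = J (h *: (x + z) + - w).
  rewrite /w scalerBr scalerDr opprB [h *: z - h *: x]addrC addrACA subrr.
  by rewrite add0r hh.
have Em := m_le (h *: (x + z)).
move: xy zy; rewrite Ex Ez !JD Ew rnormN => {Ex Ez Ew}.
clearbody w; rewrite hdotNl phiN.
case: (hdot w (h *: (x + z))) (phi w) => [a b] [c d] /=; rewrite !mulr2n => h1 h2.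
move: h1 h2 Em; rewrite exprMn; move: (J _) (rnorm w ^+ 2) => j r h1 h2 Em; lra.
Qed.

Lemma riesz : exists y, forall x, phi x = hdot x y.
Proof.
pose F := filter_from [set e : R | 0 < e] (fun e => [set x | J x < m + e]).
have FF : ProperFilter F.
  apply: filter_from_proper; last by move=> e /J_near [x ?]; exists x.
  apply: filter_from_filter; first by exists 1 => /=.
  move=> i j i0 j0; exists (Num.min i j); first by rewrite /= lt_min i0.
  move=> x /= xij; split => /=; apply: (lt_le_trans xij).
    by rewrite lerD2l ge_min lexx.
  by rewrite lerD2l ge_min lexx orbT.
have FC : cauchy F.
  apply/cauchyP => _/posnumP[eps].
  have [e e0 ->] := posC eps.
  have d0 : 0 < e ^+ 2 / 4 by rewrite divr_gt0 ?exprn_gt0.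
  have [x xd] := J_near d0; exists x.
  exists (e ^+ 2 / 4) => //= y yd.
  rewrite -ball_normE /= rnormE ltcR.
  have := parallelogram xd yd.
  rewrite mulrC divfK// ltr_pXn2r// ?nnegrE ?rnorm_ge0// ltW//.
have [u Fu] : exists u : H, F --> u by apply/cvg_ex; exact: cauchy_cvg.
have near_u e : 0 < e -> forall d, 0 < d ->
    exists2 y, J y < m + e & rnorm (u - y) < d.
  move=> e0 d d0.
  have dC : 0 < (d%:C)%C :> R[i] by rewrite ltcR.
  have [y [/= ye]] : [set x | J x < m + e] `&` ball u d%:C%C !=set0.
    apply: (@filter_ex _ F); apply: filterI; first by exists e.
    by apply: Fu; exact: nbhsx_ballx.
  by rewrite -ball_normE /= rnormE ltcR => yd; exists y.
have Ju_le : J u <= m.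
  suff Ju (e : R) : 0 < e -> J u <= m + e by apply/ler_addgt0Pr.
  move=> e0.
  set B := 2 * (rnorm u + 1 + M) + 1.
  have B0 : 0 < B.
    rewrite /B; move: (rnorm_ge0 u) M_ge0 => u0' M0'. lra.
  pose d := Num.min 1 (e / (2 * B)).
  have d0 : 0 < d by rewrite lt_min ltr01 divr_gt0// mulr_gt0.
  have [y Jy uy] := near_u (e / 2) ltac:(by rewrite divr_gt0) d d0.
  have d1 : d <= 1 by rewrite ge_min lexx.
  have dB : d * B <= e / 2.
    have : d <= e / (2 * B) by rewrite ge_min lexx orbT.
    by rewrite -(ler_pM2r B0) => /le_trans; apply; rewrite le_eqVlt; apply/orP;
      left; apply/eqP; field; rewrite gt_eqF.
  have -> : u = y + (u - y) by rewrite addrC subrK.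
  rewrite JD; set w := u - y in uy *.
  have h1 := hdot_CS w y.
  have h2 : - complex.Re (phi w) <= M * rnorm w.
    by have := phi_bnd (- w); rewrite phiN rnormN; case: (phi w).
  have h3 : rnorm y <= rnorm u + rnorm w.
    have {1}-> : y = u - w by rewrite /w opprB addrC subrK.
    by rewrite -(rnormN w) rnormD.
  have w0 := rnorm_ge0 w; have y0 := rnorm_ge0 y; have u0 := rnorm_ge0 u.
  have h4 : rnorm w * B <= e / 2.
    by apply: le_trans dB; rewrite ler_wpM2r// ltW.
  have h5 : rnorm w <= 1 by apply: le_trans d1; exact: ltW.
  have h6 : rnorm w * rnorm y <= rnorm w * (rnorm u + 1).
    by rewrite ler_wpM2l//; lra.
  have h7 : rnorm w ^+ 2 <= rnorm w by rewrite expr2 ler_piMl.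
  move: h1 h2 h3 h4 h5 h6 h7 (Jy); rewrite /B; lra.
have minu w : 0 <= rnorm w ^+ 2 +
    complex.Re (hdot w u) *+ 2 - complex.Re (phi w) *+ 2.
  move: (m_le (u + w)) Ju_le; rewrite JD !mulr2n => h1 h2; lra.
exists u => z; apply/esym/eqP; rewrite -subr_eq0.
set l := hdot z u - phi z.
have [//|l0] := eqVneq l 0; exfalso.
pose s := (1 + rnorm z ^+ 2)^-1.
have s0 : 0 < s by rewrite invr_gt0 ltr_wpDr// exprn_ge0// rnorm_ge0.
have s1 : s * (1 + rnorm z ^+ 2) = 1.
  by rewrite mulVf// gt_eqF// ltr_wpDr// exprn_ge0// rnorm_ge0.
have := minu ((- s%:C%C * Num.conj l) *: z).
rewrite rnormZ hdotZl phiZ.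
rewrite -addrA -mulrnBl.
have -> : complex.Re (- s%:C%C * Num.conj l * hdot z u)
    - complex.Re (- s%:C%C * Num.conj l * phi z)
    = - s * complex.Re (l * Num.conj l).
  have {3}-> : l = hdot z u - phi z by [].
  case: (hdot z u) (phi z) (Num.conj l) => [a b] [c d] [e f] /=; ring.
rewrite -normCK normrM normrN norm_conjC.
set q := complex.Re `|l|.
have Eq : `|l| = q%:C%C by exact: normC_re.
have q0 : 0 < q by rewrite -ltcR -Eq normr_gt0.
have -> : `|s%:C%C : R[i]| = s%:C%C by rewrite ger0_norm// ler0c ltW.
rewrite Eq -rmorphM -rmorphXn /=.
have : 0 < s * q ^+ 2 * (1 + s) by rewrite !mulr_gt0 ?exprn_gt0 ?addr_gt0.
have -> : (s * q * rnorm z) ^+ 2 = s * q ^+ 2 * (1 - s).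
  have <- : s * rnorm z ^+ 2 = 1 - s by rewrite -s1; ring.
  by ring.
rewrite mulr2n => h1 h2; nra.
Qed.
End Riesz.

Section BoundedOperators.
Context {R : realType} (H : hilbertType R).

Definition bounded_linear : {pred H -> H} := fun f =>
  `[< linear f /\ exists M : R, forall x, `|f x| <= M%:C%C * `|x| >].

Record bounded_op := BoundedOp {
  bop_fun :> H -> H;
  bop_funP : bop_fun \in bounded_linear }.

HB.instance Definition _ := [isSub for bop_fun].
HB.instance Definition _ := [Choice of bounded_op by <:].

Lemma bounded_linearP (f : H -> H) : f \in bounded_linear <->
  linear f /\ exists2 M : R, 0 <= M & forall x, rnorm (f x) <= M * rnorm x.
Proof.
split=> [/asboolP[fl [M fM]]|[fl [M M0 fM]]]; last first.
  apply/asboolP; split=> //; exists M => x.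
  by rewrite !rnormE -rmorphM lecR.
split=> //; exists (Num.max M 0) => [|x]; first by rewrite le_max lexx orbT.
rewrite -lecR rmorphM /= -!rnormE; apply: (le_trans (fM x)).
by rewrite ler_wpM2r// lecR le_max lexx.
Qed.

Fact bounded_linear_submod : subsemimod_closed bounded_linear.
Proof.
split; first split.
- apply/bounded_linearP; split=> [a x y|]; first by rewrite scaler0 addr0.
  by exists 0 => // x; rewrite rnorm0 mul0r.
- move=> f g /bounded_linearP[fl [M M0 fM]] /bounded_linearP[gl [N N0 gN]].
  apply/bounded_linearP; split=> [a x y|].
    by rewrite !fctE fl gl scalerDr addrACA.
  exists (M + N) => [|x]; first exact: addr_ge0.
  by rewrite fctE mulrDl (le_trans (rnormD _ _))// lerD.
- move=> a f /bounded_linearP[fl [M M0 fM]].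
  apply/bounded_linearP; split=> [b x y|].
    by rewrite !fctE fl scalerDr !scalerA mulrC.
  have a0 : 0 <= complex.Re `|a| by rewrite -ler0c -normC_re.
  exists (complex.Re `|a| * M) => [|x]; first exact: mulr_ge0.
  by rewrite fctE rnormZ -mulrA ler_wpM2l.
Qed.
HB.instance Definition _ := GRing.SubChoice_isSubLmodule.Build
  R[i] (H -> H) bounded_linear bounded_op bounded_linear_submod.

Implicit Types f g h : bounded_op.

Lemma bopP f g : (forall x, f x = g x) -> f = g.
Proof. by move=> fg; apply/val_inj/funext. Qed.

Lemma bopD f g x : (f + g) x = f x + g x. Proof. by []. Qed.
Lemma bopN f x : (- f) x = - f x. Proof. by []. Qed.
Lemma bopZ a f x : (a *: f) x = a *: f x. Proof. by []. Qed.
Lemma bop0 x : (0 : bounded_op) x = 0. Proof. by []. Qed.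

Lemma bop_linear f : linear f.
Proof. by case/bounded_linearP: (bop_funP f). Qed.

HB.instance Definition _ f :=
  GRing.isLinear.Build R[i] H H *:%R f (@bop_linear f).

Definition opbound f : set R :=
  [set M | 0 <= M /\ forall x, rnorm (f x) <= M * rnorm x].
Definition opnorm f : R := inf (opbound f).

Lemma opbound_neq0 f : opbound f !=set0.
Proof. by case/bounded_linearP: (bop_funP f) => _ [M M0 fM]; exists M. Qed.

Lemma opnorm_ge0 f : 0 <= opnorm f.
Proof. by apply: lb_le_inf; [exact: opbound_neq0|move=> M []]. Qed.

Lemma opnorm_le f M : 0 <= M -> (forall x, rnorm (f x) <= M * rnorm x) ->
  opnorm f <= M.
Proof. by move=> M0 fM; apply: ge_inf => //; exists 0 => N []. Qed.

Lemma opnormP f x : rnorm (f x) <= opnorm f * rnorm x.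
Proof.
have [/rnorm_eq0 ->|x0] := eqVneq (rnorm x) 0.
  by rewrite linear0 !rnorm0 mulr0.
have xp : 0 < rnorm x by rewrite lt_def x0 rnorm_ge0.
rewrite -ler_pdivrMr//; apply: lb_le_inf; first exact: opbound_neq0.
by move=> M [_ fM]; rewrite ler_pdivrMr.
Qed.

Fact opnormD f g : (opnorm (f + g))%:C%C <= (opnorm f)%:C%C + (opnorm g)%:C%C.
Proof.
rewrite -rmorphD lecR; apply: opnorm_le => [|x].
  by rewrite addr_ge0 ?opnorm_ge0.
by rewrite mulrDl (le_trans (rnormD _ _))// lerD// opnormP.
Qed.

Let opnormZ_le a f : opnorm (a *: f) <= complex.Re `|a| * opnorm f.
Proof.
have a0 : 0 <= complex.Re `|a| by rewrite -ler0c -normC_re.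
apply: opnorm_le => [|x]; first by rewrite mulr_ge0 ?opnorm_ge0.
by rewrite rnormZ -mulrA ler_wpM2l// opnormP.
Qed.

Fact opnormZ a f : (opnorm (a *: f))%:C%C = `|a| * (opnorm f)%:C%C.
Proof.
rewrite normC_re -rmorphM; congr (_%:C)%C; apply/eqP.
rewrite eq_le opnormZ_le andTb.
have [->|a0] := eqVneq a 0.
  by rewrite normr0 mul0r opnorm_ge0.
have := opnormZ_le a^-1 (a *: f).
rewrite scalerA mulVf// scale1r normfV.
have ap : 0 < complex.Re `|a| by rewrite -ltcR -normC_re normr_gt0.
rewrite [`|a|]normC_re -fmorphV /= => h.
by rewrite mulrC -ler_pdivlMr// mulrC.
Qed.

Fact opnorm_eq0 f : (opnorm f)%:C%C = 0 -> f = 0.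
Proof.
move=> [f0]; apply: bopP => x; apply: rnorm_eq0; apply/eqP.
by rewrite eq_le rnorm_ge0 andbT (le_trans (opnormP _ _))// f0 mul0r.
Qed.

HB.instance Definition _ := Lmodule_isNormed.Build R[i] bounded_op
  opnormD opnormZ opnorm_eq0.

Lemma bop_normE f : rnorm f = opnorm f. Proof. by []. Qed.

End BoundedOperators.
Arguments bounded_linear {R H}.

Section BoundedOperatorsCstar.
Context {R : realType} (H : hilbertType R).
Implicit Types (f g h : bounded_op H) (x y z : H).

Fact bop_complete (F : set_system (bounded_op H)) :
  ProperFilter F -> cauchy F -> cvg F.
Proof.
move=> FF /cauchyP Fc.
have Fc' (e : R) : 0 < e ->
    exists f, F [set g : bounded_op H | forall x, rnorm (f x - g x) <= e * rnorm x].
  move=> e0; have [|f Ff] := Fc e%:C%C; first by rewrite ltcR.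
  exists f; apply: filterS Ff => g; rewrite -ball_normE /= rnormE ltcR => fg x.
  rewrite (le_trans (opnormP (f - g) x))// ler_wpM2r ?rnorm_ge0//.
  exact: ltW.
have evc x : exists y : H, (fun f : bounded_op H => f x) @ F --> y.
  apply/cvg_ex; apply: cauchy_cvg; apply/cauchyP => _/posnumP[eps].
  have [e e0 ->] := posC eps.
  have x1 : 0 < rnorm x + 1 by rewrite ltr_wpDl// rnorm_ge0.
  have [f Ff] := Fc' (e / (rnorm x + 1)) ltac:(exact: divr_gt0).
  exists (f x); rewrite /fmap /=; apply: filterS Ff => g /(_ x) fg.
  suff : rnorm (f x - g x) < e by rewrite -ltcR -rnormE /= -ball_normE.
  apply: (le_lt_trans fg).
  by rewrite mulrAC ltr_pdivrMr// ltr_pM2l// ltrDl.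
pose u x := sval (cid (evc x)).
have Fu x : (fun f : bounded_op H => f x) @ F --> u x by exact: (svalP (cid (evc x))).
have near_u x (d : R) : 0 < d -> F [set f : bounded_op H | rnorm (u x - f x) < d].
  move=> d0; have dC : 0 < (d%:C)%C :> R[i] by rewrite ltcR.
  have Fb : F [set f : bounded_op H | ball (u x) d%:C%C (f x)].
    exact: (Fu x _ (nbhsx_ballx (u x) _ dC)).
  by apply: filterS Fb => f /=; rewrite -ball_normE /= rnormE ltcR.
have dist_u (e : R) : 0 < e ->
    F [set f : bounded_op H | forall x, rnorm (u x - f x) <= e * rnorm x].
  move=> e0; have [f Ff] := Fc' (e / 2) ltac:(exact: divr_gt0).
  apply: filterS (Ff) => g fg x; apply/ler_addgt0Pr => d d0.
  have [k [kx fk]] := @filter_ex _ F _ _ (filterI (near_u x d d0) Ff).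
  have -> : u x - g x = (u x - k x) + (- (f x - k x) + (f x - g x)).
    by rewrite opprB !subrKA.
  apply: (le_trans (rnormD _ _)); rewrite addrC lerD//; last exact: ltW.
  apply: (le_trans (rnormD _ _)); rewrite rnormN.
  by have := lerD (fk x) (fg x); rewrite -mulrDl -splitr.
have ulin : linear u.
  move=> a x y; apply/eqP; rewrite -subr_eq0; apply/eqP/rnorm_eq0/eqP.
  rewrite eq_le rnorm_ge0 andbT; apply/ler_addgt0Pr => d d0; rewrite add0r.
  set A := complex.Re `|a|.
  have A0 : 0 <= A by rewrite -ler0c -normC_re.
  set B := rnorm (a *: x + y) + A * rnorm x + rnorm y + 1.
  have B0 : 0 < B.
    by rewrite ltr_wpDl// !addr_ge0 ?mulr_ge0 ?rnorm_ge0.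
  have [f fu] := filter_ex (dist_u (d / B) ltac:(exact: divr_gt0)).
  have -> : u (a *: x + y) - (a *: u x + u y) =
      (u (a *: x + y) - f (a *: x + y)) + (- (a *: (u x - f x)) + - (u y - f y)).
    rewrite (bop_linear f) scalerBr !opprB.
    by rewrite [X in _ = _ + X]addrACA subrKA -opprD.
  apply: (le_trans (rnormD _ _)).
  apply: (@le_trans _ _ (d / B * (B - 1))); last first.
    by rewrite mulrAC ler_pdivrMr// ler_pM2l// lerBlDr lerDl.
  have -> : B - 1 = rnorm (a *: x + y) + (A * rnorm x + rnorm y).
    by rewrite /B addrK addrA.
  rewrite mulrDr lerD ?fu//.
  apply: (le_trans (rnormD _ _)); rewrite !rnormN mulrDr lerD ?fu//.
  by rewrite rnormZ mulrCA ler_wpM2l.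
have [f0 f0u] := filter_ex (dist_u 1 ltr01).
have ubnd : u \in bounded_linear.
  apply/bounded_linearP; split => //.
  exists (1 + opnorm f0) => [|x]; first by rewrite addr_ge0 ?opnorm_ge0.
  rewrite -[u x](subrK (f0 x)) (le_trans (rnormD _ _))// mulrDl.
  by rewrite lerD ?f0u ?opnormP.
apply/cvg_ex; exists (BoundedOp ubnd).
apply/cvgrPdist_le => _/posnumP[eps]; have [e e0 ->] := posC eps.
near=> f; rewrite rnormE lecR; apply: opnorm_le; first exact: ltW.
by near: f; exact: dist_u.
Unshelve. all: by end_near. Qed.

HB.instance Definition _ := Uniform_isComplete.Build (bounded_op H) bop_complete.

Fact bop_id_bounded : @id H \in bounded_linear.
Proof.
by apply/bounded_linearP; split=> //; exists 1 => // x; rewrite mul1r.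
Qed.
Definition bop_id := BoundedOp bop_id_bounded.

Fact bop_comp_bounded f g : f \o g \in bounded_linear.
Proof.
apply/bounded_linearP; split=> [a x y|] /=; first by rewrite !linearP.
exists (opnorm f * opnorm g) => [|x]; first by rewrite mulr_ge0 ?opnorm_ge0.
rewrite (le_trans (opnormP f _))// -mulrA ler_wpM2l ?opnorm_ge0//.
exact: opnormP.
Qed.
Definition bop_comp f g := BoundedOp (bop_comp_bounded f g).

Lemma hdotP x y : (forall z, hdot z x = hdot z y) -> x = y.
Proof.
move=> xy; apply/eqP; rewrite -subr_eq0; apply/eqP/rnorm_eq0/eqP.
rewrite -(@eqrXn2 _ 2)// ?rnorm_ge0//.
have : hdot (x - y) (x - y) = 0 by rewrite linearBr /= xy subrr.
by rewrite hdot_rnorm expr0n /= => -[->].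
Qed.

Lemma bop_adj_exists f y : exists y', forall x, hdot (f x) y = hdot x y'.
Proof.
apply: (@riesz _ _ _ (opnorm f * rnorm y)) => [a x z|x|].
- by rewrite linearP hdotDl hdotZl.
- apply: (le_trans (hdot_CS _ _)); rewrite mulrAC ler_wpM2r ?rnorm_ge0//.
  exact: opnormP.
- by rewrite mulr_ge0 ?opnorm_ge0 ?rnorm_ge0.
Qed.

Definition adj_fun f y : H := sval (cid (bop_adj_exists f y)).

Lemma adj_funE f x y : hdot (f x) y = hdot x (adj_fun f y).
Proof. exact: (svalP (cid (bop_adj_exists f y))). Qed.

Lemma adj_fun_le f y : rnorm (adj_fun f y) <= opnorm f * rnorm y.
Proof.
have [->|y0] := eqVneq (rnorm (adj_fun f y)) 0.
  by rewrite mulr_ge0 ?opnorm_ge0 ?rnorm_ge0.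
have yp : 0 < rnorm (adj_fun f y) by rewrite lt_def y0 rnorm_ge0.
rewrite -(ler_pM2l yp) -expr2.
have <- : complex.Re (hdot (f (adj_fun f y)) y) = rnorm (adj_fun f y) ^+ 2.
  by rewrite adj_funE hdot_rnorm.
rewrite (le_trans (hdot_CS _ _))// mulrA ler_wpM2r ?rnorm_ge0// mulrC.
exact: opnormP.
Qed.

Fact bop_adj_bounded f : adj_fun f \in bounded_linear.
Proof.
apply/bounded_linearP; split=> [a x y|].
  by apply: hdotP => z; rewrite -adj_funE !linearP /= !adj_funE.
by exists (opnorm f); [exact: opnorm_ge0|exact: adj_fun_le].
Qed.
Definition bop_adj f := BoundedOp (bop_adj_bounded f).

Lemma bop_adjE f x y : hdot (f x) y = hdot x (bop_adj f y).
Proof. exact: adj_funE. Qed.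

Fact bop_adjK : involutive bop_adj.
Proof.
move=> f; apply: bopP => x; apply: hdotP => z.
by rewrite -bop_adjE hdotC -bop_adjE -hdotC.
Qed.

Fact bop_adjD f g : bop_adj (f + g) = bop_adj f + bop_adj g.
Proof.
apply: bopP => x; apply: hdotP => z.
by rewrite -bop_adjE !bopD hdotDl linearDr /= !bop_adjE.
Qed.

Fact bop_adjZ a f : bop_adj (a *: f) = Num.conj a *: bop_adj f.
Proof.
apply: bopP => x; apply: hdotP => z.
by rewrite -bop_adjE !bopZ hdotZl linearZr_LR /= conjCK bop_adjE.
Qed.

Fact bop_adjM f g : bop_adj (bop_comp f g) = bop_comp (bop_adj g) (bop_adj f).
Proof. by apply: bopP => x; apply: hdotP => z; rewrite -!bop_adjE. Qed.

Lemma opnormM f g : opnorm (bop_comp f g) <= opnorm f * opnorm g.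
Proof.
apply: opnorm_le => [|x]; first by rewrite mulr_ge0 ?opnorm_ge0.
rewrite (le_trans (opnormP f _))// -mulrA ler_wpM2l ?opnorm_ge0//.
exact: opnormP.
Qed.

Fact bop_normM f g : `|bop_comp f g| <= `|f| * `|g|.
Proof. by rewrite !rnormE -rmorphM lecR; exact: opnormM. Qed.

Lemma opnorm_star_ge f : opnorm f ^+ 2 <= opnorm (bop_comp (bop_adj f) f).
Proof.
set N := opnorm (bop_comp _ _).
have N0 : 0 <= N by exact: opnorm_ge0.
rewrite -[leRHS]sqr_sqrtr// ler_sqr ?nnegrE ?opnorm_ge0 ?sqrtr_ge0//.
apply: opnorm_le => [|x]; first exact: sqrtr_ge0.
rewrite -ler_sqr ?nnegrE ?mulr_ge0 ?sqrtr_ge0 ?rnorm_ge0//.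
rewrite exprMn sqr_sqrtr//.
have <- : complex.Re (hdot (bop_comp (bop_adj f) f x) x) = rnorm (f x) ^+ 2.
  by rewrite hdotC /= -bop_adjE hdot_rnorm.
rewrite (le_trans (hdot_CS _ _))// expr2 mulrA ler_wpM2r ?rnorm_ge0//.
exact: opnormP.
Qed.

Lemma opnorm_adj_le f : opnorm (bop_adj f) <= opnorm f.
Proof. by apply: opnorm_le; [exact: opnorm_ge0|exact: adj_fun_le]. Qed.

Fact bop_norm_star f : `|bop_comp (bop_adj f) f| = `|f| ^+ 2.
Proof.
rewrite !rnormE -rmorphXn; congr (_%:C)%C; apply/eqP.
rewrite eq_le opnorm_star_ge andbT expr2 (le_trans (opnormM _ _))//.
by rewrite ler_wpM2r ?opnorm_ge0// opnorm_adj_le.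
Qed.

Fact bop_compA : associative (@bop_comp). Proof. by move=> f g h; apply: bopP. Qed.
Fact bop_comp1f : left_id bop_id bop_comp. Proof. by move=> f; apply: bopP. Qed.
Fact bop_compf1 : right_id bop_id bop_comp. Proof. by move=> f; apply: bopP. Qed.
Fact bop_compDl : left_distributive bop_comp +%R.
Proof. by move=> f g h; apply: bopP. Qed.
Fact bop_compDr : right_distributive bop_comp +%R.
Proof. by move=> f g h; apply: bopP => x; exact: (linearD f (g x) (h x)). Qed.
Fact bop_scaleAl a f g : a *: bop_comp f g = bop_comp (a *: f) g.
Proof. exact: bopP. Qed.
Fact bop_scaleAr a f g : a *: bop_comp f g = bop_comp f (a *: g).
Proof. by apply: bopP => x; apply/esym; exact: (linearZ_LR f a (g x)). Qed.

HB.instance Definition _ := CompleteNormedModule_isCstar.Build R (bounded_op H)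
  bop_compA bop_comp1f bop_compf1 bop_compDl bop_compDr bop_scaleAl bop_scaleAr
  bop_adjD bop_adjZ bop_adjM bop_adjK bop_normM bop_norm_star.

End BoundedOperatorsCstar.

Section MatrixAlgebra.
Context {R : realType} {A : cstarType R}.

Definition mxstar n (x : 'M[A]_n) : 'M[A]_n := map_mx cstar x^T.

Definition mxpositive n (x : 'M[A]_n) : Prop :=
  exists y : 'M[A]_n, x = mxstar y *m y.

(* The norm making the *-algebra M_n(A) a C*-algebra exists and is unique; it
   is characterized here by the axioms of a C*-norm (a C*-norm on M_n(A) is
   automatically complete). *)
Definition is_mx_cstar_norm n (N : 'M[A]_n -> R) : Prop :=
  [/\ forall x, N x = 0 -> x = 0,
      forall x y, N (x + y) <= N x + N y,
      forall (a : R[i]) x, N (map_mx ( *:%R a) x) = complex.Re `|a| * N x,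
      forall x y, N (x *m y) <= N x * N y
    & forall x, N (mxstar x *m x) = N x ^+ 2].

Definition mx_over n (S : set A) : set 'M[A]_n :=
  [set x | forall i j, S (x i j)].
End MatrixAlgebra.

Section CompletelyPositiveMaps.
Context {R : realType} {A B : cstarType R}.

(* [phi] only matters on the operator system [S], and on all of [A] when [S] is
   [setT]; M_n(S) is ordered as a subspace of M_n(A). *)
Definition ucp (S : set A) (phi : A -> B) : Prop :=
  [/\ forall (a : R[i]) x y, S x -> S y ->
        phi (a *: x + y) = a *: phi x + phi y,
      phi 1 = 1
    & forall n (x : 'M[A]_n),
        mx_over S x -> mxpositive x -> mxpositive (map_mx phi x)].

Definition unique_extension_property (S : set A) (phi : A -> B) : Prop :=
  ucp S phi /\
  exists psi : A -> B,
    [/\ ucp setT psi,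
        forall s, S s -> psi s = phi s,
        forall psi' : A -> B, ucp setT psi' ->
          (forall s, S s -> psi' s = phi s) -> psi' = psi
      & forall x y, psi (x * y) = psi x * psi y].

Definition unital_star_hom (pi : A -> B) : Prop :=
  [/\ linear pi,
      pi 1 = 1,
      forall x y, pi (x * y) = pi x * pi y
    & forall x, pi (cstar x) = cstar (pi x)].
End CompletelyPositiveMaps.

Section OperatorSystems.
Context {R : realType} {A : cstarType R}.
Implicit Types (S K : set A).

Definition linear_subspace (V : lmodType R[i]) (E : set V) : Prop :=
  E 0 /\ forall (a : R[i]) x y, E x -> E y -> E (a *: x + y).

Definition operator_system S : Prop :=
  [/\ linear_subspace S, forall x, S x -> S (cstar x) & S 1].

Definition separable_set S : Prop :=
  exists D : set A, [/\ countable D, D `<=` S & S `<=` closure D].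

Definition cstar_subalgebra (B : set A) : Prop :=
  [/\ linear_subspace B, forall x y, B x -> B y -> B (x * y),
      forall x, B x -> B (cstar x) & closed B].

(* [smallest] is the intersection of all C*-subalgebras containing [S]. *)
Definition cstar_generated S : set A := smallest cstar_subalgebra S.

(* A representation of a unital algebra is nondegenerate iff it is unital. *)
Definition representation (H : hilbertType R) (pi : A -> bounded_op H) : Prop :=
  unital_star_hom pi.

Definition irreducible_rep (H : hilbertType R) (pi : A -> bounded_op H) : Prop :=
  (exists x : H, x != 0) /\
  forall E : set H, closed E -> linear_subspace E ->
    (forall a x, E x -> E (pi a x)) -> E = [set 0] \/ E = setT.

Definition boundary_representation S (H : hilbertType R)
    (pi : A -> bounded_op H) : Prop :=
  [/\ representation pi, irreducible_rep pi & unique_extension_property S pi].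

Definition closed_ideal K : Prop :=
  [/\ linear_subspace K, forall a x, K x -> K (a * x), forall a x, K x -> K (x * a)
    & closed K].

(* M_n(A/K) = M_n(A)/M_n(K) carries the quotient norm. *)
Definition quotient_norm n (N : 'M[A]_n -> R) K (x : 'M[A]_n) : R :=
  inf [set N (x + k) | k in mx_over K].

Definition quotient_completely_isometric S K : Prop :=
  forall n (N : 'M[A]_n -> R), is_mx_cstar_norm N ->
    forall x, mx_over S x -> quotient_norm N K x = N x.

Definition is_boundary_ideal S K : Prop :=
  [/\ closed_ideal K, quotient_completely_isometric S K
    & forall L, closed_ideal L -> quotient_completely_isometric S L ->
        L `<=` K].

Definition hyperrigid S : Prop :=
  forall (H : hilbertType R) (pi : A -> bounded_op H),
    representation pi -> injective pi ->
  forall phi : nat -> bounded_op H -> bounded_op H,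
    (forall n, ucp setT (phi n)) ->
    (forall s, S s -> rnorm (phi n (pi s) - pi s) @[n --> \oo] --> (0 : R)) ->
  forall a : A, rnorm (phi n (pi a) - pi a) @[n --> \oo] --> (0 : R).

End OperatorSystems.

(* Main.v *)
(** The quotient and uniqueness statements are both reduced to kernels
    [Psi c p q], linear in [c] in [A], with [p] and [q] in a Hilbert space [H],
    that are completely positive in the sense that
    [sum_(u, v) Psi (v_a^* u_a) u_p v_p >= 0] for all finite families [(u_a, u_p)].

    Uniqueness.  Let [sigma] be a representation on [H], and let [Psi] agree with
    [<sigma(.) p, q>] on [S].  Put [tau := faithful + sigma + infinitely many
    copies of rho], where [rho] is the Stinespring dilation of [Psi], and let [Z]
    be the isometry that is the identity on the first summand, the Stinespring
    isometry from [H] into the zeroth copy of [rho], and the shift on the copies.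
    The map [T |-> Z^* T Z] is UCP on all operators, it fixes [tau(S)], and it
    compresses [tau(a)] to [Psi a].  Hyperrigidity, applied to the constant
    sequence, makes it fix [tau(A)], so that [Psi] is [<sigma(.) p, q>] on [A].
    In this way Arveson's extension theorem is not needed; the faithful summand
    is the GNS construction over all positive functionals.

    Boundary ideal.  If [A -> A/L] is completely isometric on [S], then the form
    [<sigma(.) p, q>] on [S] is positive modulo [L] on matrices over [S], hence, by
    the extension theorem of M. Riesz on finitely supported matrices indexed by
    [H], it extends to a completely positive kernel on [A] vanishing on the
    self-adjoint part of [L].  For [sigma] faithful, uniqueness forces
    [x^* x = 0] for every [x] in [L]. *)
Require Import Defs.
From HB Require Import structures.
From mathcomp Require Import all_boot all_order all_algebra.
From mathcomp Require Import complex.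
From mathcomp Require Import all_classical all_reals all_analysis.
From mathcomp Require Import ring lra.

Set Implicit Arguments.
Unset Strict Implicit.
Unset Printing Implicit Defensive.

Import Order.TTheory GRing.Theory Num.Theory.
Import numFieldNormedType.Exports.

Local Open Scope classical_set_scope.
Local Open Scope ring_scope.

(** * Square roots and positivity in C*-algebras *)

Section RealNorm.
Context {R : realType}.

Lemma rnorm_small (V : normedModType R[i]) (x : V) (c : R) :
  (forall e, 0 < e -> rnorm x <= c * e) -> x = 0.
Proof.
move=> h; apply/rnorm_eq0/eqP; rewrite eq_le rnorm_ge0 andbT.
apply/ler_addgt0Pr => e e0; rewrite add0r.
have c0 : 0 < `|c| + 1 by rewrite ltr_wpDl.
apply: (le_trans (h (e / (`|c| + 1)) _)); first exact: divr_gt0.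
rewrite mulrA ler_pdivrMr// mulrC ler_pM2l//.
by rewrite (le_trans (ler_norm c))// lerDl.
Qed.

Lemma rnorm_real (V : normedModType R[i]) (r : R) (x : V) : 0 <= r ->
  rnorm (r%:C%C *: x) = r * rnorm x.
Proof. by move=> r0; rewrite rnormZ normc_real. Qed.

Lemma cauchy_rnorm_cvg (V : completeNormedModType R[i]) (u : nat -> V) :
  (forall e : R, 0 < e -> exists N, forall m n, (N <= m)%N -> (N <= n)%N ->
     rnorm (u m - u n) <= e) ->
  exists l, forall e : R, 0 < e -> exists N, forall n, (N <= n)%N ->
     rnorm (l - u n) <= e.
Proof.
move=> uC; have : cvg (u @ \oo).
  apply: cauchy_cvg; apply/cauchyP => _/posnumP[eps].
  have [e e0 ->] := posC eps.
  have [N uN] := uC (e / 2) ltac:(exact: divr_gt0).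
  exists (u N); exists N => // n Nn.
  rewrite -ball_normE /= rnormE ltcR.
  apply: (@le_lt_trans _ _ (e / 2)); last by rewrite ltr_pdivrMr// ltr_pMr// ltr1n.
  exact: uN.
move=> /cvg_ex[l ul]; exists l => e e0.
have eC : 0 < e%:C%C :> R[i] by rewrite ltcR.
have /cvgrPdist_le /(_ _ eC) [N _ uN] := ul.
by exists N => n /uN; rewrite rnormE lecR.
Qed.
End RealNorm.

Section SquareRoots.
Context {R : realType} {A : cstarType R}.
Implicit Types (x y z h k : A).

Lemma sqr_iC : 'i%C * 'i%C = -1 :> R[i].
Proof. by rewrite -expr2 sqr_i. Qed.

Lemma scaleAl (a : R[i]) x y : a *: (x * y) = (a *: x) * y.
Proof. exact: cstar_scaleAl. Qed.

Lemma scaleAr (a : R[i]) x y : a *: (x * y) = x * (a *: y).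
Proof. exact: cstar_scaleAr. Qed.

Lemma cstar0 : cstar (0 : A) = 0.
Proof. by apply: (addrI (cstar (0 : A))); rewrite -cstarD !addr0. Qed.

Lemma cstarN x : cstar (- x) = - cstar x.
Proof. by apply: (addrI (cstar x)); rewrite -cstarD !subrr cstar0. Qed.

Lemma cstarB x y : cstar (x - y) = cstar x - cstar y.
Proof. by rewrite cstarD cstarN. Qed.

Lemma cstarMr x y : cstar (x * y) = cstar y * cstar x.
Proof. exact: cstarM. Qed.

Lemma cstar1 : cstar (1 : A) = 1.
Proof.
by rewrite -[LHS]mulr1 -[X in _ * X](@cstarK _ A 1) -cstarMr mulr1 cstarK.
Qed.

Lemma cstarZr (r : R) x : cstar (r%:C%C *: x) = r%:C%C *: cstar x.
Proof. by rewrite cstarZ conj_Creal// complex_real. Qed.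

Lemma rnormM x y : rnorm (x * y) <= rnorm x * rnorm y.
Proof. by rewrite -lecR rmorphM /= -!rnormE; exact: cstar_normM. Qed.

Lemma rnorm_starM x : rnorm (cstar x * x) = rnorm x ^+ 2.
Proof. by apply: complexI; rewrite rmorphXn /= -!rnormE; exact: cstar_norm. Qed.

Lemma rnorm_star_le x : rnorm x <= rnorm (cstar x).
Proof.
have [->|x0] := eqVneq (rnorm x) 0; first exact: rnorm_ge0.
have xp : 0 < rnorm x by rewrite lt_def x0 rnorm_ge0.
by rewrite -(ler_pM2r xp) -expr2 -rnorm_starM rnormM.
Qed.

Lemma rnorm_star x : rnorm (cstar x) = rnorm x.
Proof.
by apply/eqP; rewrite eq_le rnorm_star_le -{2}[x]cstarK rnorm_star_le.
Qed.

Lemma rnorm_sqr x : cstar x = x -> rnorm (x * x) = rnorm x ^+ 2.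
Proof. by move=> xs; rewrite -rnorm_starM xs. Qed.

(** In the zero algebra the unit has norm [0], hence an inequality; otherwise the C*-identity for
    the unit gives norm [1]. *)
Lemma rnorm1_le : rnorm (1 : A) <= 1.
Proof.
have := rnorm_sqr cstar1; rewrite mulr1 => h.
have [->|x0] := eqVneq (rnorm (1 : A)) 0; first by [].
have xp : 0 < rnorm (1 : A) by rewrite lt_def x0 rnorm_ge0.
by rewrite -(ler_pM2l xp) mulr1 -expr2 -h.
Qed.

(* Converges to [y] with [(1 - y)^2 = 1 - x]; the scalar iteration at [x = 1]
   majorizes the increments, which also covers the case [rnorm x = 1]. *)
Fixpoint binom_iter x (n : nat) : A :=
  if n is m.+1 then (2^-1)%:C%C *: (x + binom_iter x m * binom_iter x m) else 0.

Fixpoint binom_major (n : nat) : R :=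
  if n is m.+1 then 2^-1 * (1 + binom_major m ^+ 2) else 0.

Lemma binom_major_bounds n : 0 <= binom_major n <= 1.
Proof.
elim: n => [|n /andP[t0 t1]] /=; first by rewrite lexx ler01.
have := exprn_ile1 2 t0 t1; have := sqr_ge0 (binom_major n).
by move=> h1 h2; apply/andP; split; lra.
Qed.

(** Induction on [n]: the splitting [y' y' - y y = y' (y' - y) + (y' - y) y], valid without
    commutativity, bounds the increments by the same expression in the majorants. *)
Lemma binom_iter_major x n : rnorm x <= 1 ->
  rnorm (binom_iter x n) <= binom_major n /\
  rnorm (binom_iter x n.+1 - binom_iter x n) <= binom_major n.+1 - binom_major n.
Proof.
move=> x1.
have bnd m : rnorm (binom_iter x m) <= binom_major m.
  elim: m => [|m IH] /=; first by rewrite rnorm0.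
  rewrite rnorm_real// ler_wpM2l// (le_trans (rnormD _ _))// lerD//.
  by rewrite (le_trans (rnormM _ _))// -expr2 lerXn2r// nnegrE ?rnorm_ge0//
    (le_trans _ IH)// rnorm_ge0.
split=> //; elim: n => [|n IH].
  by rewrite /= !subr0 mulr0 addr0 expr0n /= addr0 rnorm_real// ler_wpM2l.
rewrite [binom_iter x n.+2]/= [binom_iter x n.+1 in X in rnorm (_ - X)]/=.
rewrite -/(binom_iter x n.+1) -scalerBr opprD addrACA subrr add0r rnorm_real//.
rewrite [binom_major n.+2]/= -/(binom_major n.+1).
set y' := binom_iter x n.+1 in IH *; set y := binom_iter x n in IH *.
set t' := binom_major n.+1 in IH *; set t := binom_major n in IH *.
have -> : y' * y' - y * y = y' * (y' - y) + (y' - y) * y.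
  by rewrite mulrBr mulrBl addrA subrK.
have -> : 2^-1 * (1 + t' ^+ 2) - t' = 2^-1 * ((t' * (t' - t)) + (t' - t) * t).
  by rewrite [X in _ - X = _](_ : t' = 2^-1 * (1 + t ^+ 2))//; ring.
rewrite ler_wpM2l// (le_trans (rnormD _ _))// lerD//.
- by rewrite (le_trans (rnormM _ _))// ler_pM// ?rnorm_ge0// bnd.
- by rewrite (le_trans (rnormM _ _))// ler_pM// ?rnorm_ge0// bnd.
Qed.

Lemma binom_iter_cauchy x : rnorm x <= 1 ->
  forall e : R, 0 < e -> exists N, forall m n, (N <= m)%N -> (N <= n)%N ->
     rnorm (binom_iter x m - binom_iter x n) <= e.
Proof.
move=> x1.
have st n : rnorm (binom_iter x n.+1 - binom_iter x n) <= binom_major n.+1 -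
  binom_major n.
  by have [] := binom_iter_major n x1.
have tele n i : rnorm (binom_iter x (n + i) - binom_iter x n) <= binom_major (n +
  i) - binom_major n.
  elim: i => [|i IH]; first by rewrite addn0 !subrr rnorm0.
  rewrite addnS -[X in rnorm (X - _)](subrK (binom_iter x (n + i))) -addrA.
  rewrite -[X in _ <= X - _](subrK (binom_major (n + i))) -[X in _ <= X]addrA.
  by rewrite (le_trans (rnormD _ _))// lerD.
(* The majorant increases and is bounded by [1]; past an index where it is within [e / 2] of its
   supremum, the telescoped increments are at most [e / 2]. *)
have hs : has_sup (range binom_major).
  split; first by exists 0, 0%N.
  by exists 1 => _ [n _ <-]; case/andP: (binom_major_bounds n).
move=> e e0; have [_ [N _ <-] NS] := sup_adherent (divr_gt0 e0 (ltr0Sn R 1)) hs.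
exists N => m n Nm Nn.
have near_N i : (N <= i)%N -> rnorm (binom_iter x i - binom_iter x N) <= e / 2.
  move=> Ni; have := tele N (i - N)%N; rewrite subnKC// => /le_trans; apply.
  have := ub_le_sup hs.2 (imageP binom_major (I : setT i)); move: NS; lra.
have -> : binom_iter x m - binom_iter x n =
   (binom_iter x m - binom_iter x N) - (binom_iter x n - binom_iter x N).
  by rewrite opprB addrA subrK.
rewrite (le_trans (rnormD _ _))// rnormN.
by have := near_N _ Nm; have := near_N _ Nn; lra.
Qed.

(** The limit [y] of the iteration satisfies [2 y = x + y^2], that is [(1 - y)^2 = 1 - x].
    Self-adjointness and commutation hold for all iterates and pass to the limit. *)
Lemma sqrt1B x : rnorm x <= 1 -> exists d : A,
  [/\ d * d = 1 - x, rnorm (1 - d) <= 1, cstar x = x -> cstar d = d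
    & forall z, z * x = x * z -> z * d = d * z].
Proof.
move=> x1; have [y yP] := cauchy_rnorm_cvg (binom_iter_cauchy x1).
have u1 n : rnorm (binom_iter x n) <= 1.
  have [/le_trans h _] := binom_iter_major n x1; apply: h.
  by case/andP: (binom_major_bounds n).
have near_y e : 0 < e -> exists n, rnorm (y - binom_iter x n) <= e /\
    rnorm (y - binom_iter x n.+1) <= e.
  by move=> /yP[N h]; exists N; split; apply: h.
have y1 : rnorm y <= 1.
  apply/ler_addgt0Pr => e /near_y[n [yn _]].
  rewrite -[y](subrK (binom_iter x n)) (le_trans (rnormD _ _))//.
  by rewrite addrC lerD.
have yE : y = (2^-1)%:C%C *: (x + y * y).
  apply/eqP; rewrite -subr_eq0; apply/eqP/(@rnorm_small _ _ _ 2) => e /near_y[n [yn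
    yn']].
  set u := binom_iter x n in yn; set u' := binom_iter x n.+1 in yn'.
  have -> : y - (2^-1)%:C%C *: (x + y * y) =
     (y - u') - (2^-1)%:C%C *: (y * (y - u) + (y - u) * u).
    rewrite /u' /= -/u mulrBr mulrBl addrA subrK.
    by rewrite -[RHS]addrA -opprD -scalerDr [y * y - _]addrC addrA addrK.
  rewrite (le_trans (rnormD _ _))// rnormN rnorm_real//.
  have : rnorm (y * (y - u) + (y - u) * u) <= e + e.
    rewrite (le_trans (rnormD _ _))// lerD// (le_trans (rnormM _ _))//.
      by rewrite -[leRHS]mul1r ler_pM// rnorm_ge0.
    by rewrite -[leRHS]mulr1 ler_pM// ?rnorm_ge0// u1.
  by move: yn'; lra.
exists (1 - y); split.
- rewrite mulrBl mul1r mulrBr mulr1 opprB.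
  have -> : x = y + y - y * y.
    have := congr1 (fun v => v + v) yE; rewrite -scalerDl -rmorphD /=.
    have -> : 2^-1 + 2^-1 = 1 :> R by field.
    by rewrite scale1r => ->; rewrite addrK.
  by rewrite opprB opprD -addrA [- y + _]addrCA.
- by rewrite opprB addrC subrK.
- move=> xs; rewrite cstarB cstar1; congr (_ - _).
  have us n : cstar (binom_iter x n) = binom_iter x n.
    elim: n => [|n IH] /=; first exact: cstar0.
    by rewrite cstarZr cstarD xs cstarMr IH.
  apply/eqP; rewrite -subr_eq0; apply/eqP/(@rnorm_small _ _ _ 2) => e /near_y[n [yn _]].
  have -> : cstar y - y = cstar (y - binom_iter x n) - (y - binom_iter x n).
    by rewrite cstarB us opprB addrA subrK.
  by rewrite (le_trans (rnormD _ _))// rnormN rnorm_star; lra.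
- move=> z zx; rewrite mulrBl mulrBr mulr1 mul1r; congr (_ - _).
  have uz n : z * binom_iter x n = binom_iter x n * z.
    elim: n => [|n IH] /=; first by rewrite mulr0 mul0r.
    by rewrite -scaleAr -scaleAl mulrDl mulrDr zx mulrA IH -!mulrA IH.
  apply/eqP; rewrite -subr_eq0; apply/eqP/(@rnorm_small _ _ _ (2 * rnorm z)) => e
    /near_y[n [yn _]].
  have -> : z * y - y * z = z * (y - binom_iter x n) - (y - binom_iter x n) * z.
    by rewrite mulrBr mulrBl uz opprB addrA subrK.
  rewrite (le_trans (rnormD _ _))// rnormN.
  have := rnormM z (y - binom_iter x n); have := rnormM (y - binom_iter x n) z.
  have := ler_wpM2l (rnorm_ge0 z) yn; lra.
Qed.

(* Stating positivity through the norm makes sums of positive elements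
   positive at no cost; [cpos_sqr] and [cpos_starM] recover the usual notion. *)
Definition cpos h := cstar h = h /\
  exists2 t : R, 0 <= t & rnorm (t%:C%C *: (1 : A) - h) <= t.

Lemma cposD h k : cpos h -> cpos k -> cpos (h + k).
Proof.
move=> [hs [t t0 ht]] [ks [s s0 ks']]; split; first by rewrite cstarD hs ks.
exists (t + s); first exact: addr_ge0.
rewrite rmorphD /= scalerDl opprD addrACA (le_trans (rnormD _ _))//.
exact: lerD.
Qed.

Lemma cposZ (r : R) h : 0 <= r -> cpos h -> cpos (r%:C%C *: h).
Proof.
move=> r0 [hs [t t0 ht]]; split; first by rewrite cstarZr hs.
exists (r * t); first exact: mulr_ge0.
by rewrite rmorphM /= -scalerA -scalerBr rnorm_real// ler_wpM2l.
Qed.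

Lemma cpos0 : cpos 0.
Proof. by split; [exact: cstar0|exists 0; rewrite // scale0r subrr rnorm0]. Qed.

Lemma cposB (t : R) h : cstar h = h -> rnorm h <= t -> cpos (t%:C%C *: (1 : A) - h).
Proof.
move=> hs ht; split; first by rewrite cstarB cstarZr cstar1 hs.
by exists t; [rewrite (le_trans _ ht)// rnorm_ge0|rewrite opprB addrC subrK].
Qed.

(** With [n = h + i k] one has [h^2 + k^2 = n^* n] and [2 h = n + n^*], so [|h| <= |n|]. This
    monotonicity of the norm stands in for functional calculus below. *)
Lemma rnorm_sqrD h k : cstar h = h -> cstar k = k -> h * k = k * h ->
  rnorm (h * h) <= rnorm (h * h + k * k).
Proof.
move=> hs ks hk; set n := h + 'i%C *: k.
have ns : cstar n = h - 'i%C *: k.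
  by rewrite cstarD cstarZ hs ks conjCi scaleNr.
have -> : h * h + k * k = cstar n * n.
  rewrite ns /n mulrBl !mulrDr -!scaleAr -!scaleAl scalerA sqr_iC.
  by rewrite scaleN1r hk opprD opprK addrA addrK.
rewrite rnorm_starM rnorm_sqr// lerXn2r// ?nnegrE ?rnorm_ge0//.
have : rnorm (h + h) <= rnorm n + rnorm n.
  rewrite -{2}(rnorm_star n) (le_trans _ (rnormD _ _))// ns /n.
  by rewrite addrACA subrr addr0.
have -> : h + h = 2%:C%C *: h by rewrite -{1 2}[h]scale1r -scalerDl -rmorphD.
by rewrite rnorm_real//; lra.
Qed.

(** After scaling to [|l| <= 1], the element [1 - l^2] is the square of a self-adjoint [d] commuting
    with [l], and [|d^2| <= |d^2 + l^2| = |1|] by [rnorm_sqrD]. *)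
Lemma cpos_sqr k : cstar k = k -> cpos (k * k).
Proof.
move=> ks; split; first by rewrite cstarMr ks.
exists (rnorm k ^+ 2); first exact: exprn_ge0 (rnorm_ge0 k).
set s := rnorm k.
have [/rnorm_eq0 ->|s0] := eqVneq s 0.
  by rewrite mulr0 subr0 rnorm_real ?exprn_ge0 ?rnorm_ge0// ler_piMr ?rnorm1_le
    ?exprn_ge0 ?rnorm_ge0.
have sp : 0 < s by rewrite lt_def s0 rnorm_ge0.
pose l := (s^-1)%:C%C *: k.
have ls : cstar l = l by rewrite cstarZr ks.
have kE : k = s%:C%C *: l by rewrite scalerA -rmorphM /= divff// scale1r.
have l1 : rnorm (l * l) <= 1.
  by rewrite rnorm_sqr// rnorm_real ?invr_ge0 ?rnorm_ge0// mulVf// expr1n.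
have [d [dd _ ds dC]] := sqrt1B l1.
have {}ds : cstar d = d by apply: ds; rewrite cstarMr ls.
have -> : (s ^+ 2)%:C%C *: (1 : A) - k * k = (s ^+ 2)%:C%C *: (d * d).
  by rewrite dd scalerBr kE -scaleAl -scaleAr scalerA -rmorphM -expr2.
rewrite rnorm_real ?exprn_ge0 ?rnorm_ge0// ler_piMr ?exprn_ge0 ?rnorm_ge0//.
have dl : d * l = l * d by apply/esym/dC; rewrite mulrA.
apply: (le_trans (rnorm_sqrD ds ls dl)).
by rewrite dd subrK rnorm1_le.
Qed.

(** Write [h = t (1 - x)] with [|x| <= 1] and take [sqrt t] times the root from [sqrt1B]. The
    commutation clause makes the roots of commuting elements commute, as [rnorm_sqrD] requires. *)
Lemma cpos_sqrt h : cpos h -> exists q,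
  [/\ cstar q = q, q * q = h, cpos q & forall z, z * h = h * z -> z * q = q * z].
Proof.
move=> [hs [t t0 ht]].
have [t00|tn0] := eqVneq t 0.
  exists 0; have -> : h = 0.
    by apply: rnorm_eq0; apply/eqP; rewrite eq_le rnorm_ge0 andbT;
      move: ht; rewrite t00 scale0r sub0r rnormN.
  by split; rewrite ?cstar0 ?mulr0//; exact: cpos0.
have tp : 0 < t by rewrite lt_def tn0.
pose x := 1 - (t^-1)%:C%C *: h.
have xE : x = (t^-1)%:C%C *: (t%:C%C *: (1 : A) - h).
  by rewrite scalerBr scalerA -rmorphM /= mulVf// scale1r.
have x1 : rnorm x <= 1.
  by rewrite xE rnorm_real ?invr_ge0// mulrC ler_pdivrMr// mul1r.
have xs : cstar x = x by rewrite cstarB cstar1 cstarZr hs.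
have [d [dd d1 ds dC]] := sqrt1B x1.
have dp : cpos d.
  by split; [exact: ds|exists 1 => //; rewrite scale1r].
exists ((Num.sqrt t)%:C%C *: d); split.
- by rewrite cstarZr ds.
- rewrite -scaleAl -scaleAr scalerA -rmorphM -expr2 sqr_sqrtr// dd.
  by rewrite opprB addrC subrK scalerA -rmorphM /= divff// scale1r.
- by apply: cposZ; rewrite ?sqrtr_ge0.
- move=> z zh; rewrite -scaleAr -scaleAl dC//.
  by rewrite mulrBr mulrBl mulr1 mul1r -scaleAr -scaleAl zh.
Qed.

(** Since [k = - h], the square roots commute, and [rnorm_sqrD] bounds [|h|] by [|h + k| = 0]. *)
Lemma cpos_sum0 h k : h + k = 0 -> cpos h -> cpos k -> h = 0.
Proof.
move=> hk hp kp.
have [q [qs qq _ qC]] := cpos_sqrt hp; have [l [ls ll _ lC]] := cpos_sqrt kp.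
have kE : k = - h by apply: (addrI h); rewrite hk subrr.
have ql : q * l = l * q.
  by apply: lC; rewrite kE mulrN mulNr; congr (- _); rewrite -qq mulrA.
apply: rnorm_eq0; apply/eqP; rewrite eq_le rnorm_ge0 andbT.
by have := rnorm_sqrD qs ls ql; rewrite qq ll hk rnorm0.
Qed.

Lemma rnorm_cpos_le (e : R) h : 0 <= e -> cpos h -> cpos (e%:C%C *: (1 : A) - h) ->
  rnorm h <= e.
Proof.
move=> e0 hp kp.
have [q [qs qq _ qC]] := cpos_sqrt hp; have [l [ls ll _ lC]] := cpos_sqrt kp.
have ql : q * l = l * q.
  by apply: lC; rewrite mulrBr mulrBl -scaleAl -scaleAr mulr1 mul1r -qq mulrA.
have := rnorm_sqrD qs ls ql; rewrite qq ll addrC subrK => /le_trans; apply.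
by rewrite rnorm_real// ler_piMr// rnorm1_le.
Qed.

(* Kaplansky's argument: [c c^* + c^* c] is twice a sum of two squares. *)
Lemma cpos_symmetrized b : cpos (b * cstar b + cstar b * b).
Proof.
pose x := b + cstar b; pose y := 'i%C *: (b - cstar b).
have xs : cstar x = x by rewrite cstarD cstarK addrC.
have ys : cstar y = y.
  by rewrite cstarZ cstarB cstarK conjCi scaleNr -scalerN opprB.
have <- : (2^-1)%:C%C *: (x * x + y * y) = b * cstar b + cstar b * b.
  rewrite /x /y -scaleAl -scaleAr scalerA sqr_iC scaleN1r.
  rewrite !mulrBl !mulrBr !mulrDl !mulrDr !opprB.
  set p := b * b; set q := b * cstar b; set r := cstar b * b; set s := cstar b *
    cstar b.
  have -> : p + q + (r + s) + (r - s + (q - p)) = (q + r) + (q + r).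
    rewrite (AC ((2*2)*(2*2)) ((1*8)*(4*6)*(2*3)*(7*5)))/=.
    by rewrite !subrr !add0r.
  rewrite -[q + r]scale1r -scalerDl scalerA -!rmorphD -rmorphM /=.
  by congr ((_%:C)%C *: _); field.
apply: cposZ => //; apply: cposD; exact: cpos_sqr.
Qed.

(** For [b = c k] and [v = c c^*], one has [b b^* = - v^2] and [b^* b = - k^4], and
    [cpos_symmetrized] makes their sum positive. So [v^2 + k^4] and its negative are both positive,
    which forces [v^2 = 0] and [c = 0]. *)
Lemma starM_eq_Nsqr c k : cstar k = k -> cstar c * c = - (k * k) -> c = 0.
Proof.
move=> ks ck; pose v := c * cstar c; pose b := c * k.
have vs : cstar v = v by rewrite /v cstarMr cstarK.
have kks : cstar (k * k) = k * k by rewrite cstarMr ks.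
have bb : b * cstar b = - (v * v).
  rewrite /b /v cstarMr ks !mulrA -[c * cstar c * c]mulrA ck.
  by rewrite mulrN mulNr opprK !mulrA.
have b'b : cstar b * b = - ((k * k) * (k * k)).
  by rewrite /b cstarMr ks -mulrA [cstar c * _]mulrA ck mulNr mulrN !mulrA.
have vvp := cpos_sqr vs; have kkp := cpos_sqr kks.
have h0 : v * v + k * k * (k * k) = 0.
  apply: (cpos_sum0 _ (cposD vvp kkp) (cpos_symmetrized b)).
  by rewrite bb b'b -opprD subrr.
have vv0 := cpos_sum0 h0 vvp kkp.
have v0 : v = 0.
  by apply: rnorm_eq0; apply/eqP; rewrite -[_ == 0](expf_eq0 _ 1) -sqrf_eq0
    -rnorm_sqr// vv0 rnorm0.
apply: rnorm_eq0; rewrite -rnorm_star; apply/eqP; rewrite -sqrf_eq0 -rnorm_starM cstarK.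
by rewrite -/v v0 rnorm0.
Qed.

Lemma cpos_starM a : cpos (cstar a * a).
Proof.
(* With [r = |h|], [q = sqrt r] and [c = a (r - h)] one has
   [c^* c = - (q (r - h))^2], so that [c = 0] and [h = r]. *)
set h := cstar a * a.
have hs : cstar h = h by rewrite /h cstarMr cstarK.
have [r [rs rr rp rC]] := cpos_sqrt (cpos_sqr hs).
have [q [qs qq _ qC]] := cpos_sqrt rp.
have hr : h * r = r * h by apply: rC; rewrite mulrA.
have hq : h * q = q * h by exact: qC.
have rq : r * q = q * r by apply: qC.
pose g := r - h.
have gs : cstar g = g by rewrite cstarB rs hs.
have hg : h * g = g * h by rewrite mulrBr mulrBl hr.
have qg : q * g = g * q by rewrite mulrBr mulrBl hq rq.
have gg : g * h = - (r * g).
  by rewrite mulrBl mulrBr opprB rr.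
have ag0 : a * g = 0.
  apply: (@starM_eq_Nsqr _ (q * g)); first by rewrite cstarMr qs gs qg.
  rewrite cstarMr gs !mulrA -[g * cstar a * a]mulrA -/h gg mulNr -qq.
  by congr (- _); rewrite -[q * g * q]mulrA -qg !mulrA.
have hg0 : h * g = 0 by rewrite /h -mulrA ag0 mulr0.
have rg0 : r * g = 0 by rewrite -[LHS]opprK -gg -hg hg0 oppr0.
have g0 : g = 0.
  apply: rnorm_eq0; apply/eqP; rewrite -sqrf_eq0 -rnorm_sqr//.
  by rewrite {1}/g mulrBl rg0 hg0 subrr rnorm0.
by have -> : h = r by apply/esym/eqP; rewrite -subr_eq0 -/g g0.
Qed.

End SquareRoots.

(** * The extension theorem of M. Riesz and positive functionals *)

Section RieszExtension.
Context {R : realType} {V : lmodType R[i]}.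
Variables (C M : set V) (f : V -> R).
Hypothesis C0 : C 0.
Hypothesis CD : forall x y, C x -> C y -> C (x + y).
Hypothesis CZ : forall (r : R) x, 0 <= r -> C x -> C (r%:C%C *: x).
Hypothesis M0 : M 0.
Hypothesis MP : forall (r : R) x y, M x -> M y -> M (r%:C%C *: x + y).
Hypothesis fP : forall (r : R) x y, M x -> M y ->
  f (r%:C%C *: x + y) = r * f x + f y.
Hypothesis f_ge0 : forall x, M x -> C x -> 0 <= f x.
Hypothesis cofinal : forall x, exists2 m, M m & C (m - x).

Let graph : set (V * R) := [set p | M p.1 /\ p.2 = f p.1].

(** Graphs of partial extensions. The last clause admits the empty set, which Zorn's lemma meets as
    the union of the empty chain. *)
Let good (G : set (V * R)) :=
  [/\ forall (r : R) p q, G p -> G q -> G (r%:C%C *: p.1 + q.1, r * p.2 + q.2),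
      forall p, G p -> C p.1 -> 0 <= p.2
    & G !=set0 -> graph `<=` G].

Let good_graph : good graph.
Proof.
split=> //.
- by move=> r p q [Mp ->] [Mq ->]; split => /=; [exact: MP|rewrite fP].
- by move=> p [Mp ->]; exact: f_ge0.
- by move=> _.
Qed.

Let good_bigcup (F : set (set (V * R))) : F `<=` good -> total_on F subset ->
  good (\bigcup_(X in F) X).
Proof.
move=> Fg Ft; split.
- move=> r p q [X FX Xp] [Y FY Yq].
  have [XY|YX] := Ft _ _ FX FY.
  + by exists Y => //; have [h _ _] := Fg _ FY; apply: h => //; exact: XY.
  + by exists X => //; have [h _ _] := Fg _ FX; apply: h => //; exact: YX.
- by move=> p [X FX Xp]; have [_ h _] := Fg _ FX; exact: h.
- move=> [p [X FX Xp]]; have [_ _ h] := Fg _ FX.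
  by move=> q /h Xq; exists X => //; apply: Xq; exists p.
Qed.

Lemma riesz_extension : exists g : V -> R,
  [/\ forall (r : R) x y, g (r%:C%C *: x + y) = r * g x + g y,
      forall x, M x -> g x = f x
    & forall x, C x -> 0 <= g x].
Proof.
have [G [[Glin Gpos Ggraph] Gmax]] := Zorn_bigcup good_bigcup.
have G00 : graph (0, 0) by split => //=; have := fP 1 M0 M0; rewrite scaler0 addr0
  mul1r; lra.
have {Ggraph} graphG : graph `<=` G.
  apply: Ggraph; apply/set0P/eqP => G0.
  by apply: (Gmax graph) good_graph; rewrite G0; split => // /(_ (0, 0)); exact.
have G0 : G (0, 0) by exact: graphG.
have GZ (r : R) p : G p -> G (r%:C%C *: p.1, r * p.2).
  by move=> Gp; have := Glin r p (0, 0) Gp G0; rewrite /= !addr0.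
have GD p q : G p -> G q -> G (p.1 + q.1, p.2 + q.2).
  by move=> Gp Gq; have := Glin 1 p q Gp Gq; rewrite scale1r mul1r.
have GB p q : G p -> G q -> G (p.1 - q.1, p.2 - q.2).
  move=> Gp Gq; have := Glin (-1) q p Gq Gp.
  by rewrite rmorphN scaleN1r mulN1r addrC [- q.2 + _]addrC.
have total x : exists r, G (x, r).
  apply: contrapT => nx.
  have [m0 Mm0 Cm0] := cofinal (- x).
  have [m1 Mm1 Cm1] := cofinal x.
  (* [E] collects the values at elements below [x]; by [up] they lie below the values at elements
     above [x], so its supremum is an admissible value at [x]. *)
  pose E : set R := [set r | exists2 y, G (y, r) & C (x - y)].
  have up r : E r -> forall s y, G (y, s) -> C (y - x) -> r <= s.
    move=> [y Gy Cy] s z Gz Cz; rewrite -subr_ge0.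
    have := Gpos _ (GB _ _ Gz Gy); apply => /=.
    by rewrite -[z](subrK x) -addrA; exact: CD.
  have hE : has_sup E.
    split; last by exists (f m1) => r /up; apply; [apply: graphG|exact: Cm1].
    exists (- f m0), (- m0); last by rewrite opprK addrC -[x]opprK.
    by have := GZ (-1) (m0, f m0) (graphG (_, _) (conj Mm0 erefl));
      rewrite rmorphN scaleN1r mulN1r.
  pose c := sup E.
  pose G' : set (V * R) := [set p | exists (t : R) q, G q /\
     p = (q.1 + t%:C%C *: x, q.2 + t * c)].
  have GG' : G `<=` G'.
    by move=> p Gp; exists 0, p; split => //; rewrite scale0r mul0r !addr0; case: (p).
  have Gx : G' (x, c).
    by exists 1, (0, 0); split => //=; rewrite scale1r mul1r !add0r.
  apply: (Gmax G').
    by split => // /(_ (x, c)) G'G; apply: nx; exists c; exact: G'G.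
  split.
  - move=> r _ _ [t [p [Gp ->]]] [s [q [Gq ->]]] /=.
    exists (r * t + s), (r%:C%C *: p.1 + q.1, r * p.2 + q.2); split; first exact: Glin.
    congr (_, _) => /=; last by ring.
    by rewrite rmorphD rmorphM /= scalerDl -scalerA scalerDr addrACA.
  - move=> _ [t [[y s] [Gy ->]]] /= Cy.
    (* Dividing by [|t|] turns membership of [y + t x] in the cone into an element below [x] (for
       [t > 0]) or above [x] (for [t < 0]), whose value compares with the supremum [c]. *)
    have [t0|t0|t0] := ltrgt0P t.
    + have ti : 0 <= t^-1 by rewrite invr_ge0 ltW.
      have : E (- (t^-1 * s)).
        exists (- ((t^-1)%:C%C *: y)).
          by have := GZ (- t^-1) _ Gy; rewrite /= rmorphN scaleNr mulNr.
        have := CZ ti Cy; rewrite scalerDr scalerA -rmorphM /= mulVf ?gt_eqF//.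
        by rewrite scale1r opprK addrC.
      move=> /(ub_le_sup hE.2); rewrite -/c -(ler_pM2l t0) mulrN mulrA divff ?gt_eqF//.
      by rewrite mul1r; lra.
    + have ti : 0 <= - t^-1 by rewrite oppr_ge0 invr_le0 ltW.
      have : c <= - t^-1 * s.
        apply: ge_sup; first exact: hE.1.
        move=> r /up; apply; first exact: (GZ (- t^-1) _ Gy).
        have := CZ ti Cy; rewrite scalerDr scalerA -rmorphM /= mulNr mulVf ?lt_eqF//.
        by rewrite [(-1)%:C%C]rmorphN scaleN1r.
      have tn : 0 < - t by rewrite oppr_gt0.
      rewrite -(ler_pM2l tn) mulrA mulrNN divff ?lt_eqF//.
      by rewrite mul1r mulNr; lra.
    + have := Gpos _ Gy; rewrite t0 mul0r addr0 /=; apply.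
      by move: Cy; rewrite t0 scale0r addr0.
  - by move=> _ p /graphG; exact: GG'.
pose g x := sval (cid (total x)).
have gP x : G (x, g x) := svalP (cid (total x)).
(* Single-valuedness follows from positivity, applied to the difference of two values over the point
   [0]. *)
have gU x r : G (x, r) -> g x = r.
  move=> Gr; have h s s' : G (x, s) -> G (x, s') -> s <= s'.
    move=> Gs Gs'; have := Gpos _ (GB _ _ Gs' Gs) => /=.
    by rewrite subrr subr_ge0; apply.
  by apply/eqP; rewrite eq_le !h.
exists g; split.
- by move=> r x y; apply: gU; exact: (Glin r _ _ (gP x) (gP y)).
- by move=> x Mx; apply/gU/graphG.
- by move=> x Cx; exact: (Gpos _ (gP x)).
Qed.
End RieszExtension.

Section Complexification.
Context {R : realType} {V : lmodType R[i]}.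
Variable g : V -> R.
Hypothesis gP : forall (r : R) x y, g (r%:C%C *: x + y) = r * g x + g y.

(** The complex-linear functional whose real part is [g]. *)
Definition complexify (x : V) : R[i] := Complex (g x) (- g ('i%C *: x)).

Lemma complexifyP (a : R[i]) x y :
  complexify (a *: x + y) = a * complexify x + complexify y.
Proof.
have g0 : g 0 = 0 by have := gP 1 0 0; rewrite scaler0 addr0 mul1r; lra.
have gD u v : g (u + v) = g u + g v by have := gP 1 u v; rewrite scale1r mul1r.
have gZ (r : R) u : g (r%:C%C *: u) = r * g u by have := gP r u 0; rewrite !addr0
  g0 addr0.
case: a => u v; have -> : (u +i* v)%C = u%:C%C + v%:C%C * 'i%C by simpc.
have E1 : g ((u%:C%C + v%:C%C * 'i%C) *: x + y) = u * g x + v * g ('i%C *: x) + g y.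
  by rewrite gD scalerDl -scalerA gD !gZ.
have E2 : g ('i%C *: ((u%:C%C + v%:C%C * 'i%C) *: x + y)) =
    u * g ('i%C *: x) - v * g x + g ('i%C *: y).
  rewrite scalerDr scalerA mulrDr mulrCA sqr_iC mulrN1 mulrC scalerDl gD gD.
  by rewrite -scalerA -rmorphN !gZ mulNr.
by rewrite /complexify E1 E2; simpc; congr Complex; ring.
Qed.
End Complexification.

(** * Separation by positive functionals *)

Section States.
Context {R : realType} {A : cstarType R}.

Definition positive_functional (f : A -> R[i]) : Prop :=
  (forall a x y, f (a *: x + y) = a * f x + f y) /\
  forall x, 0 <= f (cstar x * x).

(** Extend [r 1 |-> r] from the real multiples of the unit, keeping it nonnegative on positive
    elements, on antihermitian elements and on [h - |h| / 2]. The last condition makes the value at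
    [h] at least [|h| / 2]. *)
Lemma state_exists (a : A) : a != 0 ->
  exists f, positive_functional f /\ f (cstar a * a) != 0.
Proof.
move=> a0; set h := cstar a * a.
have hs : cstar h = h by rewrite cstarMr cstarK.
have hp : cpos h := cpos_starM a.
have h0 : 0 < rnorm h.
  rewrite rnorm_starM exprn_gt0// lt_def rnorm_ge0 andbT.
  by apply: contraNneq a0 => /rnorm_eq0 ->.
pose e := rnorm h / 2.
have e0 : 0 < e by rewrite divr_gt0.
have he : ~ rnorm h <= e by rewrite /e => H; move: H h0; lra.
have n1 : (1 : A) != 0.
  by apply: contraNneq a0 => A0; rewrite -[a]mul1r A0 mul0r.
have p1 : cpos (1 : A) by rewrite -[1]mulr1; apply: cpos_sqr; exact: cstar1.
have s1inj : injective (fun r : R => r%:C%C *: (1 : A)).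
  by move=> r s /eqP; rewrite -subr_eq0 -scalerBl -rmorphB scaler_eq0 (negPf n1) orbF =>
   /eqP[/eqP]; rewrite subr_eq0 => /eqP.
pose C : set A := [set x | exists p (b : R) n, [/\ cpos p, 0 <= b, cstar n = - n
  & x = p + b%:C%C *: (h - e%:C%C *: (1 : A)) + n]].
pose M : set A := range (fun r : R => r%:C%C *: (1 : A)).
pose f (x : A) : R := xget 0 [set r : R | x = r%:C%C *: (1 : A)].
have fE r : f (r%:C%C *: (1 : A)) = r.
  by rewrite /f; case: xgetP => [s _ /s1inj ->//|/(_ r)[]].
have [||||||||g [glin gM gC]] := @riesz_extension R A C M f.
- by exists 0, 0, 0; split; rewrite // ?cstar0 ?oppr0 ?scale0r ?addr0//; exact: cpos0.
- move=> _ _ [p [b [n [pp b0 ns ->]]]] [p' [b' [n' [pp' b'0 n's ->]]]].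
  exists (p + p'), (b + b'), (n + n'); split.
  + exact: cposD.
  + exact: addr_ge0.
  + by rewrite cstarD ns n's opprD.
  + by rewrite rmorphD scalerDl addrACA [p + _ + _]addrACA.
- move=> r _ r0 [p [b [n [pp b0 ns ->]]]].
  exists (r%:C%C *: p), (r * b), (r%:C%C *: n); split.
  + exact: cposZ.
  + exact: mulr_ge0.
  + by rewrite cstarZr ns scalerN.
  + by rewrite 2!scalerDr [(r * b)%:C%C]rmorphM -scalerA.
- by exists 0 => //; rewrite scale0r.
- move=> r _ _ [s _ <-] [t _ <-]; exists (r * s + t) => //.
  by rewrite scalerA -rmorphM -scalerDl -rmorphD.
- move=> r _ _ [s _ <-] [t _ <-].
  by rewrite scalerA -rmorphM -scalerDl -rmorphD !fE.
(* If [r < 0], self-adjointness of the other terms gives [n = 0], so [b (e - h)] is the positive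
   element [p - r]; for [b > 0] this forces [|h| <= e], and for [b = 0] it forces [r = 0]. *)
- move=> _ [r _ <-] [p [b [n [pp b0 ns rE]]]]; rewrite fE leNgt; apply/negP => r0.
  have n0 : n = 0.
    have : cstar n = n.
      have -> : n = r%:C%C *: (1 : A) - (p + b%:C%C *: (h - e%:C%C *: (1 : A))) by
        rewrite rE addrC addKr.
      by rewrite cstarB cstarD !cstarZr cstarB cstarZr !cstar1 hs pp.1.
    rewrite ns => /eqP; rewrite -subr_eq0 -opprD oppr_eq0 -mulr2n -scaler_nat.
    by rewrite scaler_eq0 pnatr_eq0 /= => /eqP.
  have rp : cpos ((- r)%:C%C *: (1 : A)) by apply: cposZ => //; rewrite oppr_ge0 ltW.
  have bE : b%:C%C *: (e%:C%C *: (1 : A) - h) = p + (- r)%:C%C *: (1 : A).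
    by rewrite rmorphN scaleNr rE n0 addr0 opprD addrA subrr add0r -scalerN opprB.
  have [b00|bn0] := eqVneq b 0.
    have := cpos_sum0 (k := p) _ rp pp; rewrite addrC -bE b00 scale0r => /(_ erefl)
      /eqP.
    rewrite scaler_eq0 (negPf n1) orbF => /eqP[/eqP]; rewrite oppr_eq0 => /eqP r00.
    by move: r0; rewrite r00 ltxx.
  apply: he; apply: rnorm_cpos_le => //; first exact: ltW.
  have -> : e%:C%C *: (1 : A) - h = (b^-1)%:C%C *: (p + (- r)%:C%C *: (1 : A)).
    by rewrite -bE scalerA -rmorphM /= mulVf// scale1r.
  by apply: cposZ; [rewrite invr_ge0|exact: cposD].
(* Cofinality: the hermitian part [y] of [x] lies below [|y|], and the antihermitian part belongs to
   the cone with either sign. *)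
- move=> x; pose y := (2^-1)%:C%C *: (x + cstar x); pose n := (2^-1)%:C%C *: (x -
    cstar x).
  have xE : x = y + n.
    rewrite -scalerDr addrACA subrr addr0 -[x + x](_ : 2%:C%C *: x = _).
      by rewrite scalerA -rmorphM /= mulVf// scale1r.
    by rewrite -{2 3}[x]scale1r -scalerDl -rmorphD.
  exists ((rnorm y)%:C%C *: (1 : A)); first by exists (rnorm y).
  exists ((rnorm y)%:C%C *: (1 : A) - y), 0, (- n); split => //.
  + by apply: cposB => //; rewrite cstarZr cstarD cstarK addrC.
  + by rewrite opprK cstarN cstarZr cstarB cstarK -scalerN opprB.
  + by rewrite scale0r addr0 {1}xE opprD addrA.
have gn n : cstar n = - n -> g n = 0.
  move=> ns; have C' m : cstar m = - m -> C m.
    by move=> ms; exists 0, 0, m; split; rewrite ?scale0r ?add0r//; exact: cpos0.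
  have := gC _ (C' _ ns); have := gC _ (C' (- n) ltac:(by rewrite cstarN ns)).
  have := glin (-1) n 0; have := glin 1 0 0.
  by rewrite rmorphN !scaleN1r scaler0 !addr0; lra.
(* For self-adjoint [x] the element [i x] is antihermitian, so the complexified functional is real
   at [x]. *)
have gp x : cpos x -> complexify g x = (g x)%:C%C.
  move=> [xs _]; have ix : cstar ('i%C *: x) = - ('i%C *: x).
    by rewrite cstarZ conjCi xs scaleNr.
  by rewrite /complexify (gn _ ix) oppr0.
have gp0 x : cpos x -> 0 <= g x.
  by move=> xp; apply: gC; exists x, 0, 0; split; rewrite ?cstar0 ?oppr0 ?scale0r
    ?addr0.
exists (complexify g); split; first split.
- exact: complexifyP.
- by move=> x; rewrite gp ?ler0c ?gp0//; exact: cpos_starM.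
- rewrite gp//; suff : e <= g h by move=> eh; apply/eqP => -[gh]; move: eh e0;
    rewrite gh; lra.
  have : 0 <= g (h - e%:C%C *: (1 : A)).
    apply: gC; exists 0, 1, 0; split; rewrite ?scale1r ?cstar0 ?oppr0 ?add0r ?addr0//.
    exact: cpos0.
  have := glin (- e) 1 h; rewrite rmorphN scaleNr addrC => ->.
  rewrite (_ : g 1 = 1); last by rewrite -[X in g X]scale1r (gM (1%:C%C *: (1 :
    A))) ?fE//; exists 1.
  lra.
Qed.
End States.

(** * Hilbert spaces from positive kernels *)

Section ComplexModulus.
Context {R : realType}.
Implicit Types (z w : R[i]).

Definition cabs z : R := complex.Re `|z|.

Lemma cabsE z : `|z| = (cabs z)%:C%C. Proof. exact: normC_re. Qed.

Lemma cabs_ge0 z : 0 <= cabs z. Proof. by rewrite -ler0c -cabsE. Qed.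

Lemma cabsD z w : cabs (z + w) <= cabs z + cabs w.
Proof. by rewrite -lecR rmorphD /= -!cabsE ler_normD. Qed.

Lemma cabsM z w : cabs (z * w) = cabs z * cabs w.
Proof. by apply: complexI; rewrite rmorphM /= -!cabsE normrM. Qed.

Lemma cabsN z : cabs (- z) = cabs z. Proof. by rewrite /cabs normrN. Qed.

Lemma cabsB z w : cabs (z - w) = cabs (w - z). Proof. by rewrite -cabsN opprB. Qed.

Lemma cabs0 : cabs 0 = 0. Proof. by rewrite /cabs normr0. Qed.

Lemma cabs_conj z : cabs (Num.conj z) = cabs z.
Proof. by rewrite /cabs norm_conjC. Qed.

Lemma cabs_real (r : R) : 0 <= r -> cabs r%:C%C = r.
Proof. exact: normc_real. Qed.

Lemma cabs_eq0 z : cabs z = 0 -> z = 0.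
Proof. by move=> z0; apply/normr0_eq0; rewrite cabsE z0. Qed.

Lemma cabs_sqr z : z * Num.conj z = (cabs z ^+ 2)%:C%C.
Proof. by rewrite -normCK cabsE rmorphXn. Qed.

Lemma Re_le_cabs z : complex.Re z <= cabs z.
Proof.
have [z0|z0] := leP (complex.Re z) 0; first exact: le_trans z0 (cabs_ge0 z).
rewrite -ler_sqr ?nnegrE ?cabs_ge0 ?(ltW z0)//.
have := cabs_sqr z; case: z {z0} => a b /(congr1 (@complex.Re R)) /= <-.
by rewrite mulrN opprK expr2 lerDl -expr2 sqr_ge0.
Qed.

Lemma Re_dist z w : `|complex.Re z - complex.Re w| <= cabs (z - w).
Proof.
rewrite ler_norml; apply/andP; split.
  by have := Re_le_cabs (w - z); rewrite cabsB; case: z w => [a b] [c d] /=; lra.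
by have := Re_le_cabs (z - w); case: z w => [a b] [c d] /=.
Qed.

Lemma cabs_i : cabs 'i%C = 1.
Proof.
apply/eqP; rewrite -(@eqrXn2 _ 2)// ?cabs_ge0// expr1n; apply/eqP.
by apply: complexI; rewrite -cabs_sqr conjCi mulrN sqr_iC opprK.
Qed.

Lemma cabs_le_ReIm (x y : R) : cabs (Complex x y) <= `|x| + `|y|.
Proof.
have -> : Complex x y = x%:C%C + 'i%C * y%:C%C by simpc.
rewrite (le_trans (cabsD _ _))// cabsM.
have h (r : R) : cabs r%:C%C = `|r|.
  have [r0|/ltW r0] := leP 0 r; first by rewrite cabs_real// ger0_norm.
  by rewrite -cabsN -rmorphN cabs_real ?oppr_ge0// ler0_norm.
by rewrite !h cabs_i mul1r.
Qed.

Lemma cabs_small z (c : R) : (forall e, 0 < e -> e <= 1 -> cabs z <= c * e) -> z = 0.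
Proof.
move=> h; apply/cabs_eq0/eqP; rewrite eq_le cabs_ge0 andbT.
apply/ler_addgt0Pr => e e0; rewrite add0r.
have c0 : 0 < `|c| + 1 by rewrite ltr_wpDl.
pose d := Num.min 1 (e / (`|c| + 1)).
have d0 : 0 < d by rewrite lt_min ltr01 divr_gt0.
apply: (le_trans (h d d0 _)); first by rewrite ge_min lexx.
apply: (@le_trans _ _ ((`|c| + 1) * d)).
  by rewrite ler_pM2r// (le_trans (ler_norm c))// lerDl.
by rewrite mulrC -ler_pdivlMr// ge_min lexx orbT.
Qed.

Lemma interval_helly I (i0 : I) (c r : I -> R) :
  (forall i j, `|c i - c j| <= r i + r j) ->
  exists L, forall i, `|L - c i| <= r i.
Proof.
move=> h; pose E := range (fun i => c i - r i).
have ub j : ubound E (c j + r j).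
  by move=> _ [i _ <-]; have := h i j; rewrite ler_norml => /andP[]; lra.
have hE : has_sup E by split; [exists (c i0 - r i0), i0|exists (c i0 + r i0)].
exists (sup E) => i; rewrite ler_norml; apply/andP; split.
  by have /(ub_le_sup hE.2) : E (c i - r i) by [exists i]; lra.
by have := ge_sup hE.1 (ub i); lra.
Qed.

(** Real and imaginary parts are treated separately, at the cost of doubling the radii. The lemma
    produces limits below: the error discs around approximate values meet pairwise. *)
Lemma disk_helly I (i0 : I) (c : I -> R[i]) (r : I -> R) :
  (forall i j, cabs (c i - c j) <= r i + r j) ->
  exists L, forall i, cabs (L - c i) <= 2 * r i.
Proof.
move=> h.
have [x xP] : exists x, forall i, `|x - complex.Re (c i)| <= r i.
  by apply: (@interval_helly _ i0 (fun i => complex.Re (c i)) r) => i j; exact: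
    le_trans (Re_dist _ _) (h i j).
have [y yP] : exists y, forall i, `|y - complex.Im (c i)| <= r i.
  apply: (@interval_helly _ i0 (fun i => complex.Im (c i)) r) => i j; apply:
    le_trans (h i j).
  have ImE z : complex.Im z = complex.Re (- 'i%C * z).
    by case: z => a b /=; rewrite oppr0 mul0r sub0r mulN1r opprK.
  rewrite !ImE (le_trans (Re_dist _ _))// -mulrBr cabsM cabsN cabs_i mul1r//.
exists (Complex x y) => i; have := xP i; have := yP i.
case: (c i) => a b /= hy hx; have := cabs_le_ReIm (x - a) (y - b).
by rewrite /= => /le_trans; apply; lra.
Qed.
End ComplexModulus.

(** * Formal combinations of points and positive kernels *)

Section FormalCombinations.
Context {R : realType} {X : Type}.
Implicit Types (u v : X -> R[i]^o) (s t : seq (R[i] * X)) (a b : R[i]).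

(** The inner product of [u] with the combination of kernel sections with coefficients [p.1], as the
    reproducing property dictates; hence the conjugates. *)
Definition feval u t : R[i] := \sum_(p <- t) Num.conj p.1 * u p.2.

Definition fscale a t : seq (R[i] * X) := [seq (a * p.1, p.2) | p <- t].

Lemma feval_cat u s t : feval u (s ++ t) = feval u s + feval u t.
Proof. by rewrite /feval big_cat. Qed.

Lemma feval_scale a u t : feval u (fscale a t) = Num.conj a * feval u t.
Proof.
rewrite /feval big_map mulr_sumr; apply: eq_bigr => p _ /=.
by rewrite rmorphM mulrA.
Qed.

Lemma fevalP a u v t : feval (a *: u + v) t = a * feval u t + feval v t.
Proof.
rewrite /feval mulr_sumr -big_split /=; apply: eq_bigr => p _.
by rewrite !fctE mulrDr; congr (_ + _); rewrite [LHS]mulrCA.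
Qed.

Lemma feval1 u x : feval u [:: (1, x)] = u x.
Proof. by rewrite /feval big_seq1 /= conjC1 mul1r. Qed.

Definition fsection (k : X -> X -> R[i]) t : X -> R[i]^o :=
  fun x => \sum_(p <- t) p.1 * k p.2 x.

Definition positive_kernel (k : X -> X -> R[i]) :=
  forall t, 0 <= feval (fsection k t) t.

Lemma fsection_cat k s t : fsection k (s ++ t) = fsection k s + fsection k t.
Proof. by apply/funext => x; rewrite /fsection big_cat. Qed.

Lemma fsection_scale k a t : fsection k (fscale a t) = a *: fsection k t.
Proof.
apply/funext => x; transitivity (a * fsection k t x) => //.
rewrite /fsection big_map mulr_sumr.
by apply: eq_bigr => p _ /=; rewrite mulrA.
Qed.

Lemma fsection1 k x y : fsection k [:: (1, x)] y = k x y.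
Proof. by rewrite /fsection big_seq1 mul1r. Qed.

(** Polarization: the form is real at [x + y] and at [i x + y]. *)
Lemma positive_kernelC k : positive_kernel k ->
  forall x y, k y x = Num.conj (k x y).
Proof.
move=> kP x y.
have h a : complex.Im (feval (fsection k [:: (a, x); (1, y)]) [:: (a, x); (1, y)]) = 0.
  by have := ger0_Im (kP [:: (a, x); (1, y)]); case: (feval _ _) => u v /=.
have h0 z : complex.Im (k z z) = 0.
  have := kP [:: (1, z)]; rewrite feval1 fsection1.
  by case: (k z z) => u v /=; rewrite lecE /= => /andP[/eqP].
have := h 1; have := h 'i%C; rewrite /feval /fsection !big_cons !big_nil /=.
rewrite conjCi conjC1 !mul1r !addr0.
have := h0 x; have := h0 y.
case: (k x x) (k x y) (k y x) (k y y) => [a a'] [b b'] [c c'] [d d'] /=.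
move=> -> ->; simpc => h1 h2; congr Complex; move: h1 h2; lra.
Qed.
End FormalCombinations.

Record pkernel (R : realType) (X : Type) := PKernel {
  pkernel_fun :> X -> X -> R[i];
  kernel_positive : positive_kernel pkernel_fun }.

(** * The Hilbert space of a positive kernel *)

Section Rkhs.
Context {R : realType} {X : Type} (k : pkernel R X).
Implicit Types (s t : seq (R[i] * X)).

Definition fform s t : R[i] := feval (fsection k s) t.

Definition fnorm t : R := Num.sqrt (complex.Re (fform t t)).

Lemma fform_catl s t w : fform (s ++ t) w = fform s w + fform t w.
Proof.
by have := fevalP 1 (fsection k s) (fsection k t) w; rewrite scale1r mul1r
  -fsection_cat.
Qed.

Lemma fform_scalel a s w : fform (fscale a s) w = a * fform s w.
Proof.
rewrite /fform fsection_scale -[_ *: _]addr0 fevalP [X in _ + X](_ : _ = 0) ?addr0//.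
by rewrite /feval big1// => p _; rewrite mulr0.
Qed.

Lemma fform_catr s t w : fform w (s ++ t) = fform w s + fform w t.
Proof. exact: feval_cat. Qed.

Lemma fform_scaler a s w : fform w (fscale a s) = Num.conj a * fform w s.
Proof. exact: feval_scale. Qed.

Lemma fformC s t : fform t s = Num.conj (fform s t).
Proof.
rewrite /fform /feval /fsection rmorph_sum /=.
under eq_bigr do rewrite mulr_sumr.
rewrite exchange_big /=; apply: eq_bigr => p _.
rewrite rmorphM /= conjCK rmorph_sum mulr_sumr; apply: eq_bigr => q _ /=.
by rewrite rmorphM /= -(positive_kernelC (kernel_positive k)) mulrCA.
Qed.

Lemma fnorm_ge0 t : 0 <= fnorm t. Proof. exact: sqrtr_ge0. Qed.

Lemma fformE t : fform t t = (fnorm t ^+ 2)%:C%C.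
Proof.
have := kernel_positive k t; rewrite -/(fform t t) => h.
rewrite sqr_sqrtr; first by rewrite RRe_real// ger0_real.
by move: h; rewrite lecE => /andP[].
Qed.

(** Positivity at [(b + e) s - c t]. The parameter [e > 0] keeps [b + e] invertible when [t] has
    seminorm zero, and is taken arbitrarily small at the end. *)
Lemma fform_CS s t : cabs (fform s t) <= fnorm s * fnorm t.
Proof.
rewrite -ler_sqr ?nnegrE ?mulr_ge0 ?cabs_ge0 ?fnorm_ge0// exprMn.
set a := fnorm s ^+ 2; set b := fnorm t ^+ 2; set c := fform s t.
have a0 : 0 <= a by rewrite sqr_ge0.
have b0 : 0 <= b by rewrite sqr_ge0.
apply/ler_addgt0Pr => e' e'0.
pose e := e' / (a + 1); have a1 : 0 < a + 1 by rewrite ltr_wpDl.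
have e0 : 0 < e by rewrite divr_gt0.
have : cabs c ^+ 2 <= (b + e) * a.
  have be : 0 < b + e by rewrite ltr_wpDl.
  have := kernel_positive k (fscale (b + e)%:C%C s ++ fscale (- c) t).
  rewrite -/(fform _ _) !fform_catl !fform_catr !fform_scalel !fform_scaler.
  rewrite !fformE -/a -/b [fform t s]fformC -/c conj_Creal ?complex_real//.
  rewrite rmorphN.
  have -> : (b + e)%:C%C * ((b + e)%:C%C * a%:C%C) + (b + e)%:C%C * (- Num.conj c * c)
     + (- c * ((b + e)%:C%C * Num.conj c) + - c * (- Num.conj c * b%:C%C))
     = ((b + e) ^+ 2 * a)%:C%C - (c * Num.conj c) * ((b + e) *+ 2 - b)%:C%C.
    by rewrite !(rmorphB, rmorphMn, rmorphM, rmorphXn, rmorphD) /=; ring.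
  rewrite cabs_sqr -rmorphM -rmorphB ler0c.
  have := sqr_ge0 (cabs c); set x := cabs c ^+ 2 => x0.
  move=> h; rewrite -(ler_pM2l be).
  have : 0 <= x * e by rewrite mulr_ge0// ltW.
  move: h; rewrite mulr2n; lra.
move=> /le_trans; apply; rewrite mulrDl mulrC lerD2l.
by rewrite /e mulrAC ler_pdivrMr// ler_pM2l// lerDl.
Qed.

(* The Hilbert space of the kernel is realized as the dual of the formal
   combinations of points, so that no completion has to be built. *)
Definition kernel_bounded : {pred X -> R[i]^o} := fun u =>
  `[< exists2 M : R, 0 <= M & forall t, cabs (feval u t) <= M * fnorm t >].

Record rkhs := Rkhs {
  rkhs_fun :> X -> R[i]^o;
  rkhs_funP : rkhs_fun \in kernel_bounded }.

HB.instance Definition _ := [isSub for rkhs_fun].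
HB.instance Definition _ := [Choice of rkhs by <:].

Fact kernel_bounded_submod : subsemimod_closed kernel_bounded.
Proof.
have addP u v : u \in kernel_bounded -> v \in kernel_bounded ->
    forall a, a *: u + v \in kernel_bounded.
  move=> /asboolP[M M0 uM] /asboolP[N N0 vN] a; apply/asboolP.
  exists (cabs a * M + N) => [|t]; first by rewrite addr_ge0 ?mulr_ge0 ?cabs_ge0.
  rewrite fevalP (le_trans (cabsD _ _))// mulrDl lerD// cabsM -mulrA.
  by rewrite ler_wpM2l ?cabs_ge0.
have zeroP : 0 \in kernel_bounded.
  apply/asboolP; exists 0 => // t.
  by rewrite /feval big1 ?cabs0 ?mul0r// => p _; rewrite mulr0.
split; first split => //.
- by move=> u v uB vB; have := addP u v uB vB 1; rewrite scale1r.
- by move=> a u uB; have := addP u 0 uB zeroP a; rewrite addr0.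
Qed.
HB.instance Definition _ := GRing.SubChoice_isSubLmodule.Build
  R[i] (X -> R[i]^o) kernel_bounded rkhs kernel_bounded_submod.

Implicit Types u v : rkhs.

Lemma rkhsP u v : (forall x, u x = v x) -> u = v.
Proof. by move=> uv; apply/val_inj/funext. Qed.

Lemma fevalD u v t : feval (u + v) t = feval u t + feval v t.
Proof. by have := fevalP 1 u v t; rewrite scale1r mul1r. Qed.

Lemma fevalZ a u t : feval (a *: u) t = a * feval u t.
Proof.
have := fevalP a u 0 t; rewrite addr0 => ->; rewrite [X in _ + X](_ : _ = 0) ?addr0//.
by rewrite /feval big1// => p _; rewrite mulr0.
Qed.

Lemma fevalB u v t : feval (u - v) t = feval u t - feval v t.
Proof. by rewrite -scaleN1r fevalD fevalZ mulN1r. Qed.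

Definition kbound u : set R :=
  [set M | 0 <= M /\ forall t, cabs (feval u t) <= M * fnorm t].

Definition knorm u : R := inf (kbound u).

Let kbound_neq0 u : kbound u !=set0.
Proof. by have /asboolP[M M0 uM] := rkhs_funP u; exists M. Qed.

Lemma knorm_ge0 u : 0 <= knorm u.
Proof. by apply: lb_le_inf; [exact: kbound_neq0|move=> M []]. Qed.

Lemma knorm_le u M : 0 <= M -> (forall t, cabs (feval u t) <= M * fnorm t) ->
  knorm u <= M.
Proof. by move=> M0 uM; apply: ge_inf => //; exists 0 => N []. Qed.

Lemma knormP u t : cabs (feval u t) <= knorm u * fnorm t.
Proof.
have [t0|t0] := eqVneq (fnorm t) 0.
  by have /asboolP[M M0 /(_ t)] := rkhs_funP u; rewrite t0 !mulr0.
have tp : 0 < fnorm t by rewrite lt_def t0 fnorm_ge0.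
rewrite -ler_pdivrMr//; apply: lb_le_inf; first exact: kbound_neq0.
by move=> M [_ uM]; rewrite ler_pdivrMr.
Qed.

Fact knormD u v : (knorm (u + v))%:C%C <= (knorm u)%:C%C + (knorm v)%:C%C.
Proof.
rewrite -rmorphD lecR; apply: knorm_le => [|t].
  by rewrite addr_ge0 ?knorm_ge0.
by rewrite fevalD mulrDl (le_trans (cabsD _ _))// lerD// knormP.
Qed.

Let knormZ_le a u : knorm (a *: u) <= cabs a * knorm u.
Proof.
apply: knorm_le => [|t]; first by rewrite mulr_ge0 ?cabs_ge0 ?knorm_ge0.
by rewrite fevalZ cabsM -mulrA ler_wpM2l ?cabs_ge0// knormP.
Qed.

Fact knormZ a u : (knorm (a *: u))%:C%C = `|a| * (knorm u)%:C%C.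
Proof.
rewrite cabsE -rmorphM; congr (_%:C)%C; apply/eqP.
rewrite eq_le knormZ_le andTb.
have [->|a0] := eqVneq a 0; first by rewrite cabs0 mul0r knorm_ge0.
have := knormZ_le a^-1 (a *: u).
rewrite scalerA mulVf// scale1r => h.
have aa : cabs a * cabs a^-1 = 1 by rewrite -cabsM divff// /cabs normr1.
by rewrite (le_trans (ler_wpM2l (cabs_ge0 a) h))// mulrA aa mul1r.
Qed.

Fact knorm_eq0 u : (knorm u)%:C%C = 0 -> u = 0.
Proof.
move=> [u0]; apply: rkhsP => x; rewrite -[LHS]feval1; apply/cabs_eq0/eqP.
by rewrite eq_le cabs_ge0 andbT (le_trans (knormP _ _))// u0 mul0r.
Qed.

HB.instance Definition _ := Lmodule_isNormed.Build R[i] rkhs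
  knormD knormZ knorm_eq0.

Lemma knormE u : rnorm u = knorm u. Proof. by []. Qed.

Definition ksection t : rkhs.
Proof.
exists (fsection k t); apply/asboolP; exists (fnorm t) => [|s].
  exact: fnorm_ge0.
exact: fform_CS.
Defined.

Lemma feval_ksection s t : feval (ksection s) t = fform s t.
Proof. by []. Qed.

Lemma rnorm_ksection t : rnorm (ksection t) = fnorm t.
Proof.
rewrite knormE; apply/eqP; rewrite eq_le knorm_le ?fnorm_ge0//=; last first.
  by move=> s; exact: fform_CS.
have [->|t0] := eqVneq (fnorm t) 0; first exact: knorm_ge0.
have tp : 0 < fnorm t by rewrite lt_def t0 fnorm_ge0.
rewrite -(ler_pM2r tp) -expr2 (le_trans _ (knormP _ t))// feval_ksection.
by rewrite fformE cabs_real// sqr_ge0.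
Qed.

Lemma feval_dist u s t :
  cabs (feval u s - feval u t) <= rnorm u * rnorm (ksection s - ksection t).
Proof.
pose w := s ++ fscale (- 1) t.
have -> : feval u s - feval u t = feval u w.
  by rewrite feval_cat feval_scale rmorphN1 mulN1r.
have -> : ksection s - ksection t = ksection w.
  by apply: rkhsP => x; rewrite /= fsection_cat fsection_scale scaleN1r.
by rewrite rnorm_ksection; exact: knormP.
Qed.

(* As in the proof of Riesz' theorem, an almost minimizer of
   [|ksection t - u|^2 - |u|^2] almost represents [u]. *)
Lemma ksection_dense u (e : R) : 0 < e -> exists t, rnorm (u - ksection t) <= e.
Proof.
move=> e0; pose J t := fnorm t ^+ 2 - complex.Re (feval u t) *+ 2.
have J_ge t : - knorm u ^+ 2 <= J t.
  rewrite /J mulr2n; have := le_trans (Re_le_cabs _) (knormP u t).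
  by have := sqr_ge0 (fnorm t - knorm u); rewrite sqrrB mulr2n; nra.
have hi : has_inf (range J).
  by split; [exists (J [::]), [::]|exists (- knorm u ^+ 2) => _ [t _ <-]].
have [_ [t _ <-] Jt] := inf_adherent (exprn_gt0 2 e0) hi.
have {Jt} minJ s : J t <= J s + e ^+ 2.
  have : inf (range J) <= J s by apply: ge_inf; [exact: hi.2|exists s].
  by move: Jt; lra.
exists t; rewrite knormE; apply: knorm_le => [|w]; first exact: ltW.
set z := feval _ w.
have [w0|w0] := eqVneq (fnorm w) 0.
  by rewrite (le_trans (knormP _ _))// w0 !mulr0.
have wp : 0 < fnorm w by rewrite lt_def w0 fnorm_ge0.
have key a : 0 <= cabs a ^+ 2 * fnorm w ^+ 2 - complex.Re (Num.conj a * z) *+ 2 + e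
  ^+ 2.
  have := minJ (t ++ fscale a w).
  have sq s : fnorm s ^+ 2 = complex.Re (fform s s) by rewrite fformE.
  rewrite /J !sq !fform_catl !fform_catr !fform_scalel !fform_scaler feval_cat
    feval_scale.
  rewrite !fformE mulrA cabs_sqr -rmorphM -[feval u w](subrK (fform t w)).
  rewrite -feval_ksection -fevalB -/z feval_ksection [fform w t]fformC.
  have -> : a * Num.conj (fform t w) = Num.conj (Num.conj a * fform t w).
    by rewrite rmorphM /= conjCK.
  rewrite mulrDr; move: (Num.conj a * fform t w) (Num.conj a * z) (feval u t).
  by move=> [p p'] [q q'] [r r'] /=; rewrite !mulr2n; lra.
(* This [a] minimizes the quadratic expression in [key], which then reads [|z|^2 <= e^2 |w|^2]. *)
have := key ((fnorm w ^- 2)%:C%C * z).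
rewrite rmorphM /= conj_Creal ?complex_real// -mulrA [Num.conj z * z]mulrC cabs_sqr
  -rmorphM.
rewrite cabsM cabs_real ?invr_ge0 ?sqr_ge0//= => h.
rewrite -ler_sqr ?nnegrE ?mulr_ge0 ?cabs_ge0 ?fnorm_ge0 ?(ltW e0)//.
have wp2 : 0 < fnorm w ^+ 2 by rewrite exprn_gt0.
rewrite exprMn -ler_pdivrMr// mulrC -subr_ge0 (le_trans h)// le_eqVlt; apply/orP; left.
by apply/eqP; field; rewrite w0.
Qed.

(** Balls belonging to the filter meet pairwise, so [disk_helly] provides a common value at each
    point of [X]. The doubled radii are repaired by [lB], which compares with arbitrarily small
    balls. *)
Fact rkhs_complete (F : set_system rkhs) : ProperFilter F -> cauchy F -> cvg F.
Proof.
move=> FF /cauchyP Fc.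
have Fc' (e : R) : 0 < e -> exists v, F [set w : rkhs | rnorm (v - w) <= e].
  move=> e0; have [|v Fv] := Fc e%:C%C; first by rewrite ltcR.
  exists v; apply: filterS Fv => w; rewrite -ball_normE /= rnormE ltcR.
  exact: ltW.
pose I := {p : rkhs * R | F [set w | rnorm (p.1 - w) <= p.2]}.
have near (i j : I) t : cabs (feval (sval i).1 t - feval (sval j).1 t) <=
    ((sval i).2 + (sval j).2) * fnorm t.
  case: i j => [[v d] /= Fv] [[v' d'] /= Fv'].
  have [w [/= vw v'w]] := @filter_ex _ F _ _ (filterI Fv Fv').
  rewrite -fevalB (le_trans (knormP _ _))// ler_wpM2r ?fnorm_ge0//.
  have -> : v - v' = (v - w) - (v' - w) by rewrite opprB addrA subrK.
  rewrite -knormE (le_trans (rnormD _ _))// rnormN lerD//.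
have [v0 Fv0] := Fc' 1 ltr01.
pose i0 : I := exist _ (v0, 1) Fv0.
have /choice[l lP] : forall x, exists L, forall i : I,
    cabs (L - (sval i).1 x) <= 2 * ((sval i).2 * fnorm [:: (1, x)]).
  move=> x; apply: (disk_helly i0) => i j.
  by rewrite -mulrDl -[(sval i).1 x]feval1 -[(sval j).1 x]feval1 near.
have lB (i : I) t : cabs (feval l t - feval (sval i).1 t) <= (sval i).2 * fnorm t.
  apply/ler_addgt0Pr => d d0.
  pose K := \sum_(p <- t) cabs p.1 * (2 * fnorm [:: (1, p.2)]) + fnorm t.
  have K0 : 0 <= K.
    rewrite addr_ge0 ?fnorm_ge0// sumr_ge0// => p _.
    by rewrite !mulr_ge0 ?cabs_ge0 ?fnorm_ge0.
  have K1 : 0 < K + 1 by rewrite ltr_wpDl.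
  have [w Fw] := Fc' (d / (K + 1)) ltac:(exact: divr_gt0).
  pose j : I := exist _ (w, d / (K + 1)) Fw.
  have h1 : cabs (feval l t - feval w t) <=
      d / (K + 1) * \sum_(p <- t) cabs p.1 * (2 * fnorm [:: (1, p.2)]).
    rewrite /feval -sumrB mulr_sumr.
    elim/big_rec2: _ => [|p y z _ IH]; first by rewrite cabs0.
    rewrite (le_trans (cabsD _ _))// lerD// -mulrBr cabsM cabs_conj mulrCA.
    rewrite ler_wpM2l ?cabs_ge0//.
    by have := lP p.2 j; rewrite /= mulrCA.
  have h2 := near j i t; rewrite /= in h2.
  have -> : feval l t - feval (sval i).1 t = (feval l t - feval w t) +
     (feval w t - feval (sval i).1 t) by rewrite addrA subrK.
  rewrite (le_trans (cabsD _ _))//.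
  apply: (le_trans (lerD h1 h2)).
  rewrite mulrDl addrA -mulrDr -/K addrC lerD2l.
  by rewrite mulrAC ler_pdivrMr// ler_pM2l// lerDl.
have lK : l \in kernel_bounded.
  apply/asboolP; exists (1 + knorm v0) => [|t].
    by rewrite addr_ge0 ?knorm_ge0.
  rewrite -[feval l t](subrK (feval v0 t)) (le_trans (cabsD _ _))// mulrDl.
  by rewrite lerD ?knormP//; exact: (lB i0).
apply/cvg_ex; exists (Rkhs lK).
apply/cvgrPdist_le => _/posnumP[eps]; have [e e0 ->] := posC eps.
have [v Fv] := Fc' (e / 2) ltac:(exact: divr_gt0).
rewrite near_simpl; apply: filterS (Fv) => w /= vw; rewrite rnormE lecR.
have -> : Rkhs lK - w = (Rkhs lK - v) + (v - w) by rewrite addrA subrK.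
rewrite (le_trans (rnormD _ _))// [leRHS]splitr lerD//.
rewrite knormE; apply: knorm_le => [|t]; first by rewrite divr_ge0// ltW.
rewrite fevalB; exact: (lB (exist _ (v, e / 2) Fv)).
Qed.

HB.instance Definition _ := Uniform_isComplete.Build rkhs rkhs_complete.

(** The inner product is the limit of [feval u t] as [ksection t] tends to [v]: around these values,
    the discs of radius [|u| |v - ksection t|] meet pairwise. *)
Fact rkhs_dot_exists u v : exists L, forall t,
  cabs (L - feval u t) <= 2 * (rnorm u * rnorm (v - ksection t)).
Proof.
apply: (disk_helly [::]) => s t; rewrite -mulrDr.
rewrite (le_trans (feval_dist _ _ _))// ler_wpM2l ?rnorm_ge0//.
have -> : ksection s - ksection t = (v - ksection t) - (v - ksection s).
  by rewrite opprB [RHS]addrC addrA subrK.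
by rewrite (le_trans (rnormD _ _))// rnormN addrC.
Qed.

Definition rkhs_dot u v : R[i] := sval (cid (rkhs_dot_exists u v)).

Lemma rkhs_dotP u v t :
  cabs (rkhs_dot u v - feval u t) <= 2 * (rnorm u * rnorm (v - ksection t)).
Proof. exact: (svalP (cid (rkhs_dot_exists u v))). Qed.

Lemma rkhs_dot_section u t : rkhs_dot u (ksection t) = feval u t.
Proof.
apply/eqP; rewrite -subr_eq0; apply/eqP/cabs_eq0/eqP.
by rewrite eq_le cabs_ge0 andbT (le_trans (rkhs_dotP _ _ t))// subrr rnorm0 !mulr0.
Qed.

Lemma rkhs_dotPl a u v w : rkhs_dot (a *: u + v) w = a * rkhs_dot u w + rkhs_dot v w.
Proof.
apply/eqP; rewrite -subr_eq0; apply/eqP.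
apply: (@cabs_small _ _ (2 * (rnorm (a *: u + v) + cabs a * rnorm u + rnorm v))).
move=> e e0 _; have [t wt] := ksection_dense w e0.
have -> : rkhs_dot (a *: u + v) w - (a * rkhs_dot u w + rkhs_dot v w) =
  (rkhs_dot (a *: u + v) w - feval (a *: u + v) t)
  - a * (rkhs_dot u w - feval u t) - (rkhs_dot v w - feval v t).
  by rewrite fevalD fevalZ; ring.
rewrite (le_trans (cabsD _ _))// cabsN (le_trans (lerD (cabsD _ _) (lexx _)))//.
rewrite cabsN cabsM.
have h (u' : rkhs) : cabs (rkhs_dot u' w - feval u' t) <= 2 * (rnorm u' * e).
  by rewrite (le_trans (rkhs_dotP _ _ t))// !ler_wpM2l ?rnorm_ge0.
have := h (a *: u + v); have := ler_wpM2l (cabs_ge0 a) (h u); have := h v; lra.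
Qed.

Lemma rnorm_ksection_le v t : fnorm t <= rnorm v + rnorm (v - ksection t).
Proof.
rewrite -rnorm_ksection -[ksection t](subKr v) (le_trans (rnormD _ _))//.
by rewrite rnormN subKr.
Qed.

Lemma rkhs_dotC u v : rkhs_dot u v = Num.conj (rkhs_dot v u).
Proof.
apply/eqP; rewrite -subr_eq0; apply/eqP.
apply: (@cabs_small _ _ (3 * (rnorm u + rnorm v) + 2)) => e e0 e1.
have [t vt] := ksection_dense v e0; have [s us] := ksection_dense u e0.
have -> : rkhs_dot u v - Num.conj (rkhs_dot v u) =
    (rkhs_dot u v - feval u t) + feval (u - ksection s) t
    - Num.conj ((rkhs_dot v u - feval v s) + feval (v - ksection t) s).
  rewrite !fevalB !feval_ksection !rmorphD !rmorphN /= -[Num.conj (fform t s)]fformC.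
  by ring.
rewrite (le_trans (cabsD _ _))// cabsN cabs_conj.
have h (u' v' : rkhs) t' s' : rnorm (v' - ksection t') <= e -> rnorm (u' - ksection
  s') <= e ->
    cabs (rkhs_dot u' v' - feval u' t' + feval (u' - ksection s') t') <=
    2 * (rnorm u' * e) + e * (rnorm v' + 1).
  move=> v't u's; rewrite (le_trans (cabsD _ _))// lerD//.
    by rewrite (le_trans (rkhs_dotP _ _ t'))// !ler_wpM2l ?rnorm_ge0.
  rewrite (le_trans (knormP _ _))// ler_pM ?knorm_ge0 ?fnorm_ge0//.
  by rewrite (le_trans (rnorm_ksection_le v' t'))// lerD2l (le_trans v't).
by have := h _ _ _ _ vt us; have := h _ _ _ _ us vt; lra.
Qed.

Lemma rkhs_dotE u : rkhs_dot u u = `|u| ^+ 2.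
Proof.
rewrite rnormE -rmorphXn; apply/eqP; rewrite -subr_eq0; apply/eqP.
apply: (@cabs_small _ _ (5 * rnorm u + 2)) => e e0 e1.
have [t ut] := ksection_dense u e0.
have -> : rkhs_dot u u - (rnorm u ^+ 2)%:C%C = (rkhs_dot u u - feval u t)
   + feval (u - ksection t) t + (fnorm t ^+ 2 - rnorm u ^+ 2)%:C%C.
  by rewrite fevalB feval_ksection fformE rmorphB /=; ring.
have ft := rnorm_ksection_le u t.
have uf : rnorm u <= fnorm t + e.
  by rewrite -[u](subrK (ksection t)) (le_trans (rnormD _ _))// rnorm_ksection
    addrC lerD2l.
have u0 := rnorm_ge0 u; have f0 := fnorm_ge0 t.
rewrite (le_trans (cabsD _ _))//.
have h1 : cabs (rkhs_dot u u - feval u t + feval (u - ksection t) t) <=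
    2 * (rnorm u * e) + e * (rnorm u + 1).
  rewrite (le_trans (cabsD _ _))// lerD//.
    by rewrite (le_trans (rkhs_dotP _ _ t))// !ler_wpM2l ?rnorm_ge0.
  rewrite (le_trans (knormP _ _))// ler_pM ?knorm_ge0 ?fnorm_ge0//.
  by rewrite (le_trans ft)// lerD2l (le_trans ut).
have h2 : cabs (fnorm t ^+ 2 - rnorm u ^+ 2)%:C%C <= e * (2 * rnorm u + 1).
  have := cabs_le_ReIm (fnorm t ^+ 2 - rnorm u ^+ 2) 0.
  rewrite normr0 addr0 => /le_trans; apply.
  rewrite subr_sqr normrM ler_pM// ler_norml; apply/andP; split; lra.
apply: (le_trans (lerD h1 h2)); lra.
Qed.

Fact rkhs_dot_bilinear :
  bilinear_for *%R (Num.conj \; *%R : R[i] -> R[i] -> R[i]) rkhs_dot.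
Proof.
split=> [w a u v|u a v w]; first exact: rkhs_dotPl.
rewrite rkhs_dotC rkhs_dotPl rmorphD rmorphM /= -!rkhs_dotC.
by [].
Qed.

HB.instance Definition _ := @bilinear_isBilinear.Build R[i] rkhs rkhs R[i]
  *%R (Num.conj \; *%R) rkhs_dot rkhs_dot_bilinear.

Fact rkhs_dot_hermitian u v : rkhs_dot u v = (-1) ^+ false * Num.conj (rkhs_dot v u).
Proof. by rewrite expr0 mul1r rkhs_dotC. Qed.

HB.instance Definition _ := isHermitianSesquilinear.Build R[i] rkhs false
  (@Num.conj R[i]) rkhs_dot rkhs_dot_hermitian.

Fact rkhs_dot_gt0 u : u != 0 -> 0 < rkhs_dot u u.
Proof. by move=> u0; rewrite rkhs_dotE exprn_gt0// normr_gt0. Qed.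

HB.instance Definition _ := isDotProduct.Build R[i] rkhs rkhs_dot rkhs_dot_gt0.

HB.instance Definition _ := CompleteNormedModule_isHilbert.Build R rkhs rkhs_dotE.

Definition kpoint x : rkhs := ksection [:: (1, x)].

Lemma hdot_kpoint u x : hdot u (kpoint x) = u x.
Proof. by rewrite -[RHS]feval1 -rkhs_dot_section. Qed.

Lemma kpointE x y : kpoint x y = k x y.
Proof. exact: fsection1. Qed.

(** The condition under which the map [t] of points induces a bounded operator on kernel sections;
    [kernel_comp] below, composition with [t], is the adjoint of that operator. *)
Definition kernel_bounded_map (t : X -> X) := exists2 M : R, 0 <= M &
  forall s, fnorm [seq (p.1, t p.2) | p <- s] <= M * fnorm s.

Lemma kernel_comp_bounded (t : X -> X) u : kernel_bounded_map t ->
  (u : X -> R[i]^o) \o t \in kernel_bounded.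
Proof.
move=> [M M0 tM]; apply/asboolP; exists (knorm u * M) => [|s].
  by rewrite mulr_ge0 ?knorm_ge0.
have -> : feval (u \o t) s = feval u [seq (p.1, t p.2) | p <- s].
  by rewrite /feval big_map.
by rewrite (le_trans (knormP _ _))// -mulrA ler_wpM2l ?knorm_ge0.
Qed.

Definition kernel_comp_fun (t : X -> X) (tM : kernel_bounded_map t) (u : rkhs) : rkhs :=
  Rkhs (kernel_comp_bounded u tM).

Lemma kernel_comp_fun_bounded (t : X -> X) (tM : kernel_bounded_map t) :
  kernel_comp_fun tM \in bounded_linear.
Proof.
apply/bounded_linearP; split=> [a u v|]; first exact: rkhsP.
have [M M0 tM'] := tM; exists M => // u; rewrite !knormE.
apply: knorm_le => [|s]; first by rewrite mulr_ge0 ?knorm_ge0.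
have -> : feval (kernel_comp_fun tM u) s = feval u [seq (p.1, t p.2) | p <- s].
  by rewrite /feval big_map.
by rewrite (le_trans (knormP _ _))// mulrAC [leRHS]mulrC ler_wpM2l ?knorm_ge0.
Qed.

Definition kernel_comp (t : X -> X) (tM : kernel_bounded_map t) : bounded_op rkhs :=
  BoundedOp (kernel_comp_fun_bounded tM).

Lemma kernel_compE (t : X -> X) (tM : kernel_bounded_map t) u x : kernel_comp tM u
  x = u (t x).
Proof. by []. Qed.

Lemma kernel_isometry (t : X -> X) : (forall x y, k (t x) (t y) = k x y) ->
  kernel_bounded_map t.
Proof.
move=> tk; exists 1 => // s; rewrite mul1r /fnorm /fform /feval /fsection.
rewrite big_map; under eq_bigr do rewrite big_map.
by under eq_bigr do under eq_bigr do rewrite tk.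
Qed.

End Rkhs.

(** * Adjoints and compressions by isometries *)

Section Adjoints.
Context {R : realType} {H : hilbertType R}.
Implicit Types (f g : bounded_op H) (x y : H).

Lemma hdot_adjl f x y : hdot (bop_adj f x) y = hdot x (f y).
Proof. by rewrite bop_adjE bop_adjK. Qed.

Lemma hdotDr x y z : hdot x (y + z) = hdot x y + hdot x z :> R[i].
Proof. by rewrite hdotC hdotDl rmorphD /= -!hdotC. Qed.

Lemma hdotZr a x y : hdot x (a *: y) = Num.conj a * hdot x y.
Proof. by rewrite hdotC hdotZl rmorphM /= -hdotC. Qed.

Lemma hdot_sumr I (s : seq I) (F : I -> H) x :
  hdot x (\sum_(i <- s) F i) = \sum_(i <- s) hdot x (F i).
Proof. by elim/big_rec2: _ => [|i y z _ <-]; [rewrite linear0r|rewrite hdotDr]. Qed.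

Lemma hdot_suml I (s : seq I) (F : I -> H) x :
  hdot (\sum_(i <- s) F i) x = \sum_(i <- s) hdot (F i) x.
Proof. by elim/big_rec2: _ => [|i y z _ <-]; [rewrite linear0l|rewrite hdotDl]. Qed.

Lemma hdot_ge0 x : 0 <= hdot x x :> R[i].
Proof. by rewrite hdotE exprn_ge0. Qed.

End Adjoints.

Section Compression.
Context {R : realType} {B : cstarType R}.

Lemma mxstar_mulE n (y z : 'M[B]_n) i j :
  (mxstar y *m z) i j = \sum_l cstar (y l i) * z l j.
Proof. by rewrite mxE; apply: eq_bigr => l _; rewrite !mxE. Qed.

Lemma ucp_conj (Z : B) : cstar Z * Z = 1 -> ucp setT (fun b => cstar Z * b * Z).
Proof.
move=> ZZ; split.
- by move=> a x y _ _; rewrite mulrDr mulrDl -scaleAr -scaleAl.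
- by rewrite mulr1.
- move=> n _ _ [y ->]; exists (map_mx (fun b => b * Z) y).
  apply/matrixP => i j; rewrite mxE !mxstar_mulE mulr_sumr mulr_suml.
  by apply: eq_bigr => l _; rewrite !mxE cstarMr !mulrA.
Qed.
End Compression.

(** * Completely positive kernels and their dilations *)

Section CompletelyPositiveKernels.
Context {R : realType} {A : cstarType R} {J : Type}.
Implicit Types (Phi : A -> J -> J -> R[i]) (t : seq (A * J)).

Definition cp_sum Phi t : R[i] :=
  \sum_(p <- t) \sum_(q <- t) Phi (cstar q.1 * p.1) p.2 q.2.

Definition kernel_linear Phi :=
  forall a x y i j, Phi (a *: x + y) i j = a * Phi x i j + Phi y i j.

Definition cp_kernel Phi := kernel_linear Phi /\ forall t, 0 <= cp_sum Phi t.

(** The kernel is block diagonal along [f]: the block of the first index is split off the double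
    sum, by induction on the length of the family. *)
Lemma cp_kernel_block T (f : J -> T) Phi : kernel_linear Phi ->
  (forall x i j, f i <> f j -> Phi x i j = 0) ->
  (forall t v, 0 <= \sum_(p <- t | `[< f p.2 = v >])
     \sum_(q <- t | `[< f q.2 = v >]) Phi (cstar q.1 * p.1) p.2 q.2) ->
  cp_kernel Phi.
Proof.
move=> lin off diag; split => // t.
have [n] := ubnP (size t); elim: n t => // n IH [|p0 t0] tn.
  by rewrite /cp_sum big_nil.
set t := p0 :: t0 in tn *; pose e := fun p : A * J => `[< f p.2 = f p0.2 >].
have -> : cp_sum Phi t = \sum_(p <- t | e p) \sum_(q <- t | e q) Phi (cstar q.1 *
  p.1) p.2 q.2
   + cp_sum Phi [seq p <- t | ~~ e p].
  rewrite /cp_sum [in RHS]big_filter [LHS](bigID e); congr (_ + _).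
  - apply: eq_bigr => p /asboolP ep; rewrite [LHS](bigID e)/= [X in _ + X]big1 ?addr0//.
    by move=> q /asboolPn eq; apply: off => pq; apply: eq; rewrite -pq.
  - apply: eq_bigr => p /asboolPn ep; rewrite big_filter [LHS](bigID e)/= [X in X +
      _]big1 ?add0r//.
    by move=> q /asboolP eq; apply: off => pq; apply: ep; rewrite pq.
rewrite addr_ge0//; first exact: diag.
apply: IH; rewrite /t /= /e asboolT//=.
by rewrite size_filter (leq_ltn_trans (count_size _ _)).
Qed.

End CompletelyPositiveKernels.

Record cpkernel (R : realType) (A : cstarType R) (J : Type) := CPKernel {
  cpkernel_fun :> A -> J -> J -> R[i];
  cpkernelP : cp_kernel cpkernel_fun }.

(** * The Stinespring dilation of a completely positive kernel *)

Section Stinespring.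
Context {R : realType} {A : cstarType R} {J : Type} (Phi : cpkernel A J).
Implicit Types (x y : A * J) (a b : A).

(** The Gram kernel of the dilation: the point [(a, j)] stands for the elementary tensor of [a] and
    [j] in Stinespring's construction. *)
Definition stinespring_fun x y : R[i] := Phi (cstar y.1 * x.1) x.2 y.2.

Let PhiP c (x y : A) i j : Phi (c *: x + y) i j = c * Phi x i j + Phi y i j.
Proof. exact: (cpkernelP Phi).1. Qed.

Let Phi0 i j : Phi 0 i j = 0.
Proof.
have := PhiP 1 0 0 i j; rewrite scaler0 addr0 mul1r => /eqP.
by rewrite -[X in X == _]addr0 (inj_eq (addrI _)) eq_sym => /eqP.
Qed.

Let PhiD (x y : A) i j : Phi (x + y) i j = Phi x i j + Phi y i j.
Proof. by have := PhiP 1 x y i j; rewrite scale1r mul1r. Qed.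

Let PhiZ c (x : A) i j : Phi (c *: x) i j = c * Phi x i j.
Proof. by have := PhiP c x 0 i j; rewrite !addr0 Phi0 addr0. Qed.

Let PhiN (x : A) i j : Phi (- x) i j = - Phi x i j.
Proof. by rewrite -scaleN1r PhiZ mulN1r. Qed.

Definition absorb (s : seq (R[i] * (A * J))) : seq (A * J) :=
  [seq (p.1 *: p.2.1, p.2.2) | p <- s].

Lemma stinespring_form s :
  feval (fsection stinespring_fun s) s = cp_sum Phi (absorb s).
Proof.
rewrite /feval /fsection /cp_sum /absorb big_map.
under [RHS]eq_bigr do rewrite big_map.
under [LHS]eq_bigr do rewrite mulr_sumr.
rewrite exchange_big /=; apply: eq_bigr => p _; apply: eq_bigr => q _.
by rewrite /stinespring_fun cstarZ -scaleAl -scaleAr !PhiZ.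
Qed.

Lemma stinespring_positive : positive_kernel stinespring_fun.
Proof. by move=> s; rewrite stinespring_form; exact: (cpkernelP Phi).2. Qed.

Definition stinespring_kernel := PKernel stinespring_positive.

Definition stinespring_space := rkhs stinespring_kernel.

Definition lact a x : A * J := (a * x.1, x.2).

(** With [d] self-adjoint and [d^2 = |a|^2 - a^* a], the difference of the two squared seminorms is
    the nonnegative sum of the family multiplied by [d]. *)
Lemma lact_bounded a : kernel_bounded_map stinespring_kernel (lact a).
Proof.
exists (rnorm a); first exact: rnorm_ge0.
move=> s; rewrite -ler_sqr ?nnegrE ?mulr_ge0 ?rnorm_ge0 ?fnorm_ge0//.
rewrite exprMn -lecR [(rnorm a ^+ 2 * _)%:C%C]rmorphM /= -!fformE /fform
  !stinespring_form.
have hp : cpos ((rnorm a ^+ 2)%:C%C *: (1 : A) - cstar a * a).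
  by apply: cposB; rewrite ?cstarMr ?cstarK// rnorm_starM.
have [d [ds dd _ _]] := cpos_sqrt hp.
rewrite -subr_ge0.
have -> : (rnorm a ^+ 2)%:C%C * cp_sum Phi (absorb s) -
    cp_sum Phi (absorb [seq (p.1, lact a p.2) | p <- s]) =
    cp_sum Phi [seq lact d p | p <- absorb s].
  rewrite /cp_sum /absorb !big_map mulr_sumr -sumrB; apply: eq_bigr => p _.
  rewrite !big_map mulr_sumr -sumrB; apply: eq_bigr => q _ /=.
  rewrite !scaleAr !cstarMr ds; set P := p.1 *: p.2.1; set Q := q.1 *: q.2.1;
    clearbody P Q.
  have -> : cstar Q * d * (d * P) =
      (rnorm a ^+ 2)%:C%C *: (cstar Q * P) - cstar Q * cstar a * (a * P).
    by rewrite mulrA -[cstar Q * d * d]mulrA dd mulrBr mulrBl -scaleAr mulr1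
      -scaleAl !mulrA.
  by rewrite PhiD PhiN PhiZ.
exact: (cpkernelP Phi).2.
Qed.

(** [kernel_comp] is the adjoint of the action on kernel sections, hence the star; [kpoint_lact]
    recovers left multiplication by [a]. *)
Definition stinespring_rep a : bounded_op stinespring_space :=
  kernel_comp (lact_bounded (cstar a)).

Lemma stinespring_repE a (u : stinespring_space) b j :
  stinespring_rep a u (b, j) = u (cstar a * b, j).
Proof. by []. Qed.

Lemma kpoint_lact a x :
  stinespring_rep a (kpoint stinespring_kernel x) = kpoint stinespring_kernel (lact
    a x).
Proof.
apply: rkhsP => y; rewrite kernel_compE !kpointE /= /stinespring_fun /=.
by rewrite cstarMr cstarK mulrA.
Qed.

Lemma stinespring_antilinear (u : stinespring_space) c a b j :
  u (c *: a + b, j) = Num.conj c * u (a, j) + u (b, j).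
Proof.
rewrite -!hdot_kpoint.
have -> : kpoint stinespring_kernel (c *: a + b, j) =
    c *: kpoint stinespring_kernel (a, j) + kpoint stinespring_kernel (b, j).
  apply: rkhsP => y; rewrite kpointE.
  transitivity (c * kpoint stinespring_kernel (a, j) y + kpoint stinespring_kernel
    (b, j) y) => //.
  by rewrite !kpointE /= /stinespring_fun /= mulrDr -scaleAr PhiP.
by rewrite hdotDr hdotZr.
Qed.

Lemma stinespring_repP : representation stinespring_rep.
Proof.
split.
- move=> c a b; apply: bopP => u; apply: rkhsP => -[x j].
  rewrite stinespring_repE cstarD cstarZ mulrDl -scaleAl stinespring_antilinear conjCK.
  by [].
- by apply: bopP => u; apply: rkhsP => -[x j]; rewrite stinespring_repE cstar1 mul1r.
- move=> a b; apply: bopP => u; apply: rkhsP => -[x j].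
  transitivity (stinespring_rep a (stinespring_rep b u) (x, j)) => //.
  by rewrite !stinespring_repE cstarMr mulrA.
- move=> a; apply: bopP => u; apply: rkhsP => x.
  rewrite -[RHS]hdot_kpoint.
  transitivity (hdot (bop_adj (stinespring_rep a) u) (kpoint stinespring_kernel x))
    => //.
  rewrite hdot_adjl kpoint_lact hdot_kpoint.
  by case: x => x j; rewrite stinespring_repE cstarK.
Qed.

(** A difference [c] killed by the representation annihilates the section at [(1, j)], whose image
    takes the value [Phi (cstar c * c) j j] at [(c, j)]. *)
Lemma stinespring_faithful :
  (forall a, a != 0 -> exists j, Phi (cstar a * a) j j != 0) -> injective
    stinespring_rep.
Proof.
move=> Phi_faithful a b ab; apply/eqP; rewrite -subr_eq0; apply/negPn/negP =>
  /Phi_faithful[j].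
have [lin _ _ _] := stinespring_repP.
have r0 : stinespring_rep (a - b) = 0.
  by rewrite addrC -scaleN1r lin ab scaleN1r addNr.
have := kpoint_lact (a - b) (1, j); rewrite r0 => /(congr1 (fun u :
  stinespring_space => u (a - b, j))).
by rewrite kpointE /= /stinespring_fun /= mulr1 => <-; rewrite eqxx.
Qed.
End Stinespring.

(** * The direct sum of all GNS representations *)

Section StateKernel.
Context {R : realType} {A : cstarType R}.

(** All functions serve as indices, and those that are not positive functionals contribute zero. The
    integer gives countably many copies of each GNS space, from which [faithful_representation]
    obtains the isometries [V n]. *)
Definition state_fun (c : A) (i j : nat * (A -> R[i])) : R[i] :=
  if `[< i = j /\ positive_functional i.2 >] then i.2 c else 0.

Lemma state_cp : cp_kernel state_fun.
Proof.
apply: (@cp_kernel_block _ _ _ _ id).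
- move=> a x y i j; rewrite /state_fun.
  by case: asboolP => [[_ [fl _]]|_]; rewrite ?fl ?mulr0 ?addr0.
- by move=> x i j ij; rewrite /state_fun; case: asboolP => // -[].
- move=> t [n f].
  have [fP|fN] := asboolP (positive_functional f); last first.
    rewrite big1// => p /asboolP pE; rewrite big1// => q _.
    by rewrite /state_fun; case: asboolP => // -[]; rewrite pE.
  pose x := \sum_(p <- t | `[< p.2 = (n, f) >]) p.1.
  have f0 : f 0 = 0.
    have := fP.1 1 0 0; rewrite scaler0 addr0 mul1r => /eqP.
    by rewrite -[X in X == _]addr0 (inj_eq (addrI _)) eq_sym => /eqP.
  have fD a b : f (a + b) = f a + f b by have := fP.1 1 a b; rewrite scale1r mul1r.
  have fS (P : pred (A * (nat * (A -> R[i])))) F :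
     f (\sum_(p <- t | P p) F p) = \sum_(p <- t | P p) f (F p).
    by elim/big_rec2: _ => [|p a b _ <-] //.
  have xs : cstar x = \sum_(p <- t | `[< p.2 = (n, f) >]) cstar p.1.
    rewrite /x; elim/big_rec2: _ => [|p a b _ <-]; first exact: cstar0.
    exact: cstarD.
  have := fP.2 x; rewrite {}xs mulr_sumr fS; congr (0 <= _).
  apply: eq_bigr => p /asboolP pE.
  rewrite mulr_suml fS; apply: eq_bigr => q /asboolP qE.
  by rewrite /state_fun pE qE asboolT.
Qed.

Definition state_kernel := CPKernel state_cp.

Lemma state_kernel_faithful (a : A) : a != 0 ->
  exists i, state_kernel (cstar a * a) i i != 0.
Proof.
move=> /state_exists[f [fP fa]]; exists (0%N, f).
by rewrite /= /state_fun asboolT.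
Qed.
End StateKernel.

(** * Uniqueness of completely positive extensions *)

Section HyperrigidUniqueness.
Context {R : realType} {A : cstarType R} (H : hilbertType R).
Variables (sigma : A -> bounded_op H) (Psi : cpkernel A H).
Hypothesis sigmaP : representation sigma.

Inductive dilation_index :=
  | StateIndex of nat * (A -> R[i])
  | RepIndex of H
  | CopyIndex of nat & H.

Definition dilation_fun (c : A) (i j : dilation_index) : R[i] :=
  match i, j with
  | StateIndex f, StateIndex g => state_fun c f g
  | RepIndex p, RepIndex q => hdot (sigma c p) q
  | CopyIndex n p, CopyIndex m q => if n == m then Psi c p q else 0
  | _, _ => 0
  end.

Let block (i : dilation_index) : unit + option nat :=
  match i with
  | StateIndex _ => inl tt
  | RepIndex _ => inr None
  | CopyIndex n _ => inr (Some n)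
  end.

(** The default values of [vector] and [state] are harmless: both are applied only to indices
    already filtered by [block]. *)
Let vector (i : dilation_index) : H :=
  match i with StateIndex _ => 0 | RepIndex p => p | CopyIndex _ p => p end.

Let state (i : dilation_index) : nat * (A -> R[i]) :=
  if i is StateIndex f then f else (0%N, fun=> 0).

Lemma dilation_cp : cp_kernel dilation_fun.
Proof.
have [slin s1 sM sstar] := sigmaP.
apply: (@cp_kernel_block _ _ _ _ block).
- move=> a x y [f|p|n p] [g|q|m q] /=; rewrite ?mulr0 ?addr0//.
  + exact: (cpkernelP state_kernel).1.
  + by rewrite slin hdotDl hdotZl.
  + by case: ifP => _; rewrite ?(cpkernelP Psi).1 ?mulr0 ?addr0.
- move=> x [f|p|n p] [g|q|m q] //= ij.
  by case: eqP => // nm; case: ij; rewrite nm.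
- move=> t [[]|[n|]].
  + have := (cpkernelP state_kernel).2
      [seq (p.1, state p.2) | p <- t & `[< block p.2 = inl tt >]].
    rewrite /cp_sum big_map big_filter; congr (0 <= _).
    apply: eq_bigr => -[a i] /asboolP /= fi.
    rewrite big_map big_filter; apply: eq_bigr => -[b j] /asboolP /= fj.
    by case: i fi => //= g _; case: j fj.
  + have := (cpkernelP Psi).2
      [seq (p.1, vector p.2) | p <- t & `[< block p.2 = inr (Some n) >]].
    rewrite /cp_sum big_map big_filter; congr (0 <= _).
    apply: eq_bigr => -[a i] /asboolP /= fi.
    rewrite big_map big_filter; apply: eq_bigr => -[b j] /asboolP /= fj.
    case: i fi => //= _ p [->]; case: j fj => //= _ q [->].
    by rewrite eqxx.
  + pose x := \sum_(p <- t | `[< block p.2 = inr None >]) sigma p.1 (vector p.2).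
    suff -> : \sum_(p <- t | `[< block p.2 = inr None >])
       \sum_(q <- t | `[< block q.2 = inr None >]) dilation_fun (cstar q.1 * p.1)
         p.2 q.2
       = hdot x x by exact: hdot_ge0.
    rewrite {1}/x -big_filter -[in RHS]big_filter hdot_suml.
    rewrite !big_filter; apply: eq_bigr => -[a i] /asboolP /= fi.
    rewrite /x -big_filter -[in RHS]big_filter hdot_sumr.
    rewrite !big_filter; apply: eq_bigr => -[b j] /asboolP /= fj.
    case: i fi => //= p _; case: j fj => //= q _.
    rewrite sM sstar.
    transitivity (hdot (bop_adj (sigma b) (sigma a p)) q) => //.
    by rewrite hdot_adjl.
Qed.

Definition dilation_kernel := CPKernel dilation_cp.
Let K := stinespring_kernel dilation_kernel.
Let tau := stinespring_rep dilation_kernel.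

Lemma dilation_faithful : injective tau.
Proof.
apply: stinespring_faithful => a /state_kernel_faithful[i ai].
by exists (StateIndex i).
Qed.

(* The adjoint of the isometry [Z] fixing the state summands, sending the
   representation space into the zeroth copy of the Stinespring space of [Psi]
   and shifting the copies, so that [Z^* tau(a) Z] has [Psi] as a summand. *)
Definition dilation_shift (x : A * dilation_index) : A * dilation_index :=
  match x.2 with
  | StateIndex _ => x
  | RepIndex p => (1, CopyIndex 0 (sigma x.1 p))
  | CopyIndex n p => (x.1, CopyIndex n.+1 p)
  end.

Variable S : set A.
Hypothesis S1 : S 1.
Hypothesis SC : forall x, S x -> S (cstar x).
Hypothesis SPsi : forall s p q, S s -> Psi s p q = hdot (sigma s p) q.

Let sigma_starM a b p q : hdot (sigma (cstar b * a) p) q = hdot (sigma a p) (sigma b q).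
Proof.
have [_ _ sM sstar] := sigmaP; rewrite sM sstar.
transitivity (hdot (bop_adj (sigma b) (sigma a p)) q) => //.
by rewrite hdot_adjl.
Qed.

(** Between points of the representation summand the shifted kernel is given by [Psi 1], which is
    the inner product because [1] lies in [S]. *)
Lemma dilation_shift_isometry x y : K (dilation_shift x) (dilation_shift y) = K x y.
Proof.
have [_ s1 _ _] := sigmaP.
case: x y => [a [f|p|n p]] [b [g|q|m q]] //=.
by rewrite /stinespring_fun /= mulr1 cstar1 SPsi// sigma_starM s1.
Qed.

Let T := kernel_comp (kernel_isometry dilation_shift_isometry).
Let Z := bop_adj T.

Let TZ_point x : T (kpoint K (dilation_shift x)) = kpoint K x.
Proof.
by apply: rkhsP => y; rewrite kernel_compE !kpointE dilation_shift_isometry.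
Qed.

Let ZE u x : Z u x = hdot u (T (kpoint K x)).
Proof. by rewrite -hdot_kpoint hdot_adjl. Qed.

Let omega (b : bounded_op (stinespring_space dilation_kernel)) := bop_comp
  (bop_comp T b) Z.

Let omega_ucp : ucp setT omega.
Proof.
pose B : cstarType R := bounded_op (stinespring_space dilation_kernel).
have ZZ : cstar (Z : B) * (Z : B) = 1.
  apply: bopP => u; apply: rkhsP => x.
  transitivity (Z u (dilation_shift x)).
    by transitivity (bop_adj Z (Z u) x) => //; rewrite /Z bop_adjK.
  by rewrite ZE TZ_point hdot_kpoint.
have := ucp_conj ZZ; congr (ucp setT _); apply/funext => b.
by rewrite /omega -[in RHS](bop_adjK T).
Qed.

Let omega_tau a u x : omega (tau a) u x =
  hdot u (T (kpoint K (lact (cstar a) (dilation_shift x)))).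
Proof. by rewrite -ZE. Qed.

(** The shift commutes with left multiplication except on the representation summand, where the
    claim is the agreement of [Psi] with [sigma] at [cstar s]. *)
Let omega_tauS s : S s -> omega (tau s) = tau s.
Proof.
move=> Ss; apply: bopP => u; apply: rkhsP => x; rewrite omega_tau.
have -> : T (kpoint K (lact (cstar s) (dilation_shift x))) = kpoint K (lact (cstar
  s) x).
  have [_ _ sM _] := sigmaP.
  apply: rkhsP => y; rewrite kernel_compE !kpointE.
  case: x y => [a [f|p|n p]] [b [g|q|m q]] //=.
  rewrite /stinespring_fun /= mulr1 cstar1 mul1r SPsi; last exact: SC.
  by rewrite sigma_starM sM.
exact: hdot_kpoint.
Qed.

Lemma hyperrigid_cp_unique : hyperrigid S ->
  forall a p q, Psi a p q = hdot (sigma a p) q.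
Proof.
move=> hS a p q; have [_ s1 _ _] := sigmaP.
(* Along a constant sequence hyperrigidity forces the norm itself to vanish, so [omega] fixes
   [tau (cstar a)]. The star undoes the one in [omega_tau]. *)
have := hS _ tau (stinespring_repP _) dilation_faithful (fun=> omega) (fun=>
  omega_ucp) _ (cstar a).
have h0 s : S s -> rnorm (omega (tau s) - tau s) @[_ --> \oo] --> (0 : R).
  by move=> /omega_tauS ->; rewrite subrr rnorm0; exact: cvg_cst.
move=> /(_ h0) /cvg_lim; rewrite lim_cst// => /(_ (@norm_hausdorff _ _)).
move=> /rnorm_eq0 /eqP; rewrite subr_eq0 => /eqP ota.
(* The shift moves [(1, RepIndex p)] to the zeroth copy; evaluating this equality at
   [(1, RepIndex q)] compares [Psi a p q] with [hdot (sigma a p) q]. *)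
have TE : T (kpoint K (lact a (dilation_shift (1, RepIndex p)))) = kpoint K (a,
  RepIndex p).
  apply: hdotP => u; rewrite hdot_kpoint.
  have := omega_tau (cstar a) u (1, RepIndex p); rewrite cstarK => <-.
  by rewrite ota stinespring_repE cstarK mulr1.
have := congr1 (fun u : stinespring_space dilation_kernel => u (1, RepIndex q)) TE.
rewrite kernel_compE !kpointE /= /stinespring_fun /= cstar1 !mulr1 !mul1r s1.
by [].
Qed.
End HyperrigidUniqueness.

(** * Unital completely positive maps as kernels *)

Section HomomorphismsAreUcp.
Context {R : realType} {A B : cstarType R}.

Lemma unital_star_hom_ucp (S : set A) (pi : A -> B) : unital_star_hom pi -> ucp S pi.
Proof.
move=> [lin p1 pM pstar]; split; [by move=> a x y _ _; exact: lin|by []|].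
move=> n _ _ [y ->]; exists (map_mx pi y); apply/matrixP => i j.
rewrite mxE !mxstar_mulE.
have p0 : pi 0 = 0.
  have := lin 1 0 0; rewrite !scale1r addr0 => /eqP.
  by rewrite -[X in X == _]addr0 (inj_eq (addrI _)) eq_sym => /eqP.
have pD x y' : pi (x + y') = pi x + pi y' by have := lin 1 x y'; rewrite !scale1r.
rewrite (big_morph pi pD p0); apply: eq_bigr => l _.
by rewrite !mxE pM pstar.
Qed.
End HomomorphismsAreUcp.

Section UcpKernel.
Context {R : realType} {A : cstarType R} {H : hilbertType R}.
Variable phi : A -> bounded_op H.
Hypothesis phiP : ucp setT phi.

(** The matrix with entries [cstar a_i * a_j] is positive; writing its image as [z^* z] turns the
    double sum into [sum_l |sum_j z_lj p_j|^2]. *)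
Lemma ucp_cp_kernel : cp_kernel (fun a p q => hdot (phi a p) q).
Proof.
have [lin _ pos] := phiP; split.
  by move=> c x y p q; rewrite lin// hdotDl hdotZl.
case=> [|x0 t0]; first by rewrite /cp_sum big_nil.
set t := x0 :: t0; pose n := size t0.
(* The row of the [a_j], padded with zero rows to a square matrix. *)
pose y : 'M[A]_n.+1 := \matrix_(i, j) (if i == 0 then (nth x0 t j).1 else 0).
have [z zE] := pos _ (mxstar y *m y) (fun _ _ => I) (ex_intro _ y erefl).
have phiE (i j : 'I_n.+1) p q :
    hdot (phi (cstar (nth x0 t i).1 * (nth x0 t j).1) p) q = \sum_l hdot (z l j p)
      (z l i q).
  have yE : \sum_l cstar (y l i) * y l j = cstar (nth x0 t i).1 * (nth x0 t j).1.
    rewrite big_ord_recl big1 => [|l _]; first by rewrite !mxE addr0.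
    by rewrite !mxE /= mulr0.
  have := congr1 (fun m : 'M[bounded_op H]_(n.+1) => m i j) zE; rewrite mxE
    !mxstar_mulE yE => ->.
  rewrite (big_morph (fun f : bounded_op H => hdot (f p) q) (id1 := 0) (op1 := +%R)).
  - apply: eq_bigr => l _.
    transitivity (hdot (bop_adj (z l i) (z l j p)) q) => //.
    by rewrite hdot_adjl.
  - by move=> f g; rewrite bopD hdotDl.
  - by rewrite bop0 linear0l.
have -> : cp_sum (fun a p q => hdot (phi a p) q) t =
    \sum_l hdot (\sum_j z l j (nth x0 t j).2) (\sum_i z l i (nth x0 t i).2).
  rewrite /cp_sum (big_nth x0) big_mkord.
  under eq_bigr do rewrite (big_nth x0) big_mkord.
  under [RHS]eq_bigr do rewrite hdot_suml.
  rewrite [RHS]exchange_big; apply: eq_bigr => j _.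
  under [RHS]eq_bigr do rewrite hdot_sumr.
  rewrite [RHS]exchange_big; apply: eq_bigr => i _.
  exact: phiE.
by apply: sumr_ge0 => l _; exact: hdot_ge0.
Qed.
End UcpKernel.

(** The kernel of any UCP extension of the restriction of [pi] satisfies the hypotheses of
    [hyperrigid_cp_unique] with [sigma := pi], so [pi] is the only extension. *)
Lemma boundary_representation_hyperrigid (R : realType) (A : cstarType R) (S : set A)
    (H : hilbertType R) (pi : A -> bounded_op H) :
  operator_system S -> hyperrigid S -> representation pi -> irreducible_rep pi ->
  boundary_representation S pi.
Proof.
move=> [_ SC S1] hS piP irr; split => //; split; first exact: unital_star_hom_ucp.
have [_ _ piM _] := piP.
exists pi; split => //; first exact: unital_star_hom_ucp.
move=> phi phiP phiS; apply/funext => a; apply: bopP => p; apply: hdotP => q.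
rewrite [LHS]hdotC [RHS]hdotC; congr (Num.conj _).
apply: (@hyperrigid_cp_unique _ _ _ _ (CPKernel (ucp_cp_kernel phiP)) piP S) => //.
by move=> s p' q' Ss /=; rewrite phiS.
Qed.

(** * The boundary ideal *)

Section StateRepresentation.
Context {R : realType} (A : cstarType R).

Let K := stinespring_kernel (@state_kernel R A).

(** Renumbers the copies of the GNS spaces by an injective pairing, so that different [n] give
    isometries with orthogonal ranges. *)
Definition state_shift (n : nat) (x : A * (nat * (A -> R[i]))) : A * (nat * (A ->
  R[i])) :=
  (x.1, (pickle (n, x.2.1), x.2.2)).

Lemma state_shiftE n m x y :
  K (state_shift n x) (state_shift m y) = if n == m then K x y else 0.
Proof.
case: x y => [a [i f]] [b [j g]] /=; rewrite /stinespring_fun /state_fun /=.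
have [->|nm] := eqVneq n m; last first.
  case: asboolP => // -[[/(congr1 (@unpickle (nat * nat)%type))]].
  by rewrite !pickleK => -[/eqP]; rewrite (negPf nm).
case: asboolP => [[[/(congr1 (@unpickle (nat * nat)%type))]]|h1].
  by rewrite !pickleK => -[-> ->] fP; rewrite asboolT.
case: asboolP => // -[[ij fg] fP]; case: h1; split => //.
by rewrite ij fg.
Qed.

Lemma state_shift_bounded n : kernel_bounded_map K (state_shift n).
Proof. by apply: kernel_isometry => x y; rewrite state_shiftE eqxx. Qed.

Lemma faithful_representation : exists (H : hilbertType R) (sigma : A -> bounded_op H)
  (V : nat -> bounded_op H), [/\ representation sigma, injective sigma &
    forall n m, bop_comp (bop_adj (V n)) (V m) = if n == m then bop_id H else 0].
Proof.
exists (stinespring_space (@state_kernel R A)), (stinespring_rep state_kernel).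
exists (fun n => bop_adj (kernel_comp (state_shift_bounded n))); split.
- exact: stinespring_repP.
- exact/stinespring_faithful/state_kernel_faithful.
- move=> n m; rewrite bop_adjK; apply: bopP => u; apply: rkhsP => x.
  transitivity (hdot u (kernel_comp (state_shift_bounded m) (kpoint K (state_shift
    n x)))).
    by rewrite -hdot_adjl hdot_kpoint.
  have -> : kernel_comp (state_shift_bounded m) (kpoint K (state_shift n x)) =
     if n == m then kpoint K x else 0.
    apply: rkhsP => y; rewrite kernel_compE kpointE state_shiftE.
    by case: eqP => // _; rewrite kpointE.
  by case: eqP => _; [exact: hdot_kpoint|rewrite linear0r].
Qed.
End StateRepresentation.

(** * C*-norms on matrices through orthogonal isometries *)

Section MatrixNorm.
Context {R : realType} {A B : cstarType R}.
Variables (sigma : A -> B) (V : nat -> B).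
Hypothesis sigmaP : unital_star_hom sigma.
Hypothesis VV : forall n m, cstar (V n) * V m = if n == m then 1 else 0.

Let sigma0 : sigma 0 = 0.
Proof.
have [lin _ _ _] := sigmaP; have := lin 1 0 0; rewrite !scale1r addr0 => /eqP.
by rewrite -[X in X == _]addr0 (inj_eq (addrI _)) eq_sym => /eqP.
Qed.

Let sigmaD x y : sigma (x + y) = sigma x + sigma y.
Proof. by have [/(_ 1 x y) + _ _ _] := sigmaP; rewrite !scale1r. Qed.

Let sigmaZ a x : sigma (a *: x) = a *: sigma x.
Proof. by have [/(_ a x 0) + _ _ _] := sigmaP; rewrite !addr0 sigma0 addr0. Qed.

Let sigma_sum I (s : seq I) (F : I -> A) :
  sigma (\sum_(i <- s) F i) = \sum_(i <- s) sigma (F i).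
Proof. exact: (big_morph sigma sigmaD sigma0). Qed.

(* Matrices over [A] embedded (non-unitally) into [B] by means of isometries
   [V i] with orthogonal ranges. *)
Definition mx_embed n (x : 'M[A]_n) : B :=
  \sum_(i < n) \sum_(j < n) V i * sigma (x i j) * cstar (V j).

Lemma mx_embedD n (x y : 'M[A]_n) : mx_embed (x + y) = mx_embed x + mx_embed y.
Proof.
rewrite /mx_embed -big_split; apply: eq_bigr => i _; rewrite -big_split.
by apply: eq_bigr => j _; rewrite !mxE sigmaD mulrDr mulrDl.
Qed.

Lemma mx_embed0 n : mx_embed (0 : 'M[A]_n) = 0.
Proof.
rewrite /mx_embed big1// => i _; rewrite big1// => j _.
by rewrite mxE sigma0 mulr0 mul0r.
Qed.

Lemma mx_embedN n (x : 'M[A]_n) : mx_embed (- x) = - mx_embed x.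
Proof. by apply: (addrI (mx_embed x)); rewrite -mx_embedD !subrr mx_embed0. Qed.

Lemma mx_embedZ n (a : R[i]) (x : 'M[A]_n) :
  mx_embed (map_mx ( *:%R a) x) = a *: mx_embed x.
Proof.
rewrite /mx_embed scaler_sumr; apply: eq_bigr => i _; rewrite scaler_sumr.
by apply: eq_bigr => j _; rewrite !mxE sigmaZ -scaleAr -scaleAl.
Qed.

Lemma mx_embedM n (x y : 'M[A]_n) : mx_embed (x *m y) = mx_embed x * mx_embed y.
Proof.
have [_ _ sM _] := sigmaP.
rewrite /mx_embed mulr_suml; apply: eq_bigr => i _.
under [LHS]eq_bigr do rewrite mxE sigma_sum mulr_sumr mulr_suml.
rewrite exchange_big mulr_suml; apply: eq_bigr => l _.
rewrite mulr_sumr [RHS](bigD1 l)//= [X in _ + X]big1 ?addr0 => [|k kl].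
  rewrite mulr_sumr; apply: eq_bigr => j _.
  by rewrite sM !mulrA -[_ * cstar (V l) * V l]mulrA VV eqxx mulr1.
rewrite mulr_sumr big1// => j _.
rewrite !mulrA -[_ * cstar (V l) * V k]mulrA VV.
have -> : (l == k :> nat) = false by rewrite eq_sym; apply/negbTE.
by rewrite mulr0 !mul0r.
Qed.

Lemma mx_embed_star n (x : 'M[A]_n) : mx_embed (mxstar x) = cstar (mx_embed x).
Proof.
have [_ _ _ sS] := sigmaP.
have cs I (s : seq I) (F : I -> B) : cstar (\sum_(i <- s) F i) = \sum_(i <- s)
  cstar (F i).
  exact: (big_morph cstar (@cstarD _ B) (cstar0 (A := B))).
rewrite /mx_embed cs exchange_big; apply: eq_bigr => i _; rewrite cs.
by apply: eq_bigr => j _; rewrite !mxE sS !cstarMr cstarK mulrA.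
Qed.

(** Recovering the entries by compression shows that the embedding is injective as soon as [sigma]
    is. *)
Lemma mx_embedE n (x : 'M[A]_n) (i j : 'I_n) :
  cstar (V i) * mx_embed x * V j = sigma (x i j).
Proof.
have nE (k l : 'I_n) : k != l -> (k == l :> nat) = false by move=> kl; apply/negbTE.
rewrite /mx_embed mulr_sumr mulr_suml (bigD1 i)//= [X in _ + X]big1 ?addr0; last first.
  move=> k ki; rewrite mulr_sumr mulr_suml big1// => l _.
  by rewrite !mulrA VV nE ?[i == k]eq_sym// !mul0r.
rewrite mulr_sumr mulr_suml (bigD1 j)//= [X in _ + X]big1 ?addr0; last first.
  by move=> l lj; rewrite -!mulrA VV nE// !mulr0.
by rewrite !mulrA VV eqxx mul1r -mulrA VV eqxx mulr1.
Qed.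

(** The C*-norm pulled back from [B], to which [quotient_completely_isometric] will be applied. *)
Definition mx_norm_of n (x : 'M[A]_n) : R := rnorm (mx_embed x).

Lemma mx_norm_ofP n : injective sigma -> is_mx_cstar_norm (@mx_norm_of n).
Proof.
move=> sinj; split.
- move=> x /rnorm_eq0 x0; apply/matrixP => i j; rewrite mxE.
  by apply: sinj; rewrite -mx_embedE x0 mulr0 mul0r sigma0.
- by move=> x y; rewrite /mx_norm_of mx_embedD rnormD.
- by move=> a x; rewrite /mx_norm_of mx_embedZ rnormZ.
- by move=> x y; rewrite /mx_norm_of mx_embedM rnormM.
- by move=> x; rewrite /mx_norm_of mx_embedM mx_embed_star rnorm_starM.
Qed.

(** A projection, in general different from [1]. *)
Let e n : B := mx_embed (1%:M : 'M[A]_n).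

Let ee n : e n * e n = e n.
Proof. by rewrite -mx_embedM mulmx1. Qed.

Let mxstar1 n : mxstar (1%:M : 'M[A]_n) = 1%:M.
Proof.
apply/matrixP => i j; rewrite !mxE eq_sym.
by case: eqP => _; rewrite ?cstar1 ?cstar0.
Qed.

Let es n : cstar (e n) = e n.
Proof. by rewrite -mx_embed_star mxstar1. Qed.

Let rnorm_e n : rnorm (e n) <= 1.
Proof.
have := rnorm_sqr (es n); rewrite ee => h.
have [->|x0] := eqVneq (rnorm (e n)) 0; first by [].
have xp : 0 < rnorm (e n) by rewrite lt_def x0 rnorm_ge0.
by rewrite -(ler_pM2l xp) mulr1 -expr2 -h.
Qed.

Lemma mx_embed_gram n (y : 'I_n -> A) :
  mx_embed (\matrix_(i, j) (cstar (y i) * y j)) =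
  cstar (\sum_(j < n) sigma (y j) * cstar (V j)) * \sum_(j < n) sigma (y j) * cstar
    (V j).
Proof.
have [_ _ sM sS] := sigmaP.
rewrite (big_morph cstar (@cstarD _ B) (cstar0 (A := B))) mulr_suml.
apply: eq_bigr => i _; rewrite mulr_sumr; apply: eq_bigr => j _.
by rewrite mxE sM sS cstarMr cstarK !mulrA.
Qed.

(* Positivity of [x] is detected by the norm of [t - x] for a single large [t],
   and on matrices over [S] that norm is the quotient norm. *)
Lemma quotient_order n (S K : set A) (Y : seq ('I_n -> A)) (x k : 'M[A]_n) :
  injective sigma -> operator_system S -> linear_subspace K ->
  quotient_completely_isometric S K -> mx_over S x -> mx_over K k ->
  x = \sum_(y <- Y) (\matrix_(i, j) (cstar (y i) * y j)) + k ->
  exists2 t : R, 0 <= t & rnorm (t%:C%C *: e n - mx_embed x) <= t.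
Proof.
move=> sinj [[S0 SP] _ S1] [K0 KP] qS Sx Kk xE.
have hp : cpos (mx_embed (x - k)).
  rewrite xE addrK; elim/big_ind: _ => [|a b ha hb|y _].
  - by rewrite mx_embed0; exact: cpos0.
  - by rewrite mx_embedD; exact: cposD.
  - by rewrite mx_embed_gram; exact: cpos_starM.
have [hs [t t0 ht]] := hp; exists t => //.
pose tx : 'M[A]_n := map_mx ( *:%R t%:C%C) (1%:M : 'M[A]_n) - x.
have txE : mx_embed tx = t%:C%C *: e n - mx_embed x.
  by rewrite mx_embedD mx_embedZ mx_embedN.
have Stx : mx_over S tx.
  move=> i j; rewrite !mxE addrC -scaleN1r; apply: (SP) => //.
  rewrite -[_ *: _]addr0; apply: SP => //.
  by case: (i == j); rewrite ?mulr1n ?mulr0n.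
rewrite -txE -/(mx_norm_of tx) -(qS n _ (@mx_norm_ofP n sinj) _ Stx).
have KNk : mx_over K k by [].
apply: (@le_trans _ _ (mx_norm_of (tx + k))).
  apply: ge_inf; last by exists k.
  by exists 0 => _ [l _ <-]; exact: rnorm_ge0.
(* The image of [tx + k] lies in the corner cut out by the projection [e n]; it is the compression
   of [t - (x - k)], whose norm is at most [t]. *)
have -> : mx_norm_of (tx + k) = rnorm (e n * (t%:C%C *: (1 : B) - mx_embed (x - k))
  * e n).
  have ehe : e n * mx_embed (x - k) * e n = mx_embed (x - k).
    by rewrite -!mx_embedM mul1mx mulmx1.
  rewrite /mx_norm_of mx_embedD txE mulrBr mulrBl -scaleAr mulr1 -scaleAl ee ehe.
  by rewrite mx_embedD mx_embedN opprD opprK addrA.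
rewrite (le_trans (rnormM _ _))// (le_trans (ler_piMr (rnorm_ge0 _) (rnorm_e n)))//.
rewrite (le_trans (rnormM _ _))// (le_trans _ ht)//.
by rewrite ler_piMl// rnorm_ge0.
Qed.
End MatrixNorm.

(** * Finitely supported families *)

Section FiniteSupport.
Context {R : realType} (T : choiceType) (V : lmodType R[i]).

Definition finite_support : {pred T -> V} := fun f =>
  `[< exists s : seq T, forall z, z \notin s -> f z = 0 >].

Record finsupp := Finsupp {
  finsupp_fun :> T -> V;
  finsuppP : finsupp_fun \in finite_support }.

HB.instance Definition _ := [isSub for finsupp_fun].
HB.instance Definition _ := [Choice of finsupp by <:].

Fact finite_support_submod : subsemimod_closed finite_support.
Proof.
split; first split.
- by apply/asboolP; exists [::].
- move=> f g /asboolP[s fs] /asboolP[t gt]; apply/asboolP; exists (s ++ t) => z.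
  by rewrite mem_cat negb_or => /andP[zs zt]; rewrite fctE fs// gt// addr0.
- move=> a f /asboolP[s fs]; apply/asboolP; exists s => z zs.
  by rewrite fctE fs// scaler0.
Qed.
HB.instance Definition _ := GRing.SubChoice_isSubLmodule.Build
  R[i] (T -> V) finite_support finsupp finite_support_submod.

Implicit Types f g : finsupp.

Lemma finsupp_ext f g : (forall z, f z = g z) -> f = g.
Proof. by move=> fg; apply/val_inj/funext. Qed.

Lemma finsuppD f g z : (f + g) z = f z + g z. Proof. by []. Qed.
Lemma finsuppZ a f z : (a *: f) z = a *: f z. Proof. by []. Qed.
Lemma finsuppN f z : (- f) z = - f z. Proof. by []. Qed.
Lemma finsupp0 z : (0 : finsupp) z = 0. Proof. by []. Qed.

Lemma finsupp_sum I (s : seq I) (F : I -> finsupp) z :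
  (\sum_(i <- s) F i) z = \sum_(i <- s) F i z.
Proof. exact: (big_morph (fun f : finsupp => f z) (fun f g => finsuppD f g z)
  (finsupp0 z)). Qed.

(** A chosen list covering the support, possibly larger than it; [pairingE] makes the sum over it
    independent of this choice. *)
Definition supp f : seq T := undup (sval (cid (asboolW (finsuppP f)))).

Lemma supp_uniq f : uniq (supp f). Proof. exact: undup_uniq. Qed.

Lemma suppP f z : z \notin supp f -> f z = 0.
Proof. by rewrite mem_undup; exact: (svalP (cid (asboolW (finsuppP f)))). Qed.

Definition delta_fun (z0 : T) (a : V) : T -> V := fun z => if z == z0 then a else 0.

Fact delta_finite z0 a : delta_fun z0 a \in finite_support.
Proof.
apply/asboolP; exists [:: z0] => z; rewrite inE /delta_fun.
by move=> /negbTE ->.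
Qed.
Definition delta z0 a := Finsupp (delta_finite z0 a).

Lemma deltaE z0 a z : delta z0 a z = if z == z0 then a else 0. Proof. by []. Qed.

Lemma deltaP z0 c a b : delta z0 (c *: a + b) = c *: delta z0 a + delta z0 b.
Proof.
apply: finsupp_ext => z; rewrite finsuppD finsuppZ !deltaE.
by case: eqP => // _; rewrite scaler0 addr0.
Qed.

Lemma finsupp_ind (P : finsupp -> Prop) : P 0 ->
  (forall f g, P f -> P g -> P (f + g)) -> (forall z a, P (delta z a)) ->
  forall f, P f.
Proof.
move=> P0 PD Pd f.
have [s fs] : exists s : seq T, forall z, z \notin s -> f z = 0.
  by exists (supp f); exact: suppP.
elim: s f fs => [|z0 s IH] g gs.
  have -> : g = 0 by apply: finsupp_ext => z; rewrite gs.
  exact: P0.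
rewrite -[g](subrK (delta z0 (g z0))); apply: PD => //; apply: IH => z zs.
rewrite finsuppD finsuppN deltaE; case: eqP => [->|/eqP zz0]; first exact: subrr.
by rewrite gs ?subr0// inE negb_or zz0.
Qed.
End FiniteSupport.

(** * Positivity modulo an ideal *)

Section QuotientForms.
Context {R : realType} {A : cstarType R} {H : hilbertType R}.
Variables (sigma : A -> bounded_op H) (V : nat -> bounded_op H).
Hypothesis sigmaP : representation sigma.
Hypothesis sigma_inj : injective sigma.
Hypothesis VV : forall n m,
  bop_comp (bop_adj (V n)) (V m) = if n == m then bop_id H else 0.
Variables S L : set A.
Hypothesis Ssys : operator_system S.
Hypothesis Lideal : closed_ideal L.
Hypothesis SL : quotient_completely_isometric S L.

(** Tests [quotient_order] on [zeta = sum_i V_i p_i]: there the embedded [x] has the value in the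
    statement and the embedded unit matrix has the value [|zeta|^2]. By Cauchy-Schwarz, [t |zeta|^2
    - Re <X zeta, zeta> <= t |zeta|^2]. *)
Lemma quotient_order_form n (Y : seq ('I_n -> A)) (x k : 'M[A]_n) (p : 'I_n -> H) :
  mx_over S x -> mx_over L k ->
  x = \sum_(y <- Y) (\matrix_(i, j) (cstar (y i) * y j)) + k ->
  0 <= complex.Re (\sum_j \sum_i hdot (sigma (x i j) (p j)) (p i)).
Proof.
have [L0 _ _ _] := Lideal => Sx Lk xE.
pose B : cstarType R := bounded_op H.
have VVB : forall n m, cstar (V n : B) * (V m : B) = if n == m then 1 else 0 by
  exact: VV.
have [t t0 ht] := quotient_order (B := B) (V := V) sigmaP VVB sigma_inj Ssys L0 SL
  Sx Lk xE.
pose zeta := \sum_(i < n) V i (p i).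
have Vz (j : 'I_n) : bop_adj (V j) zeta = p j.
  rewrite linear_sum (bigD1 j)//= big1 ?addr0 => [|i ij].
    by have := congr1 (fun f : bounded_op H => f (p j)) (VV j j); rewrite eqxx.
  have := congr1 (fun f : bounded_op H => f (p i)) (VV j i).
  by have -> : (j == i :> nat) = false by rewrite eq_sym; apply/negbTE.
have embE y : hdot ((mx_embed (B := B) sigma V y : bounded_op H) zeta) zeta =
    \sum_j \sum_i hdot (sigma (y i j) (p j)) (p i).
  have opsum I (r : seq I) (F : I -> bounded_op H) u : (\sum_(i <- r) F i) u =
    \sum_(i <- r) F i u.
    exact: (big_morph (fun f : bounded_op H => f u) (fun f g => bopD f g u) (bop0 u)).
  rewrite /mx_embed (opsum _ _ (fun i => _)) hdot_suml [RHS]exchange_big; apply: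
    eq_bigr => i _.
  rewrite (opsum _ _ (fun i => _)) hdot_suml; apply: eq_bigr => j _.
  transitivity (hdot (V i (sigma (y i j) (bop_adj (V j) zeta))) zeta) => //.
  by rewrite bop_adjE !Vz.
have zz : hdot zeta zeta = \sum_i hdot (p i) (p i).
  by rewrite {1}/zeta hdot_suml; apply: eq_bigr => i _; rewrite bop_adjE Vz.
have ez : hdot ((mx_embed (B := B) sigma V (1%:M : 'M[A]_n) : bounded_op H) zeta)
  zeta = hdot zeta zeta.
  have [slin s1 _ _] := sigmaP.
  have s0 : sigma 0 = 0.
    have := slin 1 0 0; rewrite !scale1r addr0 => /eqP.
    by rewrite -[X in X == _]addr0 (inj_eq (addrI _)) eq_sym => /eqP.
  rewrite embE zz; apply: eq_bigr => j _; rewrite (bigD1 j)//= big1 ?addr0 => [|i ij].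
    by rewrite mxE eqxx mulr1n s1.
  by rewrite mxE (negbTE ij) mulr0n s0 bop0 linear0l.
rewrite -embE.
set X := mx_embed _ _ x in ht *; set e := mx_embed _ _ _ in ht ez.
have : complex.Re (hdot ((t%:C%C *: e - X : bounded_op H) zeta) zeta) <= t * rnorm
  zeta ^+ 2.
  rewrite (le_trans (hdot_CS _ _))// expr2 mulrA ler_wpM2r ?rnorm_ge0//.
  by rewrite (le_trans (opnormP _ _))// ler_wpM2r ?rnorm_ge0.
rewrite hdotDl hdotNl [hdot ((_ *: e : bounded_op H) _) _]hdotZl ez hdot_rnorm -rmorphM.
by case: (hdot _ _) => a b /=; lra.
Qed.
End QuotientForms.

(** * Extension of the form to a completely positive kernel *)

Section CompletelyPositiveExtension.
Context {R : realType} {A : cstarType R} {H : hilbertType R}.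
Variables (sigma : A -> bounded_op H) (V : nat -> bounded_op H).
Hypothesis sigmaP : representation sigma.
Hypothesis sigma_inj : injective sigma.
Hypothesis VV : forall n m,
  bop_comp (bop_adj (V n)) (V m) = if n == m then bop_id H else 0.
Variables S L : set A.
Hypothesis Ssys : operator_system S.
Hypothesis Lideal : closed_ideal L.
Hypothesis SL : quotient_completely_isometric S L.

Local Notation E := (finsupp (H * H)%type A).

Let sigma0 : sigma 0 = 0.
Proof.
have [slin _ _ _] := sigmaP; have := slin 1 0 0; rewrite !scale1r addr0 => /eqP.
by rewrite -[X in X == _]addr0 (inj_eq (addrI _)) eq_sym => /eqP.
Qed.

Let sigmaD a b p : sigma (a + b) p = sigma a p + sigma b p.
Proof. by have [/(_ 1 a b) + _ _ _] := sigmaP; rewrite !scale1r => ->. Qed.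

Definition pairing (m : E) : R[i] :=
  \sum_(z <- supp m) hdot (sigma (m z) z.1) z.2.

Lemma pairingE (m : E) s : uniq s -> (forall z, z \notin s -> m z = 0) ->
  pairing m = \sum_(z <- s) hdot (sigma (m z) z.1) z.2.
Proof.
move=> su ms.
have red r : \sum_(z <- r) hdot (sigma (m z) z.1) z.2 =
    \sum_(z <- [seq z <- r | m z != 0]) hdot (sigma (m z) z.1) z.2.
  rewrite big_filter [LHS](bigID (fun z => m z != 0))/= [X in _ + X]big1 ?addr0//.
  by move=> z /negPn/eqP ->; rewrite sigma0 bop0 linear0l.
rewrite /pairing red [RHS]red; apply: perm_big; apply: uniq_perm.
- exact: filter_uniq (supp_uniq m).
- exact: filter_uniq.
- move=> z; rewrite !mem_filter; have [//|mz] := eqVneq (m z) 0 => /=.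
  have -> : z \in supp m by apply: contraT => /suppP /eqP; rewrite (negPf mz).
  by apply/esym; apply: contraT => /ms /eqP; rewrite (negPf mz).
Qed.

Lemma pairingP a x y : pairing (a *: x + y) = a * pairing x + pairing y.
Proof.
have [slin _ _ _] := sigmaP.
pose s := undup (supp x ++ supp y).
have sx z : z \notin s -> x z = 0 /\ y z = 0.
  by rewrite mem_undup mem_cat negb_or => /andP[/suppP ? /suppP ?].
have su : uniq s by exact: undup_uniq.
have hx z : z \notin s -> x z = 0 by move=> /sx[].
have hy z : z \notin s -> y z = 0 by move=> /sx[].
have hxy z : z \notin s -> (a *: x + y) z = 0.
  by move=> zs; rewrite finsuppD finsuppZ hx// hy// scaler0 addr0.
rewrite (pairingE su hx) (pairingE su hy) (pairingE su hxy).
rewrite mulr_sumr -big_split; apply: eq_bigr => z _ /=.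
by rewrite slin hdotDl hdotZl.
Qed.

Lemma pairing_delta z a : pairing (delta z a) = hdot (sigma a z.1) z.2.
Proof.
rewrite (@pairingE _ [:: z])//; first by rewrite big_seq1 deltaE eqxx.
by move=> z'; rewrite inE deltaE => /negbTE ->.
Qed.

(** The points cover both coordinates of the support, which makes [m] a square matrix. *)
Lemma pairing_points (m : E) : exists (n : nat) (p : 'I_n -> H),
  pairing m = \sum_j \sum_i hdot (sigma (m (p j, p i)) (p j)) (p i).
Proof.
pose P := undup ([seq z.1 | z <- supp m] ++ [seq z.2 | z <- supp m]).
exists (size P), (fun i => nth 0 P i).
rewrite (@pairingE _ [seq (p, q) | p <- P, q <- P]).
- rewrite big_allpairs_dep (big_nth 0) big_mkord; apply: eq_bigr => j _.
  by rewrite (big_nth 0) big_mkord.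
- by apply: allpairs_uniq; rewrite ?undup_uniq// => -[? ?] [? ?].
- move=> [p q] pq; apply: suppP; apply: contra pq => pq.
  by apply/allpairsP; exists (p, q); rewrite !mem_undup !mem_cat;
    split=> //; apply/orP; [left|right]; apply/mapP; exists (p, q).
Qed.

Definition gram_fun (Y : finsupp H A) (z : H * H) : A := cstar (Y z.2) * Y z.1.

Fact gram_finite Y : gram_fun Y \in @finite_support R (H * H)%type A.
Proof.
apply/asboolP; exists [seq (p, q) | p <- supp Y, q <- supp Y] => -[p q] pq.
rewrite /gram_fun /=; have [ps|/suppP ->] := boolP (p \in supp Y); last by rewrite
  mulr0.
have [qs|/suppP ->] := boolP (q \in supp Y); last by rewrite cstar0 mul0r.
by case/negP: pq; apply/allpairsP; exists (p, q).
Qed.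
Definition gram Y : E := Finsupp (gram_finite Y).

Lemma gramE Y z : gram Y z = cstar (Y z.2) * Y z.1. Proof. by []. Qed.

Definition antihermitian (m : E) := forall z, m (z.2, z.1) = - cstar (m z).

(* Closed ideals are self-adjoint, but this is not needed: [x^* x] belongs to
   the core for every [x] in [L]. *)
Definition ideal_core : set A := [set x | L x /\ L (cstar x)].

Let Lsub : linear_subspace L. Proof. by case: Lideal. Qed.

Let L0 : L 0. Proof. exact: Lsub.1. Qed.

Let LP (a : R[i]) x y : L x -> L y -> L (a *: x + y). Proof. exact: Lsub.2. Qed.

Let LD x y : L x -> L y -> L (x + y).
Proof. by move=> Lx Ly; rewrite -[x]scale1r; exact: LP. Qed.

Let LZ (a : R[i]) x : L x -> L (a *: x).
Proof. by move=> Lx; rewrite -[_ *: _]addr0; exact: LP. Qed.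

(** Gram matrices account for complete positivity. The other two kinds form real subspaces, so that
    a real-linear functional nonnegative on the cone vanishes on them. *)
Definition cp_cone : set E := [set m | exists (T : seq (finsupp H A)) (n l : E),
  [/\ antihermitian n, forall z, ideal_core (l z) & m = \sum_(Y <- T) gram Y + n + l]].

Let core0 (z : H * H) : ideal_core ((0 : E) z).
Proof. by rewrite finsupp0; split; rewrite ?cstar0. Qed.

Let anti0 : antihermitian 0.
Proof. by move=> z; rewrite !finsupp0 cstar0 oppr0. Qed.

Lemma cp_cone0 : cp_cone 0.
Proof. by exists [::], 0, 0; rewrite big_nil !addr0. Qed.

Lemma cp_coneD x y : cp_cone x -> cp_cone y -> cp_cone (x + y).
Proof.
move=> [T [n [l [na lL ->]]]] [T' [n' [l' [n'a l'L ->]]]].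
exists (T ++ T'), (n + n'), (l + l'); split.
- by move=> z; rewrite !finsuppD cstarD opprD na n'a.
- move=> z; have [? ?] := lL z; have [? ?] := l'L z.
  by split; rewrite finsuppD ?cstarD; exact: LD.
- by rewrite big_cat /= addrACA [X in X + _ = _]addrACA.
Qed.

Lemma gramZ (r : R) Y : 0 <= r ->
  r%:C%C *: gram Y = gram ((Num.sqrt r)%:C%C *: Y).
Proof.
move=> r0; apply: finsupp_ext => z.
rewrite finsuppZ !gramE !finsuppZ cstarZr -scaleAl -scaleAr scalerA -rmorphM.
by rewrite -expr2 sqr_sqrtr.
Qed.

Lemma cp_coneZ (r : R) x : 0 <= r -> cp_cone x -> cp_cone (r%:C%C *: x).
Proof.
move=> r0 [T [n [l [na lL ->]]]].
exists [seq (Num.sqrt r)%:C%C *: Y | Y <- T], (r%:C%C *: n), (r%:C%C *: l); split.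
- by move=> z; rewrite !finsuppZ cstarZr na scalerN.
- by move=> z; have [? ?] := lL z; split; rewrite finsuppZ ?cstarZr; exact: LZ.
- rewrite !scalerDr scaler_sumr big_map; congr (_ + _ + _).
  by apply: eq_bigr => Y _; rewrite gramZ.
Qed.

Lemma cp_cone_gram Y : cp_cone (gram Y).
Proof. by exists [:: Y], 0, 0; rewrite big_seq1 !addr0. Qed.

Lemma cp_cone_antihermitian (n : E) : antihermitian n -> cp_cone n.
Proof. by move=> na; exists [::], n, 0; rewrite big_nil add0r addr0. Qed.

Lemma cp_cone_core (l : E) : (forall z, ideal_core (l z)) -> cp_cone l.
Proof. by move=> lL; exists [::], 0, l; rewrite big_nil !add0r. Qed.

Let M : set E := [set m | forall z, S (m z)].

Let SP (a : R[i]) x y : S x -> S y -> S (a *: x + y).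
Proof. by case: Ssys => -[_ +] _ _; exact. Qed.

Let S0 : S 0. Proof. by case: Ssys => -[]. Qed.

Let S1 : S 1. Proof. by case: Ssys. Qed.

Let SC x : S x -> S (cstar x). Proof. by case: Ssys => _ + _; exact. Qed.

(** Adding to [m] its adjoint cancels the antihermitian part, doubles the Gram part and keeps the
    ideal part in [L]; the form of the sum is twice the real part, and [quotient_order_form]
    applies. *)
Lemma pairing_ge0 m : M m -> cp_cone m -> 0 <= complex.Re (pairing m).
Proof.
move=> Mm [T [l0 [l [na lL mE]]]].
have [n [p ->]] := pairing_points m.
pose x : 'M[A]_n := \matrix_(i, j) (m (p j, p i) + cstar (m (p i, p j))).
pose k : 'M[A]_n := \matrix_(i, j) (l (p j, p i) + cstar (l (p i, p j))).
pose Ys : seq ('I_n -> A) := map (fun (Y : finsupp H A) i => Y (p i)) (T ++ T).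
have := @quotient_order_form _ _ _ _ _ sigmaP sigma_inj VV _ _ Ssys Lideal SL n Ys
  x k p.
have -> : \sum_j \sum_i hdot (sigma (x i j) (p j)) (p i) =
  \sum_j \sum_i hdot (sigma (m (p j, p i)) (p j)) (p i) +
  Num.conj (\sum_j \sum_i hdot (sigma (m (p j, p i)) (p j)) (p i)).
  rewrite rmorph_sum; under [X in _ = _ + X]eq_bigr do rewrite rmorph_sum /=.
  rewrite [X in _ = _ + X]exchange_big -big_split; apply: eq_bigr => j _ /=.
  rewrite -big_split; apply: eq_bigr => i _ /=.
  rewrite mxE sigmaD hdotDl; congr (_ + _).
  have [_ _ _ sS] := sigmaP; rewrite sS.
  transitivity (hdot (bop_adj (sigma (m (p i, p j))) (p j)) (p i)) => //.
  by rewrite hdot_adjl hdotC.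
set w := \sum_j _; have -> : complex.Re (w + Num.conj w) = 2 * complex.Re w.
  by case: w => a b /=; ring.
have h : mx_over S x /\ mx_over L k /\
    x = \sum_(y <- Ys) (\matrix_(i, j) (cstar (y i) * y j)) + k.
  split; first by move=> i j; rewrite mxE -[m _]scale1r; apply: SP => //; exact: SC.
  split.
    move=> i j; rewrite mxE; have [+ _] := lL (p j, p i); have [_ +] := lL (p i, p j).
    by move=> ? ?; exact: LD.
  apply/matrixP => i j; rewrite !mxE summxE /Ys big_map big_cat /=.
  have gE i' j' : m (p i', p j') = \sum_(Y <- T) cstar (Y (p j')) * Y (p i') +
      l0 (p i', p j') + l (p i', p j').
    by rewrite mE !finsuppD finsupp_sum.
  have cs (F : finsupp H A -> A) : cstar (\sum_(Y <- T) F Y) = \sum_(Y <- T) cstar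
    (F Y).
    exact: (big_morph cstar (@cstarD _ A) (cstar0 (A := A))).
  rewrite !gE !cstarD cs.
  have -> : cstar (l0 (p i, p j)) = - l0 (p j, p i) by rewrite (na (p i, p j)) opprK.
  have -> : \sum_(Y <- T) cstar (cstar (Y (p j)) * Y (p i)) =
      \sum_(Y <- T) cstar (Y (p i)) * Y (p j).
    by apply: eq_bigr => Y _; rewrite cstarMr cstarK.
  under [in RHS]eq_bigr do rewrite mxE.
  set s := \sum_(Y <- T) _; set l1 := l0 _; set l2 := l _; set l3 := cstar (l _).
  by rewrite (AC (3*3) ((1*4)*(2*5)*(3*6)))/= subrr addr0 -addrA.
by move=> /(_ h.1 h.2.1 h.2.2); lra.
Qed.

(** For a single entry, [|a|^2 delta_pp + delta_qq - 2 a delta_pq] is, up to an antihermitian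
    matrix, the Gram matrix of [a delta_p - delta_q] plus that of [d delta_p], where
    [d^2 = |a|^2 - a^* a]. *)
Lemma cp_cone_cofinal x : exists2 m, M m & cp_cone (m - x).
Proof.
move: x; apply: finsupp_ind => [|f g [mf Mf Cf] [mg Mg Cg]|[p q] a].
- by exists 0; [move=> z; rewrite finsupp0|rewrite subrr; exact: cp_cone0].
- exists (mf + mg); last by rewrite opprD addrACA; exact: cp_coneD.
  by move=> z; rewrite finsuppD -[mf z]scale1r; exact: SP.
have hp : cpos ((rnorm a ^+ 2)%:C%C *: (1 : A) - cstar a * a).
  by apply: cposB; rewrite ?cstarMr ?cstarK// rnorm_starM.
have [d [ds dd _ _]] := cpos_sqrt hp.
pose m := (rnorm a ^+ 2)%:C%C *: delta (p, p) (1 : A) + delta (q, q) (1 : A).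
pose n := delta (q, p) (cstar a) - delta (p, q) a.
have nanti : antihermitian n.
  move=> [p' q']; rewrite !finsuppD !finsuppN !deltaE /= !xpair_eqE.
  rewrite [(p' == q) && _]andbC [(p' == p) && _]andbC.
  by case: ifP => _; case: ifP => _; rewrite !(cstarB, cstarK, cstar0, opprB).
have dM p1 p2 (b c : A) z : cstar (delta p1 b z.2) * delta p2 c z.1 =
    delta (p2, p1) (cstar b * c) z.
  case: z => p' q'; rewrite !deltaE /= xpair_eqE andbC.
  by case: eqP => _; case: eqP => _; rewrite ?cstar0 ?mul0r ?mulr0.
have mE : m - (delta (p, q) a + delta (p, q) a) =
    gram (delta p a - delta q (1 : A)) + gram (delta p d) + n.
  apply: finsupp_ext => z; rewrite /m /n.
  rewrite !(finsuppD, finsuppN, finsuppZ, gramE) cstarB mulrBl !mulrBr !dM.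
  rewrite ds dd cstar1 !mul1r mulr1.
  have -> : delta (p, p) ((rnorm a ^+ 2)%:C%C *: (1 : A) - cstar a * a) z =
      (rnorm a ^+ 2)%:C%C *: delta (p, p) (1 : A) z - delta (p, p) (cstar a * a) z.
    by rewrite !deltaE; case: eqP => _; rewrite ?scaler0 ?subr0.
  rewrite opprB opprD.
  by rewrite [RHS](AC (((2*2)*2)*2) (((1*6)*(2*7))*((5*3)*(4*8))))/= subrr addNr !add0r.
have half0 : 0 <= (2^-1 : R) by rewrite invr_ge0.
exists ((2^-1)%:C%C *: m).
  move=> z; rewrite /m finsuppZ finsuppD finsuppZ !deltaE -[_ *: (_ + _)]addr0.
  apply: SP => //; apply: SP; first by case: ifP.
  by case: ifP.
have -> : (2^-1)%:C%C *: m - delta (p, q) a =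
    (2^-1)%:C%C *: (m - (delta (p, q) a + delta (p, q) a)).
  rewrite [RHS]scalerBr; congr (_ - _).
  rewrite -[in RHS](scale1r (delta (p, q) a)) -scalerDl scalerA -[LHS]scale1r;
    congr (_ *: _).
  by rewrite -[1](rmorph1 (@real_complex R)) -rmorphD -rmorphM /=; congr (_%:C)%C;
    field.
apply: cp_coneZ => //; rewrite mE; apply: cp_coneD; first apply: cp_coneD.
- exact: cp_cone_gram.
- exact: cp_cone_gram.
- exact: cp_cone_antihermitian.
Qed.

(** The real part of [pairing] is extended from matrices over [S], complexified, and evaluated on
    matrices with a single entry. *)
Lemma cp_kernel_extension : exists Psi : cpkernel A H,
  (forall s p q, S s -> Psi s p q = hdot (sigma s p) q) /\
  forall l p q, ideal_core l -> Psi l p q = 0.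
Proof.
have pairingPr (r : R) x y : complex.Re (pairing (r%:C%C *: x + y)) =
    r * complex.Re (pairing x) + complex.Re (pairing y).
  rewrite pairingP; case: (pairing x) (pairing y) => [a b] [c d] /=.
  by rewrite mul0r subr0.
have [|||||g [glin gM gC]] := @riesz_extension R E cp_cone M
  (fun m => complex.Re (pairing m)) cp_cone0 cp_coneD cp_coneZ.
- by move=> z; rewrite finsupp0.
- by move=> r x y Mx My z; rewrite finsuppD finsuppZ; exact: SP.
- by move=> r x y _ _; exact: pairingPr.
- exact: pairing_ge0.
- exact: cp_cone_cofinal.
have g_null (n : E) : cp_cone n -> cp_cone (- n) -> g n = 0.
  move=> Cn CNn; have := gC _ Cn; have := gC _ CNn.
  have := glin (-1) n 0; have := glin 1 0 0.
  by rewrite rmorphN !scaleN1r scaler0 !addr0; lra.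
have g_anti (n : E) : antihermitian n -> g n = 0.
  move=> na; apply: g_null; first exact: cp_cone_antihermitian.
  by apply: cp_cone_antihermitian => z; rewrite !finsuppN cstarN na.
have g_core (l : E) : (forall z, ideal_core (l z)) -> g l = 0.
  move=> lL; apply: g_null; first exact: cp_cone_core.
  apply: cp_cone_core => z; have [? ?] := lL z.
  by rewrite finsuppN -scaleN1r; split; rewrite ?cstarZ; exact: LZ.
pose Psi (c : A) (p q : H) := complexify g (delta (p, q) c).
have Psi_cp : cp_kernel Psi.
  split=> [c x y p q|t]; first by rewrite /Psi deltaP complexifyP.
  pose Y := \sum_(u <- t) delta u.2 u.1.
  have -> : cp_sum Psi t = complexify g (gram Y).
    have cD x y : complexify g (x + y) = complexify g x + complexify g y.
      by have := complexifyP glin 1 x y; rewrite scale1r mul1r.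
    have c0 : complexify g 0 = 0.
      have := complexifyP glin 1 0 0; rewrite scaler0 addr0 mul1r => /eqP.
      by rewrite -[X in X == _]addr0 (inj_eq (addrI _)) eq_sym => /eqP.
    have -> : gram Y = \sum_(u <- t) \sum_(v <- t) delta (u.2, v.2) (cstar v.1 * u.1).
      apply: finsupp_ext => z; rewrite gramE /Y !finsupp_sum mulr_sumr.
      apply: eq_bigr => u _; rewrite finsupp_sum.
      rewrite (big_morph cstar (@cstarD _ A) (cstar0 (A := A))) mulr_suml.
      apply: eq_bigr => v _; case: z => p q; rewrite !deltaE /= xpair_eqE andbC.
      by case: eqP => _; case: eqP => _; rewrite ?cstar0 ?mul0r ?mulr0.
    rewrite (big_morph (complexify g) cD c0); apply: eq_bigr => u _.
    by rewrite (big_morph (complexify g) cD c0).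
  (* A Gram matrix is hermitian, so [i] times it is antihermitian and the value is real. *)
  rewrite /complexify (g_anti ('i%C *: gram Y)).
    by rewrite oppr0 ler0c; apply: gC; exact: cp_cone_gram.
  by move=> z; rewrite !finsuppZ !gramE cstarZ conjCi scaleNr opprK cstarMr cstarK.
exists (CPKernel Psi_cp); split => [s p q Ss|l p q [Ll Lls]] /=.
- have Md c : S c -> M (delta (p, q) c) by move=> Sc z; rewrite deltaE; case: ifP.
  (* The imaginary part is read off at [i s], which again lies in [S]. *)
  have iS : S ('i%C *: s) by rewrite -[_ *: _]addr0; exact: SP.
  rewrite /Psi /complexify (_ : 'i%C *: delta (p, q) s = delta (p, q) ('i%C *: s));
    last first.
    by have := deltaP (p, q) 'i%C s 0; rewrite addr0 (_ : delta (p, q) 0 = 0) ?addr0//;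
      apply: finsupp_ext => z; rewrite deltaE; case: ifP.
  rewrite !gM//; [|exact: Md|exact: Md]; rewrite !pairing_delta /=.
  have [slin _ _ _] := sigmaP.
  have := slin 'i%C s 0; rewrite sigma0 !addr0 => ->.
  rewrite bopZ hdotZl; case: (hdot _ _) => a b /=.
  by rewrite mul0r mul1r sub0r opprK.
- have core c : ideal_core (c *: l).
    by split; rewrite ?cstarZ; exact: LZ.
  have dL c z : ideal_core ((c *: delta (p, q) l) z).
    rewrite finsuppZ deltaE; case: ifP => _; first exact: core.
    by rewrite scaler0; split; rewrite ?cstar0.
  rewrite /Psi /complexify (g_core ('i%C *: delta (p, q) l))// oppr0.
  by have := dL 1; rewrite scale1r => /g_core ->.
Qed.
End CompletelyPositiveExtension.

(** For [x] in [L], [cstar x * x] lies in the self-adjoint part of [L]; there [Psi] vanishes, while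
    uniqueness identifies [Psi] with the form of the injective [sigma]. *)
Lemma boundary_ideal_hyperrigid (R : realType) (A : cstarType R) (S L : set A) :
  operator_system S -> hyperrigid S -> closed_ideal L ->
  quotient_completely_isometric S L -> L `<=` [set 0].
Proof.
move=> Ssys hS Lid SL; have [H [sigma [V [sigmaP sigma_inj VV]]]] :=
  faithful_representation A.
have [Psi [PsiS PsiL]] := cp_kernel_extension sigmaP sigma_inj VV Ssys Lid SL.
have [_ SC S1] := Ssys.
have core0 l : ideal_core L l -> l = 0.
  move=> Ll; apply: sigma_inj; apply: bopP => p; apply: hdotP => q.
  have [slin _ _ _] := sigmaP.
  have -> : sigma 0 = 0.
    have := slin 1 0 0; rewrite !scale1r addr0 => /eqP.
    by rewrite -[X in X == _]addr0 (inj_eq (addrI _)) eq_sym => /eqP.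
  rewrite bop0 linear0r [LHS]hdotC -(hyperrigid_cp_unique sigmaP S1 SC PsiS hS).
  by rewrite PsiL// conjC0.
move=> x Lx; have [_ Ll _ _] := Lid.
have /core0 xx : ideal_core L (cstar x * x).
  by split; rewrite ?cstarMr ?cstarK; exact: Ll.
apply: rnorm_eq0; apply/eqP; rewrite -sqrf_eq0 -rnorm_starM; apply/eqP.
by rewrite xx rnorm0.
Qed.

Lemma closed_ideal0 (R : realType) (A : cstarType R) : closed_ideal [set (0 : A)].
Proof.
split.
- by split=> // a x y -> ->; rewrite scaler0 addr0.
- by move=> a x ->; rewrite mulr0.
- by move=> a x ->; rewrite mul0r.
- exact/accessible_closed_set1/hausdorff_accessible/norm_hausdorff.
Qed.

Lemma quotient_completely_isometric0 (R : realType) (A : cstarType R) (S : set A) :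
  quotient_completely_isometric S [set 0].
Proof.
move=> n N _ x _; rewrite /quotient_norm.
suff -> : [set N (x + k) | k in mx_over [set 0]] = [set N x] by rewrite inf1.
apply/seteqP; split=> [_ [k k0 <-]|_ ->].
  have -> : k = 0 by apply/matrixP => i j; rewrite k0 mxE.
  by rewrite addr0.
by exists 0; rewrite ?addr0// => i j; rewrite mxE.
Qed.

Theorem corollary4p2 (R : realType) (A : cstarType R) (S : set A) :
  operator_system S -> separable_set S -> cstar_generated S = setT ->
  hyperrigid S ->
  (forall (H : hilbertType R) (pi : A -> bounded_op H),
     representation pi -> irreducible_rep pi -> boundary_representation S pi) /\
  is_boundary_ideal S [set 0].
Proof.
move=> Ssys _ _ hS; split=> [H pi|]; first exact: boundary_representation_hyperrigid.
split; [exact: closed_ideal0|exact: quotient_completely_isometric0|].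
by move=> L; exact: boundary_ideal_hyperrigid.
Qed.
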